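(* Let $\Omega\subset\mathbb{C}$ be an unbounded convex domain, $J\subsetneq\partial\Omega$ a relatively open subset of its boundary, and $p\in\{0,1,2,\dots\}$. Let $\phi:\overline{D}\to\overline{\Omega}\cup\{\infty\}$ be a Riemann map of $D$ onto $\Omega$ (extended continuously to the closed unit disc), and $L=\phi^{-1}(J)$. Then the set of functions $f\in A^p(\Omega,J)$ such that $\operatorname{Re}(f^{(p)}\circ\phi)$ and $\operatorname{Im}(f^{(p)}\circ\phi)$ are nowhere differentiable on $L$ contains a $G_\delta$ and dense subset of $A^p(\Omega,J)$.
   Context: $D$ is the open unit disc; $\partial\Omega$ and $\overline\Omega$ are taken in $\mathbb{C}$. $A^p(\Omega,J)$ is the set of holomorphic functions $f:\Omega\to\mathbb{C}$ such that for every integer $0\le l\le p$ the derivative $f^{(l)}$ extends continuously to $\Omega\cup J$ (extensions are denoted by the same symbol), with the Fréchet topology induced by the seminorms $\sup_{z\in\Delta_m}|f^{(l)}(z)|$, $0\le l\le p$, $m=1,2,\dots$, where $\Delta_m=\{z\in\Omega\cup J:\operatorname{dist}(z,\partial\Omega\setminus J)\ge\frac1m,\ |z|\le m\}$. A function $u:L\to\mathbb{R}$, $L\subset\partial D$ relatively open, is nowhere differentiable if $\theta\mapsto u(e^{i\theta})$ is not differentiable at any real $\theta$ with $e^{i\theta}\in L$. *)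

(* Defs.v *)
From Stdlib Require Import Reals.
From Coquelicot Require Import Coquelicot.
Open Scope R_scope.

Definition closure (S : C -> Prop) (z : C) : Prop :=
  forall V : C -> Prop, locally z V -> exists w, V w /\ S w.

Definition boundary (S : C -> Prop) (z : C) : Prop :=
  closure S z /\ closure (fun w => ~ S w) z.

Definition connected (S : C -> Prop) : Prop :=
  ~ exists U V : C -> Prop,
      open U /\ open V /\
      (forall z, S z -> U z \/ V z) /\
      (exists z, S z /\ U z) /\ (exists z, S z /\ V z) /\
      (forall z, S z -> ~ (U z /\ V z)).

Definition is_domain (S : C -> Prop) : Prop :=
  open S /\ (exists z, S z) /\ connected S.

Definition convex (S : C -> Prop) : Prop :=
  forall (z w : C) (t : R), S z -> S w -> 0 <= t <= 1 ->
    S (RtoC (1 - t) * z + RtoC t * w)%C.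

Definition unbounded (S : C -> Prop) : Prop :=
  forall M : R, exists z, S z /\ M < Cmod z.

Definition relatively_open_subset (X J : C -> Prop) : Prop :=
  exists U : C -> Prop, open U /\ forall z, J z <-> X z /\ U z.

Definition disc (z : C) : Prop := Cmod z < 1.
Definition closed_disc (z : C) : Prop := Cmod z <= 1.

(* Infimum of the distances; [p_infty] when [S] is empty. *)
Definition dist_to (S : C -> Prop) (z : C) : Rbar :=
  Glb_Rbar (fun r => exists w, S w /\ r = Cmod (z - w)%C).

Definition holomorphic_on (S : C -> Prop) (f : C -> C) : Prop :=
  forall z, S z -> ex_derive (K := C_AbsRing) (V := C_NormedModule) f z.

Definition C_derive_n (n : nat) (f : C -> C) : C -> C := Nat.iter n C_derive f.

Definition extends_continuously (Omega J : C -> Prop) (g : C -> C) : Prop :=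
  exists G : C -> C,
    (forall z, Omega z -> G z = g z) /\
    continuous_on (fun z => Omega z \/ J z) G.

(* The extension of [g] from Omega to closure points of Omega, as the limit
   along Omega; an unspecified value where this limit does not exist. *)
Definition extension (Omega : C -> Prop) (g : C -> C) (z : C) : C :=
  lim (T := C_CompleteNormedModule) (filtermap g (within Omega (locally z))).

(* A function Omega -> C is represented by its extension by 0 outside Omega, so
   that distinct elements of the type differ at some point of Omega.  In
   particular the values of [f] on [J] carry no information: boundary values
   are obtained through [extension]. *)
Definition in_Ap (Omega J : C -> Prop) (p : nat) (f : C -> C) : Prop :=
  (forall z, ~ Omega z -> f z = 0%C) /\
  holomorphic_on Omega f /\
  forall l : nat, (l <= p)%nat -> extends_continuously Omega J (C_derive_n l f).

Definition Ap (Omega J : C -> Prop) (p : nat) : Type :=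
  { f : C -> C | in_Ap Omega J p f }.

Definition Ap_fun {Omega J : C -> Prop} {p : nat} (f : Ap Omega J p) : C -> C :=
  proj1_sig f.

Definition Ap_deriv {Omega J : C -> Prop} {p : nat} (f : Ap Omega J p)
    (l : nat) : C -> C :=
  extension Omega (C_derive_n l (Ap_fun f)).

Definition Delta (Omega J : C -> Prop) (m : nat) (z : C) : Prop :=
  (Omega z \/ J z) /\
  Rbar_le (1 / INR m) (dist_to (fun w => boundary Omega w /\ ~ J w) z) /\
  Cmod z <= INR m.

(* The value 0 is included so that the supremum over an empty [Delta] is 0. *)
Definition seminorm (Omega J : C -> Prop) (l m : nat) (h : C -> C) : Rbar :=
  Lub_Rbar (fun r => r = 0 \/
    exists z, Delta Omega J m z /\
              r = Cmod (extension Omega (C_derive_n l h) z)).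

(* The topology generated by the seminorms with l <= p and m >= 1. *)
Definition Ap_open {Omega J : C -> Prop} {p : nat}
    (U : Ap Omega J p -> Prop) : Prop :=
  forall f, U f -> exists (N : nat) (eps : posreal), forall g : Ap Omega J p,
    (forall l m : nat, (l <= p)%nat -> (1 <= m <= N)%nat ->
       Rbar_lt
         (seminorm Omega J l m (fun z => (Ap_fun g z - Ap_fun f z)%C)) eps) ->
    U g.

Definition Ap_Gdelta {Omega J : C -> Prop} {p : nat}
    (G : Ap Omega J p -> Prop) : Prop :=
  exists O : nat -> Ap Omega J p -> Prop,
    (forall n, Ap_open (O n)) /\ forall f, G f <-> forall n, O n f.

Definition Ap_dense {Omega J : C -> Prop} {p : nat}
    (G : Ap Omega J p -> Prop) : Prop :=
  forall U : Ap Omega J p -> Prop,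
    Ap_open U -> (exists f, U f) -> exists f, U f /\ G f.

(* Neighbourhoods in the Riemann sphere [option C], where [None] is infinity. *)
Definition sphere_locally (x : option C) (P : option C -> Prop) : Prop :=
  match x with
  | Some w => locally w (fun v => P (Some v))
  | None => P None /\ exists M : R, forall v, M < Cmod v -> P (Some v)
  end.

Definition biholomorphic (S T : C -> Prop) (g : C -> C) : Prop :=
  holomorphic_on S g /\ (forall z, S z -> T (g z)) /\
  exists h : C -> C,
    holomorphic_on T h /\ (forall w, T w -> S (h w)) /\
    (forall z, S z -> h (g z) = z) /\ (forall w, T w -> g (h w) = w).

(* Only the values of [phi] on the closed disc are relevant. *)
Definition extended_riemann_map (Omega : C -> Prop) (phi : C -> option C) : Prop :=
  (exists g : C -> C,
     biholomorphic disc Omega g /\ forall z, disc z -> phi z = Some (g z)) /\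
  (forall z w, closed_disc z -> phi z = Some w -> closure Omega w) /\
  (forall z, closed_disc z ->
     filterlim phi (within closed_disc (locally z)) (sphere_locally (phi z))).

Definition phi_preimage (phi : C -> option C) (J : C -> Prop) (z : C) : Prop :=
  closed_disc z /\ exists w, phi z = Some w /\ J w.

(* The value at points sent to infinity is a dummy. *)
Definition comp_phi (F : C -> C) (phi : C -> option C) (z : C) : C :=
  match phi z with Some w => F w | None => 0%C end.

Definition cis (theta : R) : C := (cos theta, sin theta).

(* The values of [u] matter only on [L], which is relatively open in the unit
   circle in the intended use. *)
Definition nowhere_differentiable (L : C -> Prop) (u : C -> R) : Prop :=
  forall theta : R, L (cis theta) -> ~ ex_derive (fun t => u (cis t)) theta.

(* Main.v *)
From Stdlib Require Import Reals Lra Lia ZArith List Classical ClassicalEpsilon.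
From Coquelicot Require Import Coquelicot.
Require Import Defs.
Open Scope R_scope.

(** Let h : Omega -> D be the inverse of the Riemann map and W the lacunary series
    with terms z^(1024^k) / 16^k. As Omega is convex, h is Lipschitz
    ([convex_inverse_lipschitz]); so it extends to the boundary, where it inverts
    phi ([inverse_boundary_limit]). The composition of W and h is therefore bounded
    and uniformly continuous on Omega, and integrating it p times along segments
    gives an element w of A^p whose p-th derivative, read through phi, is W
    ([lacunary_antiderivative]). For every f in A^p and every complex a the
    boundary trace of the p-th derivative of f + a w at e^(is) is thus the trace
    of f plus a W(e^(is)).

    If the real or imaginary part of a trace is differentiable at a point of L,
    then for all large N its increments from this point are bounded by N times the
    distance, up to the distance 1/N: it is slow at scale 1/N
    ([differentiable_slow]). The functions that are not slow at scale 1/N form an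
    open set ([not_slow_open]), so those that are not slow at any of these scales
    form a G-delta set G of functions with nowhere differentiable parts.

    For the density of G it is enough to vary a, with f fixed. By an argument of
    Hunt, if f + a w and f + a' w are slow at points of a common
    interval of length pi / 1024^k, then a - a' is of order 64^-k, because W
    oscillates by 16^-k on such an interval ([lacunary_oscillation],
    [slow_close]). There are about (32^k)^2 such intervals; a square grid with more
    coefficients than that, in a fixed disc of the plane, can have a mesh of order
    32^-k, which is far larger. So some coefficient of the grid is not slow
    ([exists_not_slow]), and Baire's theorem in the plane of coefficients
    ([baire_plane]) gives arbitrarily small a for which f + a w is in G.

    The function theory starts from Goursat's lemma ([goursat]). In the coordinate
    log u, means over circles around 0 become integrals over vertical periods in a
    half-plane, so Goursat's lemma shows that they do not depend on the radius
    ([circle_mean]). This yields Cauchy's formula for the derivative at the centre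
    of a disc, hence the smoothness of holomorphic functions
    ([derivative_holomorphic]), and for functions with nonnegative real part a
    gradient estimate and Harnack's inequality ([gradient_estimate], [harnack]).
    The last two, applied to h and to the distance to a supporting line of Omega,
    give the Lipschitz bound for h. *)

(** * Complex differentiability and continuity in terms of the modulus *)

Notation is_Cderive := (@is_derive C_AbsRing C_NormedModule).
Notation ex_Cderive := (@ex_derive C_AbsRing C_NormedModule).

Lemma Rlt_Rmin (x a b : R) : x < Rmin a b -> x < a /\ x < b.
Proof. generalize (Rmin_l a b) (Rmin_r a b). lra. Qed.

Lemma Rmax_Rle (x a b : R) : Rmax a b <= x -> a <= x /\ b <= x.
Proof. generalize (Rmax_l a b) (Rmax_r a b). lra. Qed.

Definition pos_min (a b : posreal) : posreal := mkposreal _ (Rmin_stable_in_posreal a b).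

Lemma Cmod_diag (z : C) : Cmod (z - z) = 0.
Proof. replace (z - z)%C with (RtoC 0) by ring. apply Cmod_0. Qed.

Lemma Cmod_minus_sym (z w : C) : Cmod (z - w) = Cmod (w - z).
Proof. rewrite <- Cmod_opp. f_equal. ring. Qed.

Lemma Cmod_triangle_minus (z w : C) : Cmod (z - w) <= Cmod z + Cmod w.
Proof.
  unfold Cminus. eapply Rle_trans; [apply Cmod_triangle|]. rewrite Cmod_opp. lra.
Qed.

Lemma Cmod_ge_minus (z w : C) : Cmod z - Cmod w <= Cmod (z - w).
Proof.
  generalize (Cmod_triangle (z - w) w). replace (z - w + w)%C with z by ring. lra.
Qed.

Lemma Cmod_between (z u w : C) : Cmod (z - w) <= Cmod (z - u) + Cmod (u - w).
Proof.
  replace (z - w)%C with ((z - u) + (u - w))%C by ring. apply Cmod_triangle.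
Qed.

Lemma im_le_Cmod (z : C) : Rabs (Im z) <= Cmod z.
Proof.
  eapply Rle_trans; [|apply Rmax_Cmod]. apply Rmax_r.
Qed.

Lemma Cmod_le_abs (z : C) : Cmod z <= Rabs (Re z) + Rabs (Im z).
Proof.
  replace z with (RtoC (Re z) + Ci * RtoC (Im z))%C at 1.
  - eapply Rle_trans; [apply Cmod_triangle|].
    rewrite Cmod_mult, Cmod_Ci, !Cmod_R. lra.
  - destruct z as [x y]. unfold RtoC, Ci, Cmult, Cplus; simpl. f_equal; ring.
Qed.

Lemma re_minus (z w : C) : Re (z - w)%C = Re z - Re w.
Proof. reflexivity. Qed.

Lemma im_minus (z w : C) : Im (z - w)%C = Im z - Im w.
Proof. reflexivity. Qed.

Lemma Cmod_RtoC_pos (x : R) : 0 <= x -> Cmod (RtoC x) = x.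
Proof. intros Hx. rewrite Cmod_R. now apply Rabs_pos_eq. Qed.

(** The topology of the plane is generated by squares, complex derivatives are
    defined with modulus balls; this is the bridge between the two. *)
Lemma locally_Cmod (z : C) (P : C -> Prop) :
  locally z P <-> exists d : posreal, forall w, Cmod (w - z) < d -> P w.
Proof.
  rewrite locally_C. split; intros [d Hd]; exists d; intros w Hw; apply Hd; exact Hw.
Qed.

Lemma open_Cmod (S : C -> Prop) (z : C) :
  open S -> S z -> exists d : posreal, forall w, Cmod (w - z) < d -> S w.
Proof. intros HS Hz. apply locally_Cmod. now apply HS. Qed.

Lemma is_Cderive_eps (f : C -> C) (z l : C) :
  is_Cderive f z l <->
  forall eps : posreal, exists d : posreal, forall w, Cmod (w - z) < d ->
    Cmod (f w - f z - l * (w - z)) <= eps * Cmod (w - z).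
Proof.
  split.
  - intros [_ Hd] eps.
    destruct (Hd z (fun P HP => HP) eps) as [d H].
    exists d. intros w Hw. specialize (H w Hw).
    replace (l * (w - z))%C with ((w - z) * l)%C by ring. exact H.
  - intros H. split.
    + apply is_linear_scal_l.
    + intros x Hx eps.
      assert (x = z) as ->.
      { symmetry. apply (is_filter_lim_locally_unique (K := C_AbsRing)
           (V := AbsRing_NormedModule C_AbsRing)). exact Hx. }
      destruct (H eps) as [d Hd]. exists d. intros w Hw.
      specialize (Hd w Hw).
      replace (l * (w - z))%C with ((w - z) * l)%C in Hd by ring. exact Hd.
Qed.

Definition has_lim (S : C -> Prop) (g : C -> C) (z L : C) : Prop :=
  forall eps : posreal, exists d : posreal, forall w,
    S w -> Cmod (w - z) < d -> Cmod (g w - L) < eps.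

Definition cont_within (S : C -> Prop) (f : C -> C) (z : C) : Prop := has_lim S f z (f z).

Definition cont_at (f : C -> C) (z : C) : Prop := cont_within (fun _ => True) f z.

Lemma filterlim_within_C (S : C -> Prop) (f : C -> C) (z l : C) :
  filterlim f (within S (locally z)) (locally l) <-> has_lim S f z l.
Proof.
  split.
  - intros H eps.
    assert (HP : locally l (fun v : C => Cmod (v - l) < eps)).
    { apply locally_Cmod. exists eps. auto. }
    specialize (H _ HP). apply (proj1 (locally_Cmod z _)) in H.
    destruct H as [d Hd]. exists d. intros w Sw Hw. exact (Hd w Hw Sw).
  - intros H P HP. apply locally_Cmod in HP. destruct HP as [e He].
    destruct (H e) as [d Hd]. apply (proj2 (locally_Cmod z _)).
    exists d. intros w Hw Sw. apply He. now apply Hd.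
Qed.

Lemma continuous_RC (f : R -> C) (t : R) :
  continuous f t <->
  forall eps : posreal, exists d : posreal, forall s,
    Rabs (s - t) < d -> Cmod (f s - f t) < eps.
Proof.
  split.
  - intros H eps.
    assert (HP : locally (f t) (fun v : C => Cmod (v - f t) < eps)).
    { apply locally_Cmod. exists eps. auto. }
    destruct (H _ HP) as [d Hd]. exists d. intros s Hs. apply Hd. exact Hs.
  - intros H P HP. apply locally_Cmod in HP. destruct HP as [e He].
    destruct (H e) as [d Hd]. exists d. intros w Hw. apply He. now apply Hd.
Qed.

Lemma is_Cderive_cont (f : C -> C) (z l : C) (S : C -> Prop) :
  is_Cderive f z l -> cont_within S f z.
Proof.
  intros H eps. destruct (proj1 (is_Cderive_eps f z l) H (mkposreal 1 Rlt_0_1)) as [d Hd].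
  assert (HK : 0 < 2 * (1 + Cmod l)) by (generalize (Cmod_ge_0 l); lra).
  assert (Hm : 0 < Rmin d (eps / (2 * (1 + Cmod l)))).
  { apply Rmin_glb_lt; [apply cond_pos|]. apply Rdiv_lt_0_compat; [apply cond_pos|lra]. }
  exists (mkposreal _ Hm). simpl. intros w _ Hw.
  destruct (Rlt_Rmin _ _ _ Hw) as [H1 H2].
  specialize (Hd w H1). simpl in Hd.
  assert (Cmod (f w - f z) <= (1 + Cmod l) * Cmod (w - z)).
  { replace (f w - f z)%C with ((f w - f z - l * (w - z)) + l * (w - z))%C by ring.
    eapply Rle_trans; [apply Cmod_triangle|]. rewrite Cmod_mult. lra. }
  apply Rlt_div_r in H2; [|lra]. generalize (cond_pos eps). lra.
Qed.

Lemma holomorphic_cont (S : C -> Prop) (f : C -> C) (z : C) (T : C -> Prop) :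
  holomorphic_on S f -> S z -> cont_within T f z.
Proof. intros H Sz. destruct (H z Sz) as [l Hl]. now apply (is_Cderive_cont f z l). Qed.

Lemma C_derive_is (f : C -> C) (z : C) : ex_Cderive f z -> is_Cderive f z (C_derive f z).
Proof. apply C_derive_correct. exact z. Qed.

Lemma is_Cderive_local (f g : C -> C) (z l : C) (d : posreal) :
  (forall w, Cmod (w - z) < d -> f w = g w) -> is_Cderive f z l -> is_Cderive g z l.
Proof.
  intros E H. rewrite is_Cderive_eps in H |- *. intros eps. destruct (H eps) as [d1 H1].
  exists (pos_min d d1). simpl. intros w Hw.
  rewrite <- !E.
  - apply H1. eapply Rlt_le_trans; [exact Hw|apply Rmin_r].
  - rewrite Cmod_diag. apply cond_pos.
  - eapply Rlt_le_trans; [exact Hw|apply Rmin_l].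
Qed.

Lemma is_Cderive_eq (f : C -> C) (z l l' : C) : is_Cderive f z l -> l = l' -> is_Cderive f z l'.
Proof. now intros H <-. Qed.

(** The plane as a normed module over itself has two presentations, one with square
    balls and one with modulus balls; a derivative in either is one in the other. *)
Lemma is_Cderive_AbsRing (f : C -> C) (z l : C) :
  is_Cderive f z l <-> is_derive (V := AbsRing_NormedModule C_AbsRing) f z l.
Proof. split; intros [_ D]; (split; [apply is_linear_scal_l|exact D]). Qed.

Lemma is_Cderive_const (c z : C) : is_Cderive (fun _ => c) z (RtoC 0).
Proof. exact (is_derive_const (K := C_AbsRing) (V := C_NormedModule) c z). Qed.

Lemma is_Cderive_id (z : C) : is_Cderive (fun w => w) z (RtoC 1).
Proof. apply is_Cderive_AbsRing. exact (is_derive_id (K := C_AbsRing) z). Qed.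

Lemma is_Cderive_plus (f g : C -> C) (z lf lg : C) :
  is_Cderive f z lf -> is_Cderive g z lg -> is_Cderive (fun w => f w + g w)%C z (lf + lg)%C.
Proof. intros Hf Hg. exact (is_derive_plus (V := C_NormedModule) f g z lf lg Hf Hg). Qed.

Lemma is_Cderive_comp (f g : C -> C) (z lf lg : C) :
  is_Cderive f (g z) lf -> is_Cderive g z lg -> is_Cderive (fun w => f (g w)) z (lf * lg)%C.
Proof.
  intros Hf Hg. rewrite Cmult_comm. apply is_Cderive_AbsRing in Hg.
  exact (is_derive_comp (K := C_AbsRing) (V := C_NormedModule) f g z lf lg Hf Hg).
Qed.

Lemma is_Cderive_mult (f g : C -> C) (z lf lg : C) :
  is_Cderive f z lf -> is_Cderive g z lg ->
  is_Cderive (fun w => f w * g w)%C z (lf * g z + f z * lg)%C.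
Proof.
  rewrite !is_Cderive_AbsRing. intros Hf Hg.
  exact (is_derive_mult (K := C_AbsRing) f g z lf lg Hf Hg Cmult_comm).
Qed.

Lemma is_Cderive_scal (c : C) (f : C -> C) (z l : C) :
  is_Cderive f z l -> is_Cderive (fun w => c * f w)%C z (c * l)%C.
Proof.
  intros H. replace (c * l)%C with (RtoC 0 * f z + c * l)%C by ring.
  apply (is_Cderive_mult (fun _ => c)); [apply is_Cderive_const|exact H].
Qed.

Lemma is_Cderive_minus (f g : C -> C) (z lf lg : C) :
  is_Cderive f z lf -> is_Cderive g z lg -> is_Cderive (fun w => f w - g w)%C z (lf - lg)%C.
Proof.
  intros Hf Hg. exact (is_derive_minus (V := C_NormedModule) f g z lf lg Hf Hg).
Qed.

Lemma is_Cderive_shift (c z : C) : is_Cderive (fun w => w - c)%C z (RtoC 1).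
Proof.
  eapply is_Cderive_eq.
  - apply is_Cderive_minus; [apply is_Cderive_id|apply is_Cderive_const].
  - ring.
Qed.

Lemma is_Cderive_pow (n : nat) (z : C) :
  exists l, is_Cderive (fun w => w ^ n)%C z l.
Proof.
  induction n as [|n [l IH]].
  - exists (RtoC 0). apply (is_Cderive_const (RtoC 1)).
  - exists (RtoC 1 * z ^ n + z * l)%C.
    apply (is_Cderive_mult (fun w => w) (fun w => w ^ n)%C); [apply is_Cderive_id|exact IH].
Qed.

Lemma is_Cderive_inv (z : C) : z <> RtoC 0 -> is_Cderive Cinv z (- (/ z * / z))%C.
Proof.
  intros Hz. assert (Hz' := proj1 (Cmod_gt_0 z) Hz).
  apply is_Cderive_eps. intros eps.
  assert (Hm : 0 < Rmin (Cmod z / 2) (eps * Cmod z * Cmod z * Cmod z / 2)).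
  { generalize (cond_pos eps). intros.
    apply Rmin_glb_lt; [lra|]. apply Rdiv_lt_0_compat; [|lra]. repeat apply Rmult_lt_0_compat; lra. }
  exists (mkposreal _ Hm). simpl. intros w Hw.
  destruct (Rlt_Rmin _ _ _ Hw) as [H1 H2].
  assert (Ww : Cmod z / 2 < Cmod w).
  { generalize (Cmod_ge_minus z (z - w)). replace (z - (z - w))%C with w by ring.
    rewrite (Cmod_minus_sym z w). lra. }
  assert (Hw0 : w <> RtoC 0) by (apply Cmod_gt_0; lra).
  replace (/ w - / z - - (/ z * / z) * (w - z))%C
    with ((w - z) * ((w - z) * (/ w * (/ z * / z))))%C by (field; auto).
  rewrite !Cmod_mult, !Cmod_inv by auto.
  rewrite (Rmult_comm eps). apply Rmult_le_compat_l; [apply Cmod_ge_0|].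
  apply Rle_trans with (eps * Cmod z * Cmod z * Cmod z / 2 * (/ (Cmod z / 2) * (/ Cmod z * / Cmod z))).
  - assert (0 < / Cmod z) by now apply Rinv_0_lt_compat.
    assert (0 < / Cmod w) by (apply Rinv_0_lt_compat; lra).
    apply Rmult_le_compat; [apply Cmod_ge_0| | lra|].
    + repeat apply Rmult_le_pos; lra.
    + apply Rmult_le_compat_r; [apply Rmult_le_pos; lra|]. apply Rinv_le_contravar; lra.
  - right. field. lra.
Qed.

(** * Integration of continuous complex functions over the unit interval *)

Definition path_cont (f : R -> C) : Prop := forall t, 0 <= t <= 1 -> continuous f t.

Definition Cint (f : R -> C) : C :=
  (RInt (fun t => Re (f t)) 0 1, RInt (fun t => Im (f t)) 0 1).

Lemma is_RInt_Cint (f : R -> C) (l : C) :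
  is_RInt (V := C_R_NormedModule) f 0 1 l -> Cint f = l.
Proof.
  intros H. destruct l as [x y]. unfold Cint. f_equal; apply is_RInt_unique.
  - exact (is_RInt_fct_extend_fst (U := R_NormedModule) (V := R_NormedModule) f 0 1 (x, y) H).
  - exact (is_RInt_fct_extend_snd (U := R_NormedModule) (V := R_NormedModule) f 0 1 (x, y) H).
Qed.

Lemma Cint_is_RInt (f : R -> C) :
  path_cont f -> is_RInt (V := C_R_NormedModule) f 0 1 (Cint f).
Proof.
  intros Hf. destruct (ex_RInt_continuous (V := C_R_CompleteNormedModule) f 0 1) as [l Hl].
  - intros z Hz. rewrite Rmin_left, Rmax_right in Hz by lra. now apply Hf.
  - now rewrite (is_RInt_Cint f l Hl).
Qed.

Lemma Cint_ext (f g : R -> C) :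
  (forall t, 0 <= t <= 1 -> f t = g t) -> Cint f = Cint g.
Proof.
  intros H. unfold Cint. f_equal; apply RInt_ext; intros t Ht;
    rewrite Rmin_left, Rmax_right in Ht by lra; rewrite H; auto; lra.
Qed.

Lemma Cint_plus (f g : R -> C) :
  path_cont f -> path_cont g -> Cint (fun t => f t + g t)%C = (Cint f + Cint g)%C.
Proof.
  intros Hf Hg. apply is_RInt_Cint.
  exact (is_RInt_plus (V := C_R_NormedModule) f g 0 1 _ _ (Cint_is_RInt f Hf) (Cint_is_RInt g Hg)).
Qed.

Lemma Cint_minus (f g : R -> C) :
  path_cont f -> path_cont g -> Cint (fun t => f t - g t)%C = (Cint f - Cint g)%C.
Proof.
  intros Hf Hg. apply is_RInt_Cint.
  exact (is_RInt_minus (V := C_R_NormedModule) f g 0 1 _ _ (Cint_is_RInt f Hf) (Cint_is_RInt g Hg)).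
Qed.

Lemma path_cont_re (f : R -> C) (t : R) : continuous f t -> continuous (fun s => Re (f s)) t.
Proof. intros H. apply (continuous_comp f Re); [exact H|apply continuous_fst]. Qed.

Lemma path_cont_im (f : R -> C) (t : R) : continuous f t -> continuous (fun s => Im (f s)) t.
Proof. intros H. apply (continuous_comp f Im); [exact H|apply continuous_snd]. Qed.

Lemma ex_RInt_unit (u : R -> R) :
  (forall t, 0 <= t <= 1 -> continuous u t) -> ex_RInt u 0 1.
Proof.
  intros H. apply (ex_RInt_continuous (V := R_CompleteNormedModule)). intros z Hz.
  rewrite Rmin_left, Rmax_right in Hz by lra. now apply H.
Qed.

Lemma Cint_scal (c : C) (f : R -> C) :
  path_cont f -> Cint (fun t => c * f t)%C = (c * Cint f)%C.
Proof.
  intros Hf.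
  assert (A : ex_RInt (fun t => Re (f t)) 0 1)
    by (apply ex_RInt_unit; intros; now apply path_cont_re, Hf).
  assert (B : ex_RInt (fun t => Im (f t)) 0 1)
    by (apply ex_RInt_unit; intros; now apply path_cont_im, Hf).
  assert (HA : forall k : R, RInt (fun t => k * Re (f t)) 0 1 = k * RInt (fun t => Re (f t)) 0 1)
    by (intros k; exact (RInt_scal (V := R_CompleteNormedModule) _ 0 1 k A)).
  assert (HB : forall k : R, RInt (fun t => k * Im (f t)) 0 1 = k * RInt (fun t => Im (f t)) 0 1)
    by (intros k; exact (RInt_scal (V := R_CompleteNormedModule) _ 0 1 k B)).
  destruct c as [x y]. unfold Cint, Cmult; cbn [fst snd]. f_equal; rewrite <- HA, <- HB.
  - exact (RInt_minus (V := R_CompleteNormedModule) _ _ 0 1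
       (ex_RInt_scal (V := R_NormedModule) _ _ _ x A)
       (ex_RInt_scal (V := R_NormedModule) _ _ _ y B)).
  - exact (RInt_plus (V := R_CompleteNormedModule) _ _ 0 1
       (ex_RInt_scal (V := R_NormedModule) _ _ _ x B)
       (ex_RInt_scal (V := R_NormedModule) _ _ _ y A)).
Qed.

Lemma Cint_conj (f : R -> C) :
  path_cont f -> Cint (fun t => Cconj (f t)) = Cconj (Cint f).
Proof.
  intros Hf.
  assert (B : ex_RInt (fun t => Im (f t)) 0 1)
    by (apply ex_RInt_unit; intros; now apply path_cont_im, Hf).
  unfold Cint, Cconj; cbn [fst snd]. f_equal.
  exact (RInt_opp (V := R_CompleteNormedModule) (fun t => Im (f t)) 0 1 B).
Qed.

Lemma Cint_const (c : C) : Cint (fun _ => c) = c.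
Proof.
  apply is_RInt_Cint.
  assert (H := is_RInt_const (V := C_R_NormedModule) 0 1 c).
  assert (E : scal (V := C_R_ModuleSpace) (1 - 0) c = c).
  { rewrite scal_R_Cmult. change (RtoC (1 - 0) * c = c)%C. rewrite RtoC_minus. ring. }
  exact (eq_ind _ (fun l => is_RInt (V := C_R_NormedModule) (fun _ => c) 0 1 l) H _ E).
Qed.

Lemma Cint_le (f : R -> C) (g : R -> R) :
  path_cont f -> (forall t, 0 <= t <= 1 -> continuous g t) ->
  (forall t, 0 <= t <= 1 -> Cmod (f t) <= g t) -> Cmod (Cint f) <= RInt g 0 1.
Proof.
  intros Hf Hg H. rewrite Cmod_norm.
  apply (norm_RInt_le (V := C_R_NormedModule) f g 0 1); [lra| |now apply Cint_is_RInt|].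
  - intros t Ht. rewrite <- Cmod_norm. now apply H.
  - apply (RInt_correct (V := R_CompleteNormedModule)). now apply ex_RInt_unit.
Qed.

Lemma Cint_bound (f : R -> C) (M : R) :
  path_cont f -> (forall t, 0 <= t <= 1 -> Cmod (f t) <= M) -> Cmod (Cint f) <= M.
Proof.
  intros Hf H. apply Rle_trans with (RInt (fun _ => M) 0 1).
  - apply Cint_le; auto. intros; apply continuous_const.
  - rewrite RInt_const. unfold scal; simpl; unfold mult; simpl. lra.
Qed.

Lemma Cint_reverse (f : R -> C) :
  path_cont f -> Cint (fun t => f (1 - t)) = Cint f.
Proof.
  intros Hf. apply is_RInt_Cint.
  assert (H := is_RInt_comp_lin (V := C_R_NormedModule) f (-1) 1 0 1 (opp (Cint f))).
  replace (-1 * 0 + 1) with 1 in H by ring. replace (-1 * 1 + 1) with 0 in H by ring.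
  specialize (H (is_RInt_swap (V := C_R_NormedModule) _ _ _ _ (Cint_is_RInt f Hf))).
  apply (is_RInt_opp (V := C_R_NormedModule)) in H.
  apply (fun K => eq_ind _ (fun l => is_RInt (V := C_R_NormedModule) _ 0 1 l) K _
    (opp_opp (G := C_R_NormedModule) (Cint f))) in H.
  eapply is_RInt_ext; [|exact H]. intros t _. cbn beta.
  replace (-1 * t + 1) with (1 - t) by ring.
  destruct (f (1 - t)) as [x y]. 
  unfold opp, scal; simpl. unfold prod_opp, prod_scal, opp, scal, mult; simpl.
  unfold mult, opp; simpl. f_equal; ring.
Qed.

Lemma is_RInt_half (f : R -> C) (v : R) :
  (forall t, v <= t <= v + / 2 -> continuous f t) ->
  is_RInt (V := C_R_NormedModule) f v (v + / 2) (RtoC (/ 2) * Cint (fun t => f (t / 2 + v)%R))%C.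
Proof.
  intros Hf.
  assert (A : path_cont (fun t => f (t / 2 + v))).
  { intros t Ht. apply (continuous_comp (fun t => t / 2 + v) f); [|apply Hf; lra].
    apply (continuous_plus (V := R_NormedModule)); [|apply continuous_const].
    apply (continuous_mult (K := R_AbsRing)); [apply continuous_id|apply continuous_const]. }
  assert (H := is_RInt_comp_lin (V := C_R_NormedModule) (fun t => f (t / 2 + v)) 2 (- 2 * v)
     v (v + / 2) (Cint (fun t => f (t / 2 + v)))).
  replace (2 * v + - 2 * v) with 0 in H by ring.
  replace (2 * (v + / 2) + - 2 * v) with 1 in H by field.
  specialize (H (Cint_is_RInt _ A)).
  apply (is_RInt_scal (V := C_R_NormedModule) _ _ _ (/2)) in H.
  rewrite <- scal_R_Cmult. eapply is_RInt_ext; [|exact H]. intros t _. cbn beta.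
  replace ((2 * t + - 2 * v) / 2 + v) with t by field. rewrite scal_assoc.
  replace (mult (/2) 2) with (@one R_Ring) by (unfold mult, one; simpl; field). apply scal_one.
Qed.

Lemma Cint_halves (f : R -> C) :
  path_cont f ->
  Cint f = (RtoC (/ 2) * (Cint (fun t => f (t / 2 + 0)%R) + Cint (fun t => f (t / 2 + / 2)%R)))%C.
Proof.
  intros Hf. apply is_RInt_Cint. rewrite Cmult_plus_distr_l.
  apply (is_RInt_Chasles (V := C_R_NormedModule) _ 0 (0 + / 2) 1).
  - apply is_RInt_half. intros t Ht. apply Hf. lra.
  - replace 1 with (/ 2 + / 2) by field. replace (0 + / 2) with (/ 2) by ring.
    apply is_RInt_half. intros t Ht. apply Hf. lra.
Qed.

Lemma path_cont_plus (f g : R -> C) (t : R) :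
  continuous f t -> continuous g t -> continuous (fun s => f s + g s)%C t.
Proof. intros Hf Hg. exact (continuous_plus (V := C_R_NormedModule) f g t Hf Hg). Qed.

Lemma path_cont_minus (f g : R -> C) (t : R) :
  continuous f t -> continuous g t -> continuous (fun s => f s - g s)%C t.
Proof. intros Hf Hg. exact (continuous_minus (V := C_R_NormedModule) f g t Hf Hg). Qed.

Lemma continuous_pair (u v : R -> R) (t : R) :
  continuous u t -> continuous v t -> continuous (fun s => (u s, v s) : C) t.
Proof.
  intros Hu Hv P [e He].
  assert (A := Hu _ (locally_ball (u t) e)). assert (B := Hv _ (locally_ball (v t) e)).
  unfold filtermap in A, B |- *.
  generalize (filter_and (F := locally t) _ _ A B). apply (filter_imp (F := locally t)). intros s [Hs1 Hs2]. apply He. now split.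
Qed.

Lemma path_cont_mult (f g : R -> C) (t : R) :
  continuous f t -> continuous g t -> continuous (fun s => f s * g s)%C t.
Proof.
  intros Hf Hg.
  assert (M : forall u v : R -> R, continuous u t -> continuous v t ->
    continuous (fun s => u s * v s) t) by (intros u v; apply (continuous_mult (K := R_AbsRing))).
  assert (Rf := path_cont_re f t Hf). assert (If := path_cont_im f t Hf).
  assert (Rg := path_cont_re g t Hg). assert (Ig := path_cont_im g t Hg).
  exact (continuous_pair _ _ t
    (continuous_minus (V := R_NormedModule) _ _ t (M _ _ Rf Rg) (M _ _ If Ig))
    (continuous_plus (V := R_NormedModule) _ _ t (M _ _ Rf Ig) (M _ _ If Rg))).
Qed.

Lemma path_cont_conj (f : R -> C) (t : R) :
  continuous f t -> continuous (fun s => Cconj (f s)) t.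
Proof.
  intros Hf. apply (continuous_pair (fun s => Re (f s)) (fun s => - Im (f s))).
  - now apply path_cont_re.
  - apply (continuous_opp (V := R_NormedModule)). now apply path_cont_im.
Qed.

Lemma path_cont_RtoC (u : R -> R) (t : R) :
  continuous u t -> continuous (fun s => RtoC (u s)) t.
Proof. intros Hu. apply (continuous_pair u (fun _ => 0)); [exact Hu|apply continuous_const]. Qed.

Lemma path_cont_comp (S : C -> Prop) (f : C -> C) (g : R -> C) (t : R) :
  cont_within S f (g t) -> locally t (fun s => S (g s)) -> continuous g t ->
  continuous (fun s => f (g s)) t.
Proof.
  intros Hf HS Hg. apply continuous_RC. intros eps. destruct (Hf eps) as [d Hd].
  destruct HS as [d1 H1]. destruct (proj1 (continuous_RC g t) Hg d) as [d2 H2].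
  exists (pos_min d1 d2). simpl. intros s Hs. apply Hd.
  - apply H1. eapply Rlt_le_trans; [exact Hs|apply Rmin_l].
  - apply H2. eapply Rlt_le_trans; [exact Hs|apply Rmin_r].
Qed.

Lemma path_cont_comp_T (f : C -> C) (g : R -> C) (t : R) :
  cont_at f (g t) -> continuous g t -> continuous (fun s => f (g s)) t.
Proof.
  intros Hf Hg. apply (path_cont_comp (fun _ => True)); auto.
  now exists (mkposreal 1 Rlt_0_1).
Qed.

(** * Integrals along segments *)

Definition on_seg (a b : C) (t : R) : C := (a + RtoC t * (b - a))%C.

Definition seg (f : C -> C) (a b : C) : C := ((b - a) * Cint (fun t => f (on_seg a b t)))%C.

Definition seg_cont (f : C -> C) (a b : C) : Prop := path_cont (fun t => f (on_seg a b t)).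

Lemma on_seg_cont (a b : C) (t : R) : continuous (on_seg a b) t.
Proof.
  apply (path_cont_plus (fun _ => a)); [apply continuous_const|].
  apply (path_cont_mult RtoC (fun _ => (b - a)%C)); [|apply continuous_const].
  apply (path_cont_RtoC (fun s => s)). apply continuous_id.
Qed.

Lemma on_seg_convex (S : C -> Prop) (a b : C) (t : R) :
  convex S -> S a -> S b -> 0 <= t <= 1 -> S (on_seg a b t).
Proof.
  intros HS Ha Hb Ht. unfold on_seg.
  replace (a + RtoC t * (b - a))%C with (RtoC (1 - t) * a + RtoC t * b)%C
    by (rewrite RtoC_minus; ring).
  now apply HS.
Qed.

Lemma closed_ball_convex (S : C -> Prop) (c : C) (r : R) :
  convex S -> convex (fun z => S z /\ Cmod (z - c) <= r).
Proof.
  intros HS z w t [Hz1 Hz2] [Hw1 Hw2] Ht. split; [now apply HS|].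
  replace (RtoC (1 - t) * z + RtoC t * w - c)%C
    with (RtoC (1 - t) * (z - c) + RtoC t * (w - c))%C by (rewrite RtoC_minus; ring).
  eapply Rle_trans; [apply Cmod_triangle|]. rewrite !Cmod_mult, !Cmod_RtoC_pos by lra. nra.
Qed.

Lemma seg_cont_of (f : C -> C) (S : C -> Prop) (a b : C) :
  (forall z, S z -> cont_at f z) -> convex S -> S a -> S b -> seg_cont f a b.
Proof.
  intros Hf HS Ha Hb t Ht. apply (path_cont_comp_T f (on_seg a b)).
  - apply Hf. now apply on_seg_convex.
  - apply on_seg_cont.
Qed.

Lemma seg_reverse (f : C -> C) (a b : C) : seg_cont f a b -> seg f b a = (- seg f a b)%C.
Proof.
  intros H. unfold seg. rewrite <- (Cint_reverse (fun t => f (on_seg a b t))) by exact H.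
  replace (a - b)%C with (- (b - a))%C by ring.
  rewrite (Cint_ext (fun t => f (on_seg b a t)) (fun t => f (on_seg a b (1 - t)))).
  - ring.
  - intros t _. f_equal. unfold on_seg. rewrite RtoC_minus. ring.
Qed.

Lemma seg_midpoint (f : C -> C) (a b m : C) :
  m = (RtoC (/ 2) * (a + b))%C -> seg_cont f a b -> seg f a b = (seg f a m + seg f m b)%C.
Proof.
  assert (H2 : RtoC (/ 2) = (/ 2)%C) by (rewrite RtoC_inv; [reflexivity|lra]).
  assert (D2 : RtoC 2 <> RtoC 0) by (intros E; apply RtoC_inj in E; lra).
  intros -> H. unfold seg. rewrite (Cint_halves (fun t => f (on_seg a b t))) by exact H.
  rewrite (Cint_ext (fun t => f (on_seg a (RtoC (/ 2) * (a + b)) t))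
             (fun t => f (on_seg a b (t / 2 + 0)%R))).
  - rewrite (Cint_ext (fun t => f (on_seg (RtoC (/ 2) * (a + b)) b t))
             (fun t => f (on_seg a b (t / 2 + / 2)%R))).
    + rewrite H2. field.
    + intros t _. f_equal. unfold on_seg, Rdiv. rewrite RtoC_plus, RtoC_mult, H2. field.
  - intros t _. f_equal. unfold on_seg, Rdiv. rewrite Rplus_0_r, RtoC_mult, H2. field.
Qed.

Lemma seg_bound (f : C -> C) (a b : C) (M : R) :
  seg_cont f a b -> (forall t, 0 <= t <= 1 -> Cmod (f (on_seg a b t)) <= M) ->
  Cmod (seg f a b) <= Cmod (b - a) * M.
Proof.
  intros Hc HM. unfold seg. rewrite Cmod_mult.
  apply Rmult_le_compat_l; [apply Cmod_ge_0|]. now apply Cint_bound.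
Qed.

Lemma seg_minus (f g : C -> C) (a b : C) :
  seg_cont f a b -> seg_cont g a b -> seg (fun z => f z - g z)%C a b = (seg f a b - seg g a b)%C.
Proof.
  intros Hf Hg. unfold seg. 
  rewrite (Cint_minus (fun t => f (on_seg a b t)) (fun t => g (on_seg a b t))) by assumption. ring.
Qed.

Lemma is_derive_on_seg (F : C -> C) (a b l : C) (t : R) :
  is_Cderive F (on_seg a b t) l ->
  is_derive (V := C_R_NormedModule) (fun s => F (on_seg a b s)) t ((b - a) * l)%C.
Proof.
  intros H. split; [apply is_linear_scal_l|].
  intros x Hx. assert (x = t) as ->.
  { symmetry. now apply is_filter_lim_locally_unique. }
  intros eps. set (m := Cmod (b - a)).
  assert (He : 0 < eps / (1 + m)).
  { apply Rdiv_lt_0_compat; [apply cond_pos|]. generalize (Cmod_ge_0 (b - a)). unfold m; lra. }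
  destruct (proj1 (is_Cderive_eps _ _ _) H (mkposreal _ He)) as [d Hd].
  assert (Hd' : 0 < d / (1 + m)).
  { apply Rdiv_lt_0_compat; [apply cond_pos|]. generalize (Cmod_ge_0 (b - a)). unfold m; lra. }
  exists (mkposreal _ Hd'). intros s Hs.
  assert (Es : (on_seg a b s - on_seg a b t)%C = (RtoC (s - t) * (b - a))%C)
    by (unfold on_seg; rewrite RtoC_minus; ring).
  assert (Hm := Cmod_ge_0 (b - a)). fold m in Hm.
  assert (Hs' : Rabs (s - t) * (1 + m) < d) by (apply Rlt_div_r; [lra|exact Hs]).
  specialize (Hd (on_seg a b s)). rewrite Es, Cmod_mult, Cmod_R in Hd. fold m in Hd.
  generalize (Rabs_pos (s - t)). intros Ha.
  assert (Hd1 : Rabs (s - t) * m < d) by nra. specialize (Hd Hd1). simpl in Hd.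
  rewrite <- Cmod_norm. 
  match goal with |- Cmod ?x <= _ => replace x with
    (F (on_seg a b s) - F (on_seg a b t) - l * (RtoC (s - t) * (b - a)))%C end.
  - eapply Rle_trans; [exact Hd|]. change (norm (minus s t)) with (Rabs (s - t)).
    replace (eps / (1 + m) * (Rabs (s - t) * m)) with (eps * Rabs (s - t) * (m / (1 + m)))
      by (field; lra).
    rewrite <- (Rmult_1_r (eps * Rabs (s - t))) at 2.
    apply Rmult_le_compat_l.
    + apply Rmult_le_pos; [left; apply cond_pos|exact Ha].
    + apply Rle_div_l; lra.
  - rewrite scal_R_Cmult. change (minus s t) with (s - t).
    change (@minus) with (@minus). unfold minus at 1 2. 
    change (F (on_seg a b s) - F (on_seg a b t) - l * (RtoC (s - t) * (b - a)) =
       F (on_seg a b s) + - F (on_seg a b t) + - (RtoC (s - t) * ((b - a) * l)))%C. ring.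
Qed.

Lemma seg_FTC (F f : C -> C) (a b : C) :
  (forall t, 0 <= t <= 1 -> is_Cderive F (on_seg a b t) (f (on_seg a b t))) ->
  seg_cont f a b -> seg f a b = (F b - F a)%C.
Proof.
  intros HF Hf. unfold seg. rewrite <- Cint_scal by exact Hf.
  replace (F b - F a)%C with (minus (G := C_R_NormedModule) (F (on_seg a b 1)) (F (on_seg a b 0))).
  - apply is_RInt_Cint.
    apply (is_RInt_derive (V := C_R_CompleteNormedModule) (fun t => F (on_seg a b t))).
    + intros t Ht. rewrite Rmin_left, Rmax_right in Ht by lra. apply is_derive_on_seg. now apply HF.
    + intros t Ht. rewrite Rmin_left, Rmax_right in Ht by lra.
      apply (path_cont_mult (fun _ => (b - a)%C)); [apply continuous_const|]. now apply Hf.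
  - unfold on_seg. replace (a + RtoC 1 * (b - a))%C with b by ring.
    replace (a + RtoC 0 * (b - a))%C with a by ring. reflexivity.
Qed.

(** * Goursat's lemma *)

Definition std_triangle (x y : R) : Prop := 0 <= x /\ 0 <= y /\ x + y <= 1.

(** A cell (x, y, s) stands for the triangle with vertices (x, y), (x + s, y) and
    (x, y + s). The sign of s is free, so that the four halves of a cell, the
    inverted one in the middle included, are again cells. *)
Definition cell_inside (c : R * R * R) : Prop :=
  let '(x, y, s) := c in
  std_triangle x y /\ std_triangle (x + s) y /\ std_triangle x (y + s).

Definition half_cell (c c' : R * R * R) : Prop :=
  let '(x, y, s) := c in
  c' = (x, y, s / 2) \/ c' = (x + s / 2, y, s / 2) \/
  c' = (x, y + s / 2, s / 2) \/ c' = (x + s / 2, y + s / 2, - (s / 2)).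

Lemma half_cell_inside c c' : half_cell c c' -> cell_inside c -> cell_inside c'.
Proof.
  destruct c as [[x y] s]. unfold half_cell, cell_inside, std_triangle.
  intros [-> | [-> | [-> | ->]]] H; lra.
Qed.

Lemma pow_half_pos (n : nat) : 0 < (1 / 2) ^ n.
Proof. apply pow_lt. lra. Qed.

Lemma pow_half_small (eps : R) : 0 < eps -> exists n, (1 / 2) ^ n < eps.
Proof.
  intros He. destruct (pow_lt_1_zero (1 / 2)) with (y := eps) as [N HN].
  - rewrite Rabs_pos_eq; lra.
  - exact He.
  - exists N. specialize (HN N (le_n N)). rewrite Rabs_pos_eq in HN; [exact HN|].
    left. apply pow_half_pos.
Qed.

Lemma geometric_cauchy_lim (u : nat -> R) :
  (forall n, Rabs (u (S n) - u n) <= (1 / 2) ^ n) ->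
  exists l, forall n, Rabs (u n - l) <= 2 * (1 / 2) ^ n.
Proof.
  intros H.
  assert (Hk : forall k n, Rabs (u (n + k)%nat - u n) <= 2 * (1 / 2) ^ n - 2 * (1 / 2) ^ (n + k)).
  { induction k as [|k IH]; intros n.
    - rewrite Nat.add_0_r, Rminus_diag, Rabs_R0. lra.
    - replace (n + S k)%nat with (S (n + k)) by lia.
      replace (u (S (n + k)) - u n) with ((u (S (n + k)) - u (n + k)%nat) + (u (n + k)%nat - u n)) by ring.
      eapply Rle_trans; [apply Rabs_triang|].
      specialize (H (n + k)%nat). specialize (IH n). simpl. lra. }
  assert (Hk' : forall n m, u n - 2 * (1 / 2) ^ n <= u m + 2 * (1 / 2) ^ m).
  { intros n m. destruct (Nat.le_ge_cases n m) as [L | L].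
    - specialize (Hk (m - n)%nat n). replace (n + (m - n))%nat with m in Hk by lia.
      apply Rabs_le_between in Hk. generalize (pow_half_pos m). lra.
    - specialize (Hk (n - m)%nat m). replace (m + (n - m))%nat with n in Hk by lia.
      apply Rabs_le_between in Hk. generalize (pow_half_pos n). lra. }
  destruct (completeness (fun x => exists n, x = u n - 2 * (1 / 2) ^ n)) as [l [U L]].
  - exists (u 0%nat + 2 * (1 / 2) ^ 0). intros x [n ->]. apply Hk'.
  - now exists (u 0%nat - 2 * (1 / 2) ^ 0), 0%nat.
  - exists l. intros n. apply Rabs_le_between. split.
    + enough (l <= u n + 2 * (1 / 2) ^ n) by lra. apply L. intros x [m ->]. apply Hk'.
    + enough (u n - 2 * (1 / 2) ^ n <= l) by lra. apply U. now exists n.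
Qed.

(** If Q failed for the whole triangle it would fail for one of the halves, for a
    half of that one, and so on; these cells shrink to a point of the triangle,
    near which Q holds for small cells. *)
Lemma triangle_bisection (Q : R * R * R -> Prop) :
  (forall c, cell_inside c -> (forall c', half_cell c c' -> Q c') -> Q c) ->
  (forall u v, std_triangle u v -> exists d, 0 < d /\
     forall x y s, cell_inside (x, y, s) -> Rabs (x - u) <= 2 * Rabs s ->
       Rabs (y - v) <= 2 * Rabs s -> Rabs s < d -> Q (x, y, s)) ->
  Q (0, 0, 1).
Proof.
  intros Hhalf Hloc. apply NNPP. intros Hbad.
  assert (Hnext : forall c, exists c', cell_inside c -> ~ Q c -> half_cell c c' /\ ~ Q c').
  { intros c. destruct (classic (cell_inside c /\ ~ Q c)) as [[Hi Hq] | Hn].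
    - apply NNPP. intros Hex. apply Hq, Hhalf; [exact Hi|]. intros c' Hc'.
      apply NNPP. intros Hq'. apply Hex. now exists c'.
    - exists c. tauto. }
  pose (next c := proj1_sig (constructive_indefinite_description _ (Hnext c))).
  assert (Hn : forall c, cell_inside c -> ~ Q c -> half_cell c (next c) /\ ~ Q (next c)).
  { intros c. unfold next. exact (proj2_sig (constructive_indefinite_description _ (Hnext c))). }
  pose (st n := Nat.iter n next (0, 0, 1)).
  assert (Hst : forall n, cell_inside (st n) /\ ~ Q (st n) /\ Rabs (snd (st n)) = (1 / 2) ^ n).
  { induction n as [|n [Hi [Hq Hs]]].
    - simpl. repeat split; try lra; auto. apply Rabs_R1.
    - change (st (S n)) with (next (st n)). destruct (Hn _ Hi Hq) as [Hh Hq'].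
      split; [now apply (half_cell_inside (st n))|]. split; [exact Hq'|].
      destruct (st n) as [[x y] s]. simpl in Hs. simpl.
      assert (E : Rabs (s / 2) = 1 / 2 * (1 / 2) ^ n)
        by (unfold Rdiv; rewrite Rabs_mult, Hs, (Rabs_pos_eq (/ 2)); lra).
      destruct Hh as [-> | [-> | [-> | ->]]]; simpl; rewrite ?Rabs_Ropp; exact E. }
  assert (Hstep : forall n, Rabs (fst (fst (st (S n))) - fst (fst (st n))) <= (1 / 2) ^ n /\
                            Rabs (snd (fst (st (S n))) - snd (fst (st n))) <= (1 / 2) ^ n).
  { intros n. destruct (Hst n) as [Hi [Hq Hs]]. change (st (S n)) with (next (st n)).
    destruct (Hn _ Hi Hq) as [Hh _]. generalize (pow_half_pos n). intros Hp.
    destruct (st n) as [[x y] s]. simpl in Hs.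
    assert (E : Rabs (s / 2) <= (1 / 2) ^ n)
      by (unfold Rdiv; rewrite Rabs_mult, Hs, (Rabs_pos_eq (/ 2)); lra).
    assert (E0 : forall z, z = 0 -> Rabs z <= (1 / 2) ^ n) by (intros z ->; rewrite Rabs_R0; lra).
    destruct Hh as [-> | [-> | [-> | ->]]]; simpl; split; try (apply E0; ring);
      match goal with |- Rabs (?a + ?b - ?a) <= _ => replace (a + b - a) with b by ring end; exact E. }
  destruct (geometric_cauchy_lim (fun n => fst (fst (st n)))) as [u Hu]; [intros; apply Hstep|].
  destruct (geometric_cauchy_lim (fun n => snd (fst (st n)))) as [v Hv]; [intros; apply Hstep|].
  assert (Hin : std_triangle u v).
  { apply NNPP. intros Hout.
    assert (Hd : exists d, 0 < d /\ (d <= - u \/ d <= - v \/ d <= u + v - 1)).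
    { destruct (Rlt_le_dec u 0) as [K|K]; [exists (- u); lra|].
      destruct (Rlt_le_dec v 0) as [K'|K']; [exists (- v); lra|].
      destruct (Rlt_le_dec 1 (u + v)) as [K''|K'']; [exists (u + v - 1); lra|].
      exfalso. apply Hout. repeat split; assumption. }
    destruct Hd as [d [Hd0 Hd]]. destruct (pow_half_small (d / 8)) as [n Hn8]; [lra|].
    specialize (Hu n). specialize (Hv n). destruct (Hst n) as [Hi _]. cbn beta in *.
    destruct (st n) as [[x y] s]. simpl in Hu, Hv. apply Rabs_le_between in Hu, Hv.
    destruct Hi as [[A1 [A2 A3]] _]. lra. }
  destruct (Hloc u v Hin) as [d [Hd Hcell]].
  destruct (pow_half_small d Hd) as [n Hnd].
  destruct (Hst n) as [Hi [Hq Hs]]. specialize (Hu n). specialize (Hv n). cbn beta in *.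
  destruct (st n) as [[x y] s]. simpl in Hs, Hu, Hv. apply Hq, Hcell; auto; rewrite Hs; auto.
Qed.

Definition tri (f : C -> C) (a b c : C) : C := (seg f a b + seg f b c + seg f c a)%C.

Lemma RtoC_half : RtoC (/ 2) = (/ 2)%C.
Proof. rewrite RtoC_inv; [reflexivity|lra]. Qed.

Lemma tri_bound (f : C -> C) (S : C -> Prop) (a b c : C) (M : R) :
  (forall z, S z -> cont_at f z) -> convex S -> S a -> S b -> S c ->
  (forall z, S z -> Cmod (f z) <= M) ->
  Cmod (tri f a b c) <= (Cmod (b - a) + Cmod (c - b) + Cmod (a - c)) * M.
Proof.
  intros Hf HS Ha Hb Hc HM. unfold tri. rewrite !Rmult_plus_distr_r.
  assert (K : forall p q, S p -> S q -> Cmod (seg f p q) <= Cmod (q - p) * M).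
  { intros p q Hp Hq. apply seg_bound; [now apply (seg_cont_of f S)|].
    intros t Ht. apply HM. now apply on_seg_convex. }
  eapply Rle_trans; [apply Cmod_triangle|]. apply Rplus_le_compat; [|now apply K].
  eapply Rle_trans; [apply Cmod_triangle|]. apply Rplus_le_compat; now apply K.
Qed.

Lemma tri_FTC (F f : C -> C) (S : C -> Prop) (a b c : C) :
  (forall z, S z -> cont_at f z) -> convex S -> S a -> S b -> S c ->
  (forall z, S z -> is_Cderive F z (f z)) -> tri f a b c = RtoC 0.
Proof.
  intros Hf HS Ha Hb Hc HF. unfold tri.
  assert (K : forall p q, S p -> S q -> seg f p q = (F q - F p)%C).
  { intros p q Hp Hq. apply seg_FTC; [|now apply (seg_cont_of f S)].
    intros t Ht. apply HF. now apply on_seg_convex. }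
  rewrite !K by assumption. ring.
Qed.

Lemma tri_midpoints (f : C -> C) (S : C -> Prop) (a b c ab bc ca : C) :
  (forall z, S z -> cont_at f z) -> convex S -> S a -> S b -> S c ->
  ab = (RtoC (/ 2) * (a + b))%C -> bc = (RtoC (/ 2) * (b + c))%C -> ca = (RtoC (/ 2) * (c + a))%C ->
  tri f a b c = (tri f a ab ca + tri f ab b bc + tri f ca bc c + tri f bc ca ab)%C.
Proof.
  intros Hf HS Ha Hb Hc Eab Ebc Eca.
  assert (Hm : forall p q, S p -> S q -> S (RtoC (/ 2) * (p + q))%C).
  { intros p q Hp Hq. replace (RtoC (/ 2) * (p + q))%C with (RtoC (1 - / 2) * p + RtoC (/ 2) * q)%C.
    - apply HS; auto. lra.
    - replace (1 - / 2) with (/ 2) by lra. ring. }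
  assert (Sab : S ab) by (rewrite Eab; auto).
  assert (Sbc : S bc) by (rewrite Ebc; auto).
  assert (Sca : S ca) by (rewrite Eca; auto).
  unfold tri.
  rewrite (seg_midpoint f a b ab), (seg_midpoint f b c bc), (seg_midpoint f c a ca) by
    (auto; now apply (seg_cont_of f S)).
  rewrite (seg_reverse f ab ca), (seg_reverse f ab bc), (seg_reverse f ca bc) by
    (now apply (seg_cont_of f S)).
  ring.
Qed.

(** Near a point q the function is affine up to an error o(|z - q|), the integral
    of an affine function vanishes, and the perimeter of a cell is proportional
    to its size s: so small cells near q have integral o(s^2), a bound that
    adds up over the four halves. *)
Theorem goursat (S : C -> Prop) (f : C -> C) (a b c : C) :
  convex S -> holomorphic_on S f -> S a -> S b -> S c -> tri f a b c = RtoC 0.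
Proof.
  intros HS Hf Ha Hb Hc.
  assert (Cf : forall z, S z -> cont_at f z)
    by (intros z Hz; now apply (holomorphic_cont S)).
  pose (p x y := (a + RtoC x * (b - a) + RtoC y * (c - a))%C).
  assert (Sp : forall x y, std_triangle x y -> S (p x y)).
  { intros x y [Hx [Hy Hxy]]. destruct (Req_dec x 1) as [-> | Hx1].
    - replace y with 0 by lra. replace (p 1 0) with b by (unfold p; ring). exact Hb.
    - replace (p x y) with (RtoC (1 - x) * (on_seg a c (y / (1 - x))) + RtoC x * b)%C.
      + apply HS; [|exact Hb|lra]. apply on_seg_convex; auto. split.
        * apply Rdiv_le_0_compat; lra.
        * apply Rle_div_l; lra.
      + unfold p, on_seg. rewrite RtoC_div, RtoC_minus by lra. field.
        cbn beta. rewrite <- RtoC_minus. intros E. apply RtoC_inj in E. lra. }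
  pose (D := Cmod (b - a) + Cmod (c - a) + 1).
  assert (HD : 1 <= D) by (unfold D; generalize (Cmod_ge_0 (b - a)) (Cmod_ge_0 (c - a)); lra).
  assert (Hp : forall x y x' y' r, Rabs (x - x') <= r -> Rabs (y - y') <= r ->
     Cmod (p x y - p x' y') <= r * D).
  { intros x y x' y' r H1 H2.
    replace (p x y - p x' y')%C with (RtoC (x - x') * (b - a) + RtoC (y - y') * (c - a))%C
      by (unfold p; rewrite !RtoC_minus; ring).
    eapply Rle_trans; [apply Cmod_triangle|]. rewrite !Cmod_mult, !Cmod_R.
    assert (0 <= r) by (eapply Rle_trans; [apply Rabs_pos|exact H1]).
    unfold D. generalize (Cmod_ge_0 (b - a)) (Cmod_ge_0 (c - a)). intros. nra. }
  pose (T (k : R * R * R) := let '(x, y, s) := k in tri f (p x y) (p (x + s) y) (p x (y + s))).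
  assert (Key : forall eps, 0 < eps -> Cmod (T (0, 0, 1)) <= eps).
  { intros eps Heps.
    enough (HQ : (fun k : R * R * R => Cmod (T k) <= eps * (snd k * snd k)) (0, 0, 1))
      by (simpl in *; lra).
    apply triangle_bisection.
    - intros [[x y] s] Hi HQ.
      assert (Q1 := HQ (x, y, s / 2) ltac:(unfold half_cell; tauto)).
      assert (Q2 := HQ (x + s / 2, y, s / 2) ltac:(unfold half_cell; tauto)).
      assert (Q3 := HQ (x, y + s / 2, s / 2) ltac:(unfold half_cell; tauto)).
      assert (Q4 := HQ (x + s / 2, y + s / 2, - (s / 2)) ltac:(unfold half_cell; tauto)).
      unfold T in *. cbn [fst snd] in *.
      destruct Hi as [I1 [I2 I3]].
      rewrite (tri_midpoints f S (p x y) (p (x + s) y) (p x (y + s))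
        (p (x + s / 2) y) (p (x + s / 2) (y + s / 2)) (p x (y + s / 2))); auto.
      + replace (x + s / 2 + s / 2) with (x + s) in Q2 by field.
        replace (y + s / 2 + s / 2) with (y + s) in Q3 by field.
        replace (x + s / 2 + - (s / 2)) with x in Q4 by field.
        replace (y + s / 2 + - (s / 2)) with y in Q4 by field.
        eapply Rle_trans; [apply Cmod_triangle|].
        eapply Rle_trans; [apply Rplus_le_compat_r, Cmod_triangle|].
        eapply Rle_trans; [apply Rplus_le_compat_r, Rplus_le_compat_r, Cmod_triangle|].
        nra.
      + unfold p, Rdiv. rewrite !RtoC_plus, !RtoC_mult, RtoC_half. field.
      + unfold p, Rdiv. rewrite !RtoC_plus, !RtoC_mult, RtoC_half. field.
      + unfold p, Rdiv. rewrite !RtoC_plus, !RtoC_mult, RtoC_half. field.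
    - intros u v Huv. set (q := p u v). destruct (Hf q (Sp u v Huv)) as [l Hl].
      assert (He1 : 0 < eps / (12 * D * D)) by (apply Rdiv_lt_0_compat; nra).
      destruct (proj1 (is_Cderive_eps f q l) Hl (mkposreal _ He1)) as [d Hd]. simpl in Hd.
      exists (d / (4 * D)). split; [apply Rdiv_lt_0_compat; [apply cond_pos|lra]|].
      intros x y s Hi Hx Hy Hs. cbn [snd]. 
      apply Rlt_div_r in Hs; [|lra].
      pose (A z := (f q + l * (z - q))%C).
      pose (S' z := S z /\ Cmod (z - q) <= 3 * Rabs s * D).
      assert (CS' : convex S') by now apply closed_ball_convex.
      assert (DA : forall z, is_Cderive A z l).
      { intros z. unfold A. eapply is_Cderive_eq.
        - apply is_Cderive_plus; [apply is_Cderive_const|].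
          apply is_Cderive_scal, is_Cderive_shift.
        - ring. }
      assert (CA : forall z, cont_at A z)
        by (intros z; now apply (is_Cderive_cont A z l)).
      pose (r z := (f z - A z)%C).
      assert (Cr : forall z, S z -> cont_at r z).
      { intros z Hz. destruct (Hf z Hz) as [l' Hl'].
        apply (is_Cderive_cont r z (l' - l)%C). now apply is_Cderive_minus. }
      destruct Hi as [I1 [I2 I3]].
      assert (V : forall x' y', std_triangle x' y' -> Rabs (x' - x) <= Rabs s ->
          Rabs (y' - y) <= Rabs s -> S' (p x' y')).
      { intros x' y' I' Hx' Hy'. split; [now apply Sp|]. apply Hp.
        - replace (x' - u) with ((x' - x) + (x - u)) by ring. 
          eapply Rle_trans; [apply Rabs_triang|]. lra.
        - replace (y' - v) with ((y' - y) + (y - v)) by ring. 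
          eapply Rle_trans; [apply Rabs_triang|]. lra. }
      assert (Hss := Rabs_pos s).
      assert (V1 : S' (p x y)) by (apply V; auto; rewrite Rminus_diag, Rabs_R0; lra).
      assert (V2 : S' (p (x + s) y)).
      { apply V; auto; [replace (x + s - x) with s by ring; lra|].
        rewrite Rminus_diag, Rabs_R0; lra. }
      assert (V3 : S' (p x (y + s))).
      { apply V; auto; [rewrite Rminus_diag, Rabs_R0; lra|].
        replace (y + s - y) with s by ring; lra. }
      assert (E : T (x, y, s) = tri r (p x y) (p (x + s) y) (p x (y + s))).
      { unfold T.
        replace (tri r (p x y) (p (x + s) y) (p x (y + s)))
          with (Cminus (tri f (p x y) (p (x + s) y) (p x (y + s)))
                       (tri A (p x y) (p (x + s) y) (p x (y + s)))).
        - rewrite (tri_FTC (fun z => f q * z + l * (RtoC (/ 2) * ((z - q) * (z - q))))%C A S'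
            (p x y) (p (x + s) y) (p x (y + s))); auto; [ring|].
          intros z Hz. unfold A. eapply is_Cderive_eq.
          + apply is_Cderive_plus; [apply is_Cderive_scal, is_Cderive_id|].
            do 2 apply is_Cderive_scal.
            apply (is_Cderive_mult (fun w => w - q)%C (fun w => w - q)%C); apply is_Cderive_shift.
          + rewrite RtoC_half. field.
        - unfold tri, r. destruct V1 as [V1 _], V2 as [V2 _], V3 as [V3 _].
          rewrite !seg_minus by (apply (seg_cont_of _ S); auto). ring. }
      rewrite E.
      assert (B := tri_bound r S' (p x y) (p (x + s) y) (p x (y + s))
        (eps / (12 * D * D) * (3 * Rabs s * D))).
      eapply Rle_trans; [apply B; auto|].
      + intros z [Hz _]. now apply Cr.
      + intros z [Hz1 Hz2]. unfold r, A.
        replace (f z - (f q + l * (z - q)))%C with (f z - f q - l * (z - q))%C by ring.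
        assert (0 <= Rabs s * D) by (apply Rmult_le_pos; lra).
        eapply Rle_trans; [apply Hd; lra|]. apply Rmult_le_compat_l; [lra|exact Hz2].
      + assert (K1 : Cmod (p (x + s) y - p x y) <= Rabs s * D).
        { apply Hp; [replace (x + s - x) with s by ring|rewrite Rminus_diag, Rabs_R0]; lra. }
        assert (K2 : Cmod (p x (y + s) - p (x + s) y) <= Rabs s * D).
        { apply Hp; [replace (x - (x + s)) with (- s) by ring; rewrite Rabs_Ropp
            |replace (y + s - y) with s by ring]; lra. }
        assert (K3 : Cmod (p x y - p x (y + s)) <= Rabs s * D).
        { apply Hp; [rewrite Rminus_diag, Rabs_R0|replace (y - (y + s)) with (- s) by ring;
            rewrite Rabs_Ropp]; lra. }
        assert (Es : s * s = Rabs s * Rabs s) by (rewrite <- Rabs_mult, Rabs_pos_eq; nra).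
        rewrite Es.
        apply Rle_trans with (3 * (Rabs s * D) * (eps / (12 * D * D) * (3 * Rabs s * D))).
        * apply Rmult_le_compat_r; [|lra]. apply Rmult_le_pos; [lra|].
          repeat apply Rmult_le_pos; lra.
        * replace (3 * (Rabs s * D) * (eps / (12 * D * D) * (3 * Rabs s * D)))
            with (9 / 12 * (eps * (Rabs s * Rabs s))) by (field; lra).
          assert (0 <= eps * (Rabs s * Rabs s)) by (repeat apply Rmult_le_pos; lra). lra. }
  apply Cmod_eq_0. apply Rle_antisym; [|apply Cmod_ge_0].
  apply le_epsilon. intros eps Heps. rewrite Rplus_0_l.
  replace (tri f a b c) with (T (0, 0, 1)); [now apply Key|].
  unfold T, p. f_equal; rewrite ?Rplus_0_l; ring.
Qed.

(** * Mean value inequality and primitives *)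

Lemma is_derive_Re (f : R -> C) (t : R) (l : C) :
  is_derive (V := C_R_NormedModule) f t l -> is_derive (fun s => Re (f s)) t (Re l).
Proof.
  intros H. 
  exact (filterdiff_comp' (U := AbsRing_NormedModule R_AbsRing) (V := C_R_NormedModule)
    (W := R_NormedModule) f fst t _ fst H
    (filterdiff_linear _ (is_linear_fst (U := R_NormedModule) (V := R_NormedModule)))).
Qed.

Lemma Cderive_lipschitz (S : C -> Prop) (f : C -> C) (K : R) (a b : C) :
  convex S -> S a -> S b ->
  (forall z, S z -> exists l, is_Cderive f z l /\ Cmod l <= K) ->
  Cmod (f b - f a) <= K * Cmod (b - a).
Proof.
  intros HS Ha Hb Hf. set (D := (f b - f a)%C).
  destruct (Req_dec (Cmod D) 0) as [E0 | E0].
  { rewrite E0. destruct (Hf a Ha) as [l [_ Hl]]. apply Rmult_le_pos; [|apply Cmod_ge_0].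
    eapply Rle_trans; [apply Cmod_ge_0|exact Hl]. }
  assert (HD : 0 < Cmod D) by (generalize (Cmod_ge_0 D); lra).
  pose (g t := Re (Cconj D * f (on_seg a b t))%C).
  assert (Dg : forall t, 0 <= t <= 1 ->
     is_derive g t (Derive g t) /\ Derive g t <= Cmod D * (K * Cmod (b - a))).
  { intros t Ht. destruct (Hf (on_seg a b t)) as [l [Hl HK]]; [now apply on_seg_convex|].
    assert (Hd : is_derive g t (Re ((b - a) * (Cconj D * l))%C)).
    { apply (is_derive_Re (fun s => Cconj D * f (on_seg a b s))%C).
      apply (is_derive_on_seg (fun z => Cconj D * f z)%C). now apply is_Cderive_scal. }
    rewrite (is_derive_unique g t _ Hd). split; [exact Hd|].
    eapply Rle_trans; [apply Rle_abs|]. eapply Rle_trans; [apply re_le_Cmod|].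
    rewrite !Cmod_mult, Cmod_conj. generalize (Cmod_ge_0 (b - a)). intros Hba.
    replace (Cmod (b - a) * (Cmod D * Cmod l)) with (Cmod D * (Cmod l * Cmod (b - a))) by ring.
    apply Rmult_le_compat_l; [lra|]. now apply Rmult_le_compat_r. }
  destruct (MVT_gen g 0 1 (Derive g)) as [c [Hc E]].
  - intros x Hx. rewrite Rmin_left, Rmax_right in Hx by lra. apply Dg. lra.
  - intros x Hx. rewrite Rmin_left, Rmax_right in Hx by lra.
    apply derivable_continuous_pt. exists (Derive g x). apply is_derive_Reals. now apply Dg.
  - rewrite Rmin_left, Rmax_right in Hc by lra. destruct (Dg c Hc) as [_ B].
    assert (E1 : g 1 - g 0 = Cmod D * Cmod D).
    { unfold g, on_seg. replace (a + RtoC 1 * (b - a))%C with b by ring.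
      replace (a + RtoC 0 * (b - a))%C with a by ring.
      rewrite <- re_minus. replace (Cconj D * f b - Cconj D * f a)%C with (D * Cconj D)%C
        by (unfold D; ring).
      rewrite <- Cmod2_conj. simpl. ring. }
    rewrite E1 in E. nra.
Qed.

Lemma seg_const (k a b : C) : seg (fun _ => k) a b = ((b - a) * k)%C.
Proof. unfold seg. now rewrite Cint_const. Qed.

(** By the vanishing of the integral over the triangle z0, z, w, the increment of
    the candidate primitive is the integral of f over the short segment from z to w. *)
Lemma convex_primitive (S : C -> Prop) (f : C -> C) (z0 : C) :
  convex S -> open S -> S z0 -> (forall z, S z -> cont_at f z) ->
  (forall a b c, S a -> S b -> S c -> tri f a b c = RtoC 0) ->
  forall z, S z -> is_Cderive (fun w => seg f z0 w) z (f z).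
Proof.
  intros HS OS H0 Cf HT z Hz. apply is_Cderive_eps. intros eps.
  destruct (open_Cmod S z OS Hz) as [d1 H1]. destruct (Cf z Hz eps) as [d2 H2].
  exists (pos_min d1 d2). simpl. intros w Hw.
  destruct (Rlt_Rmin _ _ _ Hw) as [W1 W2].
  assert (Sw : S w) by now apply H1.
  assert (Hs : forall p q, S p -> S q -> seg_cont f p q) by (intros; now apply (seg_cont_of f S)).
  assert (E : (seg f z0 w - seg f z0 z - f z * (w - z))%C = seg (fun v => f v - f z)%C z w).
  { rewrite (seg_minus f (fun _ => f z) z w (Hs z w Hz Sw) (fun t _ => continuous_const _ t)), seg_const.
    specialize (HT z0 z w H0 Hz Sw). unfold tri in HT.
    rewrite (seg_reverse f z0 w) in HT by now apply Hs.
    replace (seg f z w) with (seg f z0 z + seg f z w + - seg f z0 w - seg f z0 z + seg f z0 w)%C by ring.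
    rewrite HT. ring. }
  rewrite E, Rmult_comm. apply seg_bound.
  - intros t Ht. apply (path_cont_minus (fun t => f (on_seg z w t)) (fun _ => f z)).
    + now apply Hs.
    + apply continuous_const.
  - intros t Ht. left. apply H2; [exact I|]. unfold on_seg.
    replace (z + RtoC t * (w - z) - z)%C with (RtoC t * (w - z))%C by ring.
    rewrite Cmod_mult, Cmod_RtoC_pos by lra. generalize (Cmod_ge_0 (w - z)). nra.
Qed.

(** * The exponential and means over circles *)

Lemma cis_plus (s t : R) : cis (s + t) = (cis s * cis t)%C.
Proof. unfold cis, Cmult; simpl. rewrite cos_plus, sin_plus. f_equal; ring. Qed.

Lemma Cmod_cis (t : R) : Cmod (cis t) = 1.
Proof.
  unfold Cmod, cis; cbn [fst snd]. transitivity (sqrt 1); [f_equal|apply sqrt_1].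
  generalize (sin2_cos2 t). unfold Rsqr. simpl. lra.
Qed.

Lemma cis_0 : cis 0 = RtoC 1.
Proof. unfold cis. now rewrite cos_0, sin_0. Qed.

Lemma cis_conj (t : R) : (Cconj (cis t) * cis t)%C = RtoC 1.
Proof. rewrite Cmult_comm, <- Cmod2_conj, Cmod_cis. simpl. f_equal. ring. Qed.

Lemma cis_neq_0 (t : R) : cis t <> RtoC 0.
Proof. apply Cmod_gt_0. rewrite Cmod_cis. lra. Qed.

Lemma cis_cont (t : R) : continuous cis t.
Proof. apply (continuous_pair cos sin); [apply continuous_cos|apply continuous_sin]. Qed.

Definition Cexp (z : C) : C := (RtoC (exp (Re z)) * cis (Im z))%C.

Lemma Cexp_plus (z w : C) : Cexp (z + w) = (Cexp z * Cexp w)%C.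
Proof.
  unfold Cexp. rewrite re_plus, im_plus, exp_plus, cis_plus, RtoC_mult. ring.
Qed.

Lemma Cmod_Cexp (z : C) : Cmod (Cexp z) = exp (Re z).
Proof.
  unfold Cexp. rewrite Cmod_mult, Cmod_cis, Cmod_RtoC_pos; [ring|left; apply exp_pos].
Qed.

Lemma derivable_small_o (u : R -> R) (l : R) (eps : posreal) :
  derivable_pt_lim u 0 l ->
  exists d : posreal, forall h, Rabs h < d -> Rabs (u h - u 0 - l * h) <= eps * Rabs h.
Proof.
  intros H. destruct (H eps (cond_pos eps)) as [d Hd]. exists d. intros h Hh.
  destruct (Req_dec h 0) as [-> | H0].
  - replace (u 0 - u 0 - l * 0) with 0 by ring. rewrite Rabs_R0. lra.
  - specialize (Hd h H0 Hh). rewrite Rplus_0_l in Hd.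
    replace (u h - u 0 - l * h) with (((u h - u 0) / h - l) * h) by (field; exact H0).
    rewrite Rabs_mult. apply Rmult_le_compat_r; [apply Rabs_pos|lra].
Qed.

Lemma is_Cderive_Cexp (z : C) : is_Cderive Cexp z (Cexp z).
Proof.
  apply is_Cderive_eps. intros eps. assert (Hz := exp_pos (Re z)).
  assert (He : 0 < Rmin 1 (eps / (6 * exp (Re z)))).
  { apply Rmin_glb_lt; [lra|]. apply Rdiv_lt_0_compat; [apply cond_pos|lra]. }
  set (e := mkposreal _ He).
  assert (E1 : e <= 1) by apply Rmin_l.
  assert (E2 : exp (Re z) * (6 * e) <= eps).
  { assert (E : e <= eps / (6 * exp (Re z))) by apply Rmin_r. apply Rle_div_r in E; lra. }
  destruct (derivable_small_o exp 1 e) as [d1 H1].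
  { rewrite <- exp_0. apply derivable_pt_lim_exp. }
  destruct (derivable_small_o sin 1 e) as [d2 H2].
  { rewrite <- cos_0. apply derivable_pt_lim_sin. }
  destruct (derivable_small_o cos 0 e) as [d3 H3].
  { replace 0 with (- sin 0) at 2 by (rewrite sin_0; ring). apply derivable_pt_lim_cos. }
  assert (Hd : 0 < Rmin (Rmin d1 d2) (Rmin d3 (e / 2))).
  { repeat apply Rmin_glb_lt; try apply cond_pos. generalize (cond_pos e). lra. }
  exists (mkposreal _ Hd). simpl. intros w Hw.
  destruct (Rlt_Rmin _ _ _ Hw) as [L L']. destruct (Rlt_Rmin _ _ _ L) as [K1 K2].
  destruct (Rlt_Rmin _ _ _ L') as [K3 K4].
  set (h := (w - z)%C) in *.
  replace (Cexp w) with (Cexp z * Cexp h)%C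
    by (rewrite <- Cexp_plus; f_equal; unfold h; ring).
  replace (Cexp z * Cexp h - Cexp z - Cexp z * h)%C with (Cexp z * (Cexp h - RtoC 1 - h))%C by ring.
  rewrite Cmod_mult, Cmod_Cexp.
  assert (X := re_le_Cmod h). assert (Y := im_le_Cmod h).
  specialize (H1 (Re h) (Rle_lt_trans _ _ _ X K1)).
  specialize (H2 (Im h) (Rle_lt_trans _ _ _ Y K2)).
  specialize (H3 (Im h) (Rle_lt_trans _ _ _ Y K3)).
  rewrite exp_0 in H1. rewrite sin_0 in H2. rewrite cos_0 in H3.
  set (x := Re h) in *. set (y := Im h) in *. set (m := Cmod h) in *.
  assert (Hm : 0 <= m) by apply Cmod_ge_0.
  assert (B1 : Rabs (exp x - 1) <= e).
  { replace (exp x - 1) with ((exp x - 1 - 1 * x) + x) by ring.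
    eapply Rle_trans; [apply Rabs_triang|].
    assert (e * Rabs x <= 1 * Rabs x) by (apply Rmult_le_compat_r; [apply Rabs_pos|exact E1]).
    assert (Hx2 : Rabs x < e / 2) by (eapply Rle_lt_trans; [exact X|exact K4]). lra. }
  assert (B2 : Rabs (exp x) <= 2).
  { replace (exp x) with ((exp x - 1) + 1) by ring.
    eapply Rle_trans; [apply Rabs_triang|]. rewrite Rabs_R1. lra. }
  assert (R1 : Rabs (Re (Cexp h - RtoC 1 - h)%C) <= 3 * e * m).
  { replace (Re (Cexp h - RtoC 1 - h)%C) with ((exp x - 1 - 1 * x) + exp x * (cos y - 1 - 0 * y))
      by (unfold Cexp, cis, x, y, Re; simpl; ring).
    eapply Rle_trans; [apply Rabs_triang|]. rewrite Rabs_mult.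
    assert (Rabs (exp x) * Rabs (cos y - 1 - 0 * y) <= 2 * (e * m)).
    { apply Rmult_le_compat; try apply Rabs_pos; auto. 
      eapply Rle_trans; [exact H3|]. apply Rmult_le_compat_l; [left; apply cond_pos|exact Y]. }
    generalize (cond_pos e). intros. nra. }
  assert (R2 : Rabs (Im (Cexp h - RtoC 1 - h)%C) <= 3 * e * m).
  { replace (Im (Cexp h - RtoC 1 - h)%C) with (exp x * (sin y - 0 - 1 * y) + (exp x - 1) * y)
      by (unfold Cexp, cis, x, y, Im; simpl; ring).
    eapply Rle_trans; [apply Rabs_triang|]. rewrite !Rabs_mult.
    assert (Rabs (exp x) * Rabs (sin y - 0 - 1 * y) <= 2 * (e * m)).
    { apply Rmult_le_compat; try apply Rabs_pos; auto. 
      eapply Rle_trans; [exact H2|]. apply Rmult_le_compat_l; [left; apply cond_pos|exact Y]. }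
    assert (Rabs (exp x - 1) * Rabs y <= e * m).
    { apply Rmult_le_compat; try apply Rabs_pos; auto. }
    lra. }
  assert (Cmod (Cexp h - RtoC 1 - h) <= 6 * e * m)
    by (eapply Rle_trans; [apply Cmod_le_abs|]; lra).
  apply Rle_trans with (exp (Re z) * (6 * e * m)); [apply Rmult_le_compat_l; lra|].
  replace (exp (Re z) * (6 * e * m)) with (exp (Re z) * (6 * e) * m) by ring.
  now apply Rmult_le_compat_r.
Qed.

(** The circle is parametrised by the unit interval, so that [Cint] of a function
    of [turn] is a mean. *)
Definition turn (t : R) : C := cis (2 * PI * t).

Lemma Cmod_turn (t : R) : Cmod (turn t) = 1.
Proof. apply Cmod_cis. Qed.

Lemma turn_cont (t : R) : continuous turn t.
Proof.
  apply (continuous_comp (fun t => 2 * PI * t) cis); [|apply cis_cont].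
  apply (continuous_mult (K := R_AbsRing)); [apply continuous_const|apply continuous_id].
Qed.

Definition two_pi_i : C := (0, 2 * PI).

Lemma Cexp_on_seg (x t : R) :
  Cexp (on_seg (RtoC x) (RtoC x + two_pi_i) t) = (RtoC (exp x) * turn t)%C.
Proof.
  unfold Cexp, turn, on_seg, two_pi_i. f_equal; [f_equal; f_equal|f_equal];
    unfold RtoC, Re, Im; simpl; ring.
Qed.

Lemma Cexp_period (z : C) : Cexp (z + two_pi_i) = Cexp z.
Proof.
  rewrite Cexp_plus. unfold Cexp at 2. unfold two_pi_i, cis, Re, Im; simpl.
  rewrite exp_0, cos_2PI, sin_2PI. change (1, 0) with (RtoC 1). ring.
Qed.

Lemma two_pi_i_neq_0 : two_pi_i <> RtoC 0.
Proof. intros E. apply (f_equal snd) in E. simpl in E. generalize PI_RGT_0. lra. Qed.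

Lemma Cint_turn : Cint turn = RtoC 0.
Proof.
  assert (H : seg Cexp (RtoC 0) (RtoC 0 + two_pi_i) = (Cexp (RtoC 0 + two_pi_i) - Cexp (RtoC 0))%C).
  { apply seg_FTC.
    - intros t _. apply is_Cderive_Cexp.
    - intros t Ht. apply (path_cont_comp_T Cexp); [|apply on_seg_cont].
      apply (is_Cderive_cont _ _ _ _ (is_Cderive_Cexp _)). }
  rewrite Cexp_period in H. unfold seg in H.
  rewrite (Cint_ext _ turn) in H.
  - replace (RtoC 0 + two_pi_i - RtoC 0)%C with two_pi_i in H by ring.
    replace (Cexp (RtoC 0) - Cexp (RtoC 0))%C with (RtoC 0) in H by ring.
    destruct (Ceq_dec (Cint turn) (RtoC 0)) as [E | E]; [exact E|].
    exfalso. apply (Cmult_neq_0 _ _ two_pi_i_neq_0 E H).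
  - intros t _. rewrite Cexp_on_seg, exp_0. ring.
Qed.

Lemma half_plane_convex (m : R) : convex (fun z => Re z < m).
Proof.
  intros z w t Hz Hw Ht. rewrite re_plus, !re_scal_l.
  destruct (Req_dec t 0) as [-> | H0]; [lra|]. nra.
Qed.

Lemma half_plane_shift (m : R) (z : C) : Re z < m -> Re (z + two_pi_i)%C < m.
Proof. rewrite re_plus. unfold two_pi_i, Re at 3; simpl. lra. Qed.

(** Rectangles of height 2 pi: the horizontal sides cancel by periodicity. *)
Lemma periodic_vertical_integral (m : R) (G : C -> C) (x1 x2 : R) :
  holomorphic_on (fun z => Re z < m) G ->
  (forall z, Re z < m -> G (z + two_pi_i)%C = G z) -> x1 < m -> x2 < m ->
  seg G (RtoC x1) (RtoC x1 + two_pi_i) = seg G (RtoC x2) (RtoC x2 + two_pi_i).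
Proof.
  intros HG HP H1 H2. set (S := fun z : C => Re z < m) in *.
  assert (CS : convex S) by apply half_plane_convex.
  assert (A1 : S (RtoC x1)) by exact H1. assert (A2 : S (RtoC x2)) by exact H2.
  assert (B1 : S (RtoC x1 + two_pi_i)%C) by (apply half_plane_shift; exact H1).
  assert (B2 : S (RtoC x2 + two_pi_i)%C) by (apply half_plane_shift; exact H2).
  assert (Hs : forall p q, S p -> S q -> seg_cont G p q).
  { intros p q Hp Hq. apply (seg_cont_of G S); auto.
    intros z Hz. now apply (holomorphic_cont S). }
  assert (T1 := goursat S G _ _ _ CS HG A1 A2 B2).
  assert (T2 := goursat S G _ _ _ CS HG A1 B2 B1).
  unfold tri in T1, T2.
  rewrite (seg_reverse G (RtoC x1) (RtoC x2 + two_pi_i)) in T1 by auto.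
  rewrite (seg_reverse G (RtoC x1) (RtoC x1 + two_pi_i)) in T2 by auto.
  rewrite (seg_reverse G (RtoC x1 + two_pi_i) (RtoC x2 + two_pi_i)) in T2 by auto.
  assert (E : seg G (RtoC x1 + two_pi_i) (RtoC x2 + two_pi_i) = seg G (RtoC x1) (RtoC x2)).
  { unfold seg. f_equal; [ring|]. apply Cint_ext. intros t Ht.
    replace (on_seg (RtoC x1 + two_pi_i) (RtoC x2 + two_pi_i) t)
      with (on_seg (RtoC x1) (RtoC x2) t + two_pi_i)%C by (unfold on_seg; ring).
    apply HP. now apply (on_seg_convex S). }
  rewrite E in T2. apply Ceq_minus.
  match type of T1 with ?e1 = _ => match type of T2 with ?e2 = _ =>
    transitivity (- (e1 + e2))%C; [ring|rewrite T1, T2; ring] end end.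
Qed.

(** In the coordinate log u the punctured disc becomes a half-plane, where
    Goursat's lemma applies: the mean over a circle does not depend on its
    radius, and can be read off at radius 0. *)
Lemma circle_mean (Phi : C -> C) (Rd : R) (L : C) :
  (forall u, 0 < Cmod u < Rd -> ex_Cderive Phi u) ->
  (forall eps : posreal, exists d : posreal, forall u, 0 < Cmod u < d -> Cmod (Phi u - L) <= eps) ->
  forall r, 0 < r < Rd -> Cint (fun t => Phi (RtoC r * turn t)%C) = L.
Proof.
  intros HPhi HL r Hr.
  pose (M x := Cint (fun t => Phi (RtoC x * turn t)%C)).
  assert (Cpath : forall x, 0 < x < Rd -> path_cont (fun t => Phi (RtoC x * turn t)%C)).
  { intros x Hx t Ht. apply (path_cont_comp_T Phi (fun t => RtoC x * turn t)%C).
    - destruct (HPhi (RtoC x * turn t)%C) as [l Hl].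
      + rewrite Cmod_mult, Cmod_turn, Cmod_RtoC_pos; lra.
      + apply (is_Cderive_cont _ _ _ _ Hl).
    - apply (path_cont_mult (fun _ => RtoC x) turn); [apply continuous_const|apply turn_cont]. }
  assert (HM : forall x, 0 < x < Rd -> M x = M r).
  { intros x Hx. pose (G z := Phi (Cexp z)).
    assert (E := periodic_vertical_integral (ln Rd) G (ln x) (ln r)).
    unfold seg in E. 
    assert (Es : forall y, 0 < y -> Cint (fun t => G (on_seg (RtoC (ln y)) (RtoC (ln y) + two_pi_i) t)) = M y).
    { intros y Hy. apply Cint_ext. intros t _. unfold G. rewrite Cexp_on_seg, exp_ln; auto. }
    rewrite !Es in E by lra.
    replace (RtoC (ln x) + two_pi_i - RtoC (ln x))%C with two_pi_i in E by ring.
    replace (RtoC (ln r) + two_pi_i - RtoC (ln r))%C with two_pi_i in E by ring.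
    assert (E' : (two_pi_i * M x = two_pi_i * M r)%C).
    { apply E.
      - intros z Hz. destruct (HPhi (Cexp z)) as [l Hl].
        + rewrite Cmod_Cexp. split; [apply exp_pos|]. rewrite <- (exp_ln Rd) by lra.
          now apply exp_increasing.
        + exists (l * Cexp z)%C. apply (is_Cderive_comp Phi Cexp); [exact Hl|apply is_Cderive_Cexp].
      - intros z _. unfold G. now rewrite Cexp_period.
      - apply ln_increasing; lra.
      - apply ln_increasing; lra. }
    rewrite <- (Cmult_1_l (M x)), <- (Cmult_1_l (M r)), <- (Cinv_l _ two_pi_i_neq_0).
    rewrite <- !Cmult_assoc. now rewrite E'. }
  apply Ceq_minus, Cmod_eq_0, Rle_antisym; [|apply Cmod_ge_0].
  apply le_epsilon. intros eps Heps. rewrite Rplus_0_l.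
  destruct (HL (mkposreal eps Heps)) as [d Hd]. simpl in Hd.
  set (x := Rmin (r / 2) (d / 2)).
  assert (Hx0 : 0 < x) by (apply Rmin_glb_lt; generalize (cond_pos d); lra).
  assert (Hx1 : x <= r / 2) by apply Rmin_l. assert (Hx2 : x <= d / 2) by apply Rmin_r.
  change (Cmod (M r - L) <= eps). rewrite <- (HM x) by lra.
  rewrite <- (Cint_const L). unfold M.
  rewrite <- (Cint_minus _ (fun _ => L)).
  - apply Cint_bound.
    + intros t Ht. apply (path_cont_minus _ (fun _ => L)); [|apply continuous_const].
      apply Cpath; lra.
    + intros t _. apply Hd. rewrite Cmod_mult, Cmod_turn, Cmod_RtoC_pos; lra.
  - apply Cpath; lra.
  - intros t _. apply continuous_const.
Qed.

Definition ball_C (c : C) (r : R) (z : C) : Prop := Cmod (z - c) < r.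

Lemma circle_in_ball (c : C) (r Rd : R) (t : R) :
  0 < r < Rd -> ball_C c Rd (c + RtoC r * turn t)%C.
Proof.
  intros H. unfold ball_C. replace (c + RtoC r * turn t - c)%C with (RtoC r * turn t)%C by ring.
  rewrite Cmod_mult, Cmod_turn, Cmod_RtoC_pos; lra.
Qed.

Lemma circle_cont (f : C -> C) (c : C) (r : R) :
  (forall t, 0 <= t <= 1 -> cont_at f (c + RtoC r * turn t)%C) ->
  path_cont (fun t => f (c + RtoC r * turn t)%C).
Proof.
  intros H t Ht. apply (path_cont_comp_T f (fun t => c + RtoC r * turn t)%C); [now apply H|].
  apply (path_cont_plus (fun _ => c)); [apply continuous_const|].
  apply (path_cont_mult (fun _ => RtoC r) turn); [apply continuous_const|apply turn_cont].
Qed.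

Lemma is_Cderive_translate (f : C -> C) (c u l : C) :
  is_Cderive f (c + u)%C l -> is_Cderive (fun v => f (c + v)%C) u l.
Proof.
  intros H. eapply is_Cderive_eq.
  - apply (is_Cderive_comp f (fun v => c + v)%C); [exact H|].
    apply is_Cderive_plus; [apply is_Cderive_const|apply is_Cderive_id].
  - ring.
Qed.

(** * Cauchy's formula at the centre and smoothness *)

Lemma ball_C_convex (c : C) (r : R) : convex (ball_C c r).
Proof.
  intros z w t Hz Hw Ht. unfold ball_C in *.
  replace (RtoC (1 - t) * z + RtoC t * w - c)%C
    with (RtoC (1 - t) * (z - c) + RtoC t * (w - c))%C by (rewrite RtoC_minus; ring).
  eapply Rle_lt_trans; [apply Cmod_triangle|]. rewrite !Cmod_mult, !Cmod_RtoC_pos by lra.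
  destruct (Req_dec t 0) as [-> | H0]; [lra|]. nra.
Qed.

Lemma mean_value (f : C -> C) (c : C) (Rd r : R) :
  holomorphic_on (ball_C c Rd) f -> 0 < r < Rd ->
  Cint (fun t => f (c + RtoC r * turn t)%C) = f c.
Proof.
  intros Hf Hr. apply (circle_mean (fun u => f (c + u)%C) Rd); [| |exact Hr].
  - intros u Hu. destruct (Hf (c + u)%C) as [l Hl].
    + unfold ball_C. replace (c + u - c)%C with u by ring. lra.
    + exists l. now apply is_Cderive_translate.
  - intros eps. destruct (Hf c) as [l Hl].
    { unfold ball_C. rewrite Cmod_diag. lra. }
    destruct (is_Cderive_cont f c l (fun _ => True) Hl eps) as [d Hd].
    exists d. intros u Hu. left. apply Hd; [exact I|]. replace (c + u - c)%C with u by ring. lra.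
Qed.

Lemma mean_value_turn (f : C -> C) (c : C) (Rd r : R) :
  holomorphic_on (ball_C c Rd) f -> 0 < r < Rd ->
  Cint (fun t => f (c + RtoC r * turn t) * turn t)%C = RtoC 0.
Proof.
  intros Hf Hr.
  assert (Hg : holomorphic_on (ball_C c Rd) (fun z => (z - c) * f z)%C).
  { intros z Hz. destruct (Hf z Hz) as [l Hl]. exists (RtoC 1 * f z + (z - c) * l)%C.
    apply (is_Cderive_mult (fun z => z - c)%C f); [apply is_Cderive_shift|exact Hl]. }
  assert (E := mean_value _ c Rd r Hg Hr). cbn beta in E.
  replace ((c - c) * f c)%C with (RtoC 0) in E by ring.
  rewrite (Cint_ext _ (fun t => RtoC r * (f (c + RtoC r * turn t) * turn t))%C) in E
    by (intros; ring).
  rewrite Cint_scal in E.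
  - match type of E with (_ * ?x)%C = _ => destruct (Ceq_dec x (RtoC 0)) as [E0|E0] end; [exact E0|].
    exfalso. apply (Cmult_neq_0 (RtoC r) _) in E0; [now apply E0|].
    intros K. apply RtoC_inj in K. lra.
  - intros t Ht. apply (path_cont_mult (fun t => f (c + RtoC r * turn t)%C) turn); [|apply turn_cont].
    apply circle_cont; [|exact Ht]. intros s _. apply (holomorphic_cont _ _ _ _ Hf).
    now apply circle_in_ball.
Qed.

Lemma turn_conj_cont (f : R -> C) :
  path_cont f -> path_cont (fun t => f t * Cconj (turn t))%C.
Proof.
  intros H t Ht. apply (path_cont_mult f (fun t => Cconj (turn t))); [now apply H|].
  apply path_cont_conj, turn_cont.
Qed.

(** Cauchy's formula for the derivative at the centre: the difference quotient
    at the centre has a limit, hence is subject to the mean value property. *)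
Lemma derivative_mean (f : C -> C) (c : C) (Rd r : R) :
  holomorphic_on (ball_C c Rd) f -> 0 < r < Rd ->
  Cint (fun t => f (c + RtoC r * turn t) * Cconj (turn t))%C = (RtoC r * C_derive f c)%C.
Proof.
  intros Hf Hr. assert (Hc : ball_C c Rd c).
  { unfold ball_C. rewrite Cmod_diag. lra. }
  assert (Hl := C_derive_is f c (Hf c Hc)). set (l := C_derive f c) in *.
  assert (Hr0 : RtoC r <> RtoC 0) by (intros K; apply RtoC_inj in K; lra).
  assert (E : Cint (fun t => (f (c + RtoC r * turn t) - f c) * / (RtoC r * turn t))%C = l).
  { apply (circle_mean (fun u => (f (c + u) - f c) * / u)%C Rd); [| |exact Hr].
    - intros u Hu. destruct (Hf (c + u)%C) as [k Hk].
      + unfold ball_C. replace (c + u - c)%C with u by ring. lra.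
      + eexists. apply (is_Cderive_mult (fun u => f (c + u) - f c)%C Cinv).
        * apply is_Cderive_minus; [apply is_Cderive_translate, Hk|apply is_Cderive_const].
        * apply is_Cderive_inv, Cmod_gt_0. lra.
    - intros eps. destruct (proj1 (is_Cderive_eps f c l) Hl eps) as [d Hd].
      exists d. intros u [Hu0 Hu]. specialize (Hd (c + u)%C).
      replace (c + u - c)%C with u in Hd by ring. specialize (Hd Hu).
      assert (u <> RtoC 0) by now apply Cmod_gt_0.
      replace ((f (c + u) - f c) * / u - l)%C with ((f (c + u) - f c - l * u) * / u)%C by (field; auto).
      rewrite Cmod_mult, Cmod_inv by auto. apply Rle_div_l; auto. }
  rewrite (Cint_ext _ (fun t => / RtoC r * (f (c + RtoC r * turn t) * Cconj (turn t)
              - f c * Cconj (turn t)))%C) in E.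
  - assert (P1 : path_cont (fun t => f (c + RtoC r * turn t) * Cconj (turn t))%C).
    { apply (turn_conj_cont (fun t => f (c + RtoC r * turn t)%C)), circle_cont.
      intros s _. apply (holomorphic_cont _ _ _ _ Hf). now apply circle_in_ball. }
    assert (P2 : path_cont (fun t => Cconj (turn t)))
      by (intros t _; apply path_cont_conj, turn_cont).
    assert (P3 : path_cont (fun t => f c * Cconj (turn t))%C).
    { intros t Ht. apply (path_cont_mult (fun _ => f c)); [apply continuous_const|now apply P2]. }
    rewrite Cint_scal in E by (intros t Ht; apply (path_cont_minus _ _ _ (P1 t Ht) (P3 t Ht))).
    rewrite (Cint_minus _ _ P1 P3), (Cint_scal (f c) _ P2), Cint_conj in E
      by (intros t _; apply turn_cont).
    rewrite Cint_turn in E. replace (Cconj (RtoC 0)) with (RtoC 0) in E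
      by (unfold Cconj, RtoC; simpl; f_equal; ring).
    rewrite <- E. field. exact Hr0.
  - intros t _.
    assert (T : (turn t * Cconj (turn t) = RtoC 1)%C) by (rewrite Cmult_comm; apply cis_conj).
    assert (T0 : turn t <> RtoC 0) by apply cis_neq_0.
    transitivity (/ RtoC r * (f (c + RtoC r * turn t) - f c) * (/ turn t * (turn t * Cconj (turn t))))%C.
    + rewrite T. field. now split.
    + field. now split.
Qed.

Lemma cauchy_estimate (f : C -> C) (c : C) (Rd r B : R) :
  holomorphic_on (ball_C c Rd) f -> 0 < r < Rd ->
  (forall z, ball_C c Rd z -> Cmod (f z) <= B) -> Cmod (C_derive f c) <= B / r.
Proof.
  intros Hf Hr HB. apply Rle_div_r; [lra|].
  rewrite <- (Cmod_RtoC_pos r) by lra. rewrite Rmult_comm, <- Cmod_mult.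
  rewrite <- (derivative_mean f c Rd r Hf Hr). apply Cint_bound.
  - apply (turn_conj_cont (fun t => f (c + RtoC r * turn t)%C)), circle_cont.
    intros s _. apply (holomorphic_cont _ _ _ _ Hf). now apply circle_in_ball.
  - intros t _. rewrite Cmod_mult, Cmod_conj, Cmod_turn, Rmult_1_r. apply HB.
    now apply circle_in_ball.
Qed.

(** On a small ball f is bounded, so f' is bounded and f is Lipschitz, so f' is
    Lipschitz, being a mean of translates of f; and then the mean of translates
    may be differentiated under the integral sign. *)
Lemma derivative_holomorphic (S : C -> Prop) (f : C -> C) :
  open S -> holomorphic_on S f -> holomorphic_on S (C_derive f).
Proof.
  intros OS Hf a Sa.
  destruct (open_Cmod S a OS Sa) as [d1 H1].
  destruct (holomorphic_cont S f a (fun _ => True) Hf Sa (mkposreal 1 Rlt_0_1)) as [d2 H2].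
  (* f is bounded on the ball of radius 8 r, Lipschitz on that of radius 6 r and f'
     is Lipschitz on that of radius 4 r: each step applies Cauchy's formula on balls
     of radius 2 r. *)
  set (r := Rmin d1 d2 / 8).
  assert (Hr : 0 < r).
  { unfold r. generalize (Rmin_glb_lt _ _ 0 (cond_pos d1) (cond_pos d2)). lra. }
  assert (R1 : 8 * r <= d1) by (unfold r; generalize (Rmin_l d1 d2); lra).
  assert (R2 : 8 * r <= d2) by (unfold r; generalize (Rmin_r d1 d2); lra).
  set (B := Cmod (f a) + 1).
  assert (HB : forall z, ball_C a (8 * r) z -> Cmod (f z) <= B).
  { intros z Hz. unfold ball_C in Hz. specialize (H2 z I). simpl in H2.
    replace (f z) with ((f z - f a) + f a)%C by ring.
    eapply Rle_trans; [apply Cmod_triangle|]. unfold B. 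
    assert (Cmod (f z - f a) < 1) by (apply H2; lra). lra. }
  assert (HS : forall z, ball_C a (8 * r) z -> S z)
    by (intros z Hz; apply H1; unfold ball_C in Hz; lra).
  assert (B0 : 0 < B) by (unfold B; generalize (Cmod_ge_0 (f a)); lra).
  assert (Hsub : forall b k m, 0 < m -> k + m <= 8 * r -> ball_C a k b -> forall z,
     ball_C b m z -> ball_C a (8 * r) z).
  { intros b k m Hm Hk Hb z Hz. unfold ball_C in *. 
    eapply Rle_lt_trans; [apply (Cmod_between z b a)|]. lra. }
  assert (Hhol : forall b, ball_C a (6 * r) b -> holomorphic_on (ball_C b (2 * r)) f).
  { intros b Hb z Hz. apply Hf, HS. apply (Hsub b (6 * r) (2 * r)); auto; lra. }
  set (L := B / r).
  assert (HL : 0 < L) by (apply Rdiv_lt_0_compat; lra).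
  assert (Bd : forall b, ball_C a (6 * r) b -> Cmod (C_derive f b) <= L).
  { intros b Hb. apply (cauchy_estimate f b (2 * r)); [now apply Hhol|lra|].
    intros z Hz. apply HB, (Hsub b (6 * r) (2 * r)); auto; lra. }
  assert (Hder : forall b, ball_C a (6 * r) b -> is_Cderive f b (C_derive f b)).
  { intros b Hb. apply C_derive_is, Hf, HS. unfold ball_C in *. lra. }
  assert (Lip : forall b b', ball_C a (6 * r) b -> ball_C a (6 * r) b' ->
     Cmod (f b' - f b) <= L * Cmod (b' - b)).
  { intros b b' Hb Hb'. apply (Cderive_lipschitz (ball_C a (6 * r))); auto.
    - apply ball_C_convex.
    - intros z Hz. exists (C_derive f z). auto. }
  assert (Pc : forall b, ball_C a (4 * r) b ->
     path_cont (fun t => f (b + RtoC r * turn t) * Cconj (turn t))%C).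
  { intros b Hb. apply (turn_conj_cont (fun t => f (b + RtoC r * turn t)%C)), circle_cont.
    intros s _. apply (holomorphic_cont (ball_C b (2 * r))).
    - apply Hhol. unfold ball_C in *. lra.
    - apply circle_in_ball. lra. }
  assert (Fm : forall b, ball_C a (4 * r) b ->
     Cint (fun t => f (b + RtoC r * turn t) * Cconj (turn t))%C = (RtoC r * C_derive f b)%C).
  { intros b Hb. apply (derivative_mean f b (2 * r)); [|lra]. apply Hhol. unfold ball_C in *. lra. }
  assert (Hcirc : forall b k t, ball_C a k b -> ball_C a (k + r) (b + RtoC r * turn t)%C).
  { intros b k t Hb. unfold ball_C in *.
    replace (b + RtoC r * turn t - a)%C with ((b - a) + RtoC r * turn t)%C by ring.
    eapply Rle_lt_trans; [apply Cmod_triangle|]. rewrite Cmod_mult, Cmod_turn, Cmod_RtoC_pos; lra. }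
  set (L2 := L / r).
  assert (HL2 : 0 < L2) by (apply Rdiv_lt_0_compat; lra).
  assert (Lip' : forall b b', ball_C a (4 * r) b -> ball_C a (4 * r) b' ->
     Cmod (C_derive f b' - C_derive f b) <= L2 * Cmod (b' - b)).
  { intros b b' Hb Hb'.
    assert (E : (RtoC r * (C_derive f b' - C_derive f b) =
       Cint (fun t => f (b' + RtoC r * turn t) * Cconj (turn t)
                      - f (b + RtoC r * turn t) * Cconj (turn t)))%C).
    { rewrite Cint_minus by auto. rewrite !Fm by auto. ring. }
    apply (f_equal Cmod) in E. rewrite Cmod_mult, Cmod_RtoC_pos in E by lra.
    unfold L2. apply Rmult_le_reg_l with r; [exact Hr|]. rewrite E.
    replace (r * (L / r * Cmod (b' - b))) with (L * Cmod (b' - b)) by (field; lra).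
    apply Cint_bound.
    - intros t Ht. apply path_cont_minus; now apply Pc.
    - intros t _.
      replace (f (b' + RtoC r * turn t) * Cconj (turn t) - f (b + RtoC r * turn t) * Cconj (turn t))%C
        with ((f (b' + RtoC r * turn t) - f (b + RtoC r * turn t)) * Cconj (turn t))%C by ring.
      rewrite Cmod_mult, Cmod_conj, Cmod_turn, Rmult_1_r.
      replace (b' - b)%C with (b' + RtoC r * turn t - (b + RtoC r * turn t))%C by ring.
      apply Lip; eapply Rlt_trans; try (apply (Hcirc _ (4 * r)); eassumption); lra. }
  assert (Taylor : forall u h, ball_C a (4 * r) u -> ball_C a (4 * r) (u + h)%C ->
     Cmod (f (u + h)%C - f u - h * C_derive f u) <= L2 * Cmod h * Cmod h).
  { intros u h Hu Huh.
    pose (S' z := ball_C a (4 * r) z /\ Cmod (z - u) <= Cmod h).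
    assert (CS' : convex S') by apply closed_ball_convex, ball_C_convex.
    assert (E := Cderive_lipschitz S' (fun z => f z - C_derive f u * z)%C (L2 * Cmod h) u (u + h)%C).
    cbn beta in E. replace (u + h - u)%C with h in E by ring.
    replace (f (u + h)%C - f u - h * C_derive f u)%C
      with (f (u + h)%C - C_derive f u * (u + h) - (f u - C_derive f u * u))%C by ring.
    apply E; auto.
    - split; [exact Hu|]. rewrite Cmod_diag. apply Cmod_ge_0.
    - split; [exact Huh|]. replace (u + h - u)%C with h by ring. lra.
    - intros z [Hz1 Hz2]. exists (C_derive f z - C_derive f u)%C. split.
      + eapply is_Cderive_eq.
        * apply is_Cderive_minus; [apply Hder; unfold ball_C in *; lra|].
          apply is_Cderive_scal, is_Cderive_id.
        * ring.
      + eapply Rle_trans; [apply Lip'; auto|]. apply Rmult_le_compat_l; lra. }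
  assert (Ha : ball_C a (2 * r) a).
  { unfold ball_C. rewrite Cmod_diag. lra. }
  assert (Pc' : path_cont (fun t => C_derive f (a + RtoC r * turn t) * Cconj (turn t))%C).
  { apply (turn_conj_cont (fun t => C_derive f (a + RtoC r * turn t)%C)), circle_cont.
    intros s _ eps.
    assert (Hd : 0 < Rmin r (eps / (2 * L2))).
    { apply Rmin_glb_lt; [lra|]. apply Rdiv_lt_0_compat; [apply cond_pos|lra]. }
    exists (mkposreal _ Hd). simpl. intros w _ Hw.
    destruct (Rlt_Rmin _ _ _ Hw) as [W1 W2]. apply Rlt_div_r in W2; [|lra].
    assert (Hz := Hcirc a (2 * r) s Ha).
    eapply Rle_lt_trans; [apply Lip'|].
    - unfold ball_C in *. lra.
    - unfold ball_C in *. eapply Rle_lt_trans; [apply (Cmod_between w (a + RtoC r * turn s)%C a)|]. lra.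
    - generalize (cond_pos eps). lra. }
  exists (/ RtoC r * Cint (fun t => C_derive f (a + RtoC r * turn t) * Cconj (turn t)))%C.
  set (J := Cint (fun t => C_derive f (a + RtoC r * turn t) * Cconj (turn t))%C) in *.
  apply is_Cderive_eps. intros eps.
  assert (Hd : 0 < Rmin r (eps * r / L2)).
  { apply Rmin_glb_lt; [lra|]. apply Rdiv_lt_0_compat; [|lra].
    apply Rmult_lt_0_compat; [apply cond_pos|lra]. }
  exists (mkposreal _ Hd). simpl. intros w Hw.
  destruct (Rlt_Rmin _ _ _ Hw) as [W1 W2]. apply Rlt_div_r in W2; [|lra].
  set (h := (w - a)%C) in *.
  assert (Ew : w = (a + h)%C) by (unfold h; ring).
  assert (Hw4 : ball_C a (2 * r) w) by (unfold ball_C; fold h; lra).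
  assert (Hr0 : RtoC r <> RtoC 0) by (intros K; apply RtoC_inj in K; lra).
  assert (Hw' : ball_C a (4 * r) w) by (unfold ball_C in *; lra).
  assert (Ha' : ball_C a (4 * r) a) by (unfold ball_C in *; lra).
  assert (Pd : path_cont (fun t => f (w + RtoC r * turn t) * Cconj (turn t)
                                   - f (a + RtoC r * turn t) * Cconj (turn t))%C)
    by (intros t Ht; exact (path_cont_minus _ _ _ (Pc w Hw' t Ht) (Pc a Ha' t Ht))).
  assert (Ph : path_cont (fun t => h * (C_derive f (a + RtoC r * turn t) * Cconj (turn t)))%C)
    by (intros t Ht; exact (path_cont_mult (fun _ => h) _ t (continuous_const h t) (Pc' t Ht))).
  assert (E : (RtoC r * (C_derive f w - C_derive f a - / RtoC r * J * h) =
       Cint (fun t => (f (w + RtoC r * turn t) * Cconj (turn t)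
                      - f (a + RtoC r * turn t) * Cconj (turn t))
                      - h * (C_derive f (a + RtoC r * turn t) * Cconj (turn t))))%C).
  { rewrite (Cint_minus _ _ Pd Ph), (Cint_minus _ _ (Pc w Hw') (Pc a Ha')), (Cint_scal h _ Pc').
    fold J. rewrite (Fm w Hw'), (Fm a Ha'). field. exact Hr0. }
  apply (f_equal Cmod) in E. rewrite Cmod_mult, Cmod_RtoC_pos in E by lra.
  apply Rmult_le_reg_l with r; [exact Hr|]. rewrite E.
  apply Rle_trans with (L2 * Cmod h * Cmod h).
  - apply Cint_bound.
    + intros t Ht. exact (path_cont_minus _ _ t (Pd t Ht) (Ph t Ht)).
    + intros t _. rewrite Ew. set (u := (a + RtoC r * turn t)%C).
      replace (a + h + RtoC r * turn t)%C with (u + h)%C by (unfold u; ring).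
      replace (f (u + h) * Cconj (turn t) - f u * Cconj (turn t) - h * (C_derive f u * Cconj (turn t)))%C
        with ((f (u + h) - f u - h * C_derive f u) * Cconj (turn t))%C by ring.
      rewrite Cmod_mult, Cmod_conj, Cmod_turn, Rmult_1_r.
      apply Taylor.
      * assert (Hz := Hcirc a (2 * r) t Ha). unfold ball_C, u in *. lra.
      * assert (Hz := Hcirc w (2 * r) t Hw4). rewrite Ew in Hz. unfold ball_C, u in *.
        replace (a + RtoC r * turn t + h - a)%C with (a + h + RtoC r * turn t - a)%C by ring. lra.
  - replace (r * (eps * Cmod h)) with (eps * r * Cmod h) by ring.
    apply Rmult_le_compat_r; [apply Cmod_ge_0|lra].
Qed.

Lemma C_derive_n_holomorphic (S : C -> Prop) (f : C -> C) (n : nat) :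
  open S -> holomorphic_on S f -> holomorphic_on S (C_derive_n n f).
Proof.
  intros OS Hf. induction n as [|n IH]; [exact Hf|]. now apply derivative_holomorphic.
Qed.

(** * Holomorphic functions with nonnegative real part *)

(** Against the conjugate of [turn], the mean of g over a circle of radius r is
    r g'(c) and the mean of the conjugate of g is 0; so r g'(c) is the mean of
    2 Re g against a unimodular weight. *)
Lemma gradient_estimate (g : C -> C) (c : C) (Rd : R) :
  0 < Rd -> holomorphic_on (ball_C c Rd) g -> (forall z, ball_C c Rd z -> 0 <= Re (g z)) ->
  Cmod (C_derive g c) * Rd <= 2 * Re (g c).
Proof.
  intros HRd Hg Hpos. set (G := Cmod (C_derive g c)).
  assert (Key : forall r, 0 < r < Rd -> G * r <= 2 * Re (g c)).
  { intros r Hr.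
    assert (Pg : path_cont (fun t => g (c + RtoC r * turn t)%C)).
    { apply circle_cont. intros s _. apply (holomorphic_cont _ _ _ _ Hg). now apply circle_in_ball. }
    assert (E0 := mean_value_turn g c Rd r Hg Hr).
    assert (E1 := derivative_mean g c Rd r Hg Hr).
    apply (f_equal Cconj) in E0. rewrite <- Cint_conj in E0.
    2:{ intros t Ht. apply (path_cont_mult (fun t => g (c + RtoC r * turn t)%C) turn);
          [now apply Pg|apply turn_cont]. }
    replace (Cconj (RtoC 0)) with (RtoC 0) in E0 by (unfold Cconj, RtoC; simpl; f_equal; ring).
    assert (E2 : (RtoC r * C_derive g c)%C =
       Cint (fun t => RtoC (2 * Re (g (c + RtoC r * turn t)%C)) * Cconj (turn t))%C).
    { rewrite <- E1, <- (Cplus_0_r (Cint _)), <- E0, <- Cint_plus.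
      - apply Cint_ext. intros t _. rewrite Cmult_conj, <- Cmult_plus_distr_r. f_equal.
        set (w := g (c + RtoC r * turn t)%C). destruct w as [x y].
        unfold Cconj, Cplus, RtoC, Re; simpl. f_equal; ring.
      - now apply (turn_conj_cont (fun t => g (c + RtoC r * turn t)%C)).
      - intros t Ht. apply path_cont_conj.
        apply (path_cont_mult (fun t => g (c + RtoC r * turn t)%C) turn);
          [now apply Pg|apply turn_cont]. }
    assert (Pr : forall t, 0 <= t <= 1 -> continuous (fun t => 2 * Re (g (c + RtoC r * turn t)%C)) t).
    { intros t Ht. apply (continuous_mult (K := R_AbsRing)); [apply continuous_const|].
      apply (path_cont_re (fun t => g (c + RtoC r * turn t)%C)). now apply Pg. }
    unfold G. rewrite <- (Cmod_RtoC_pos r) by lra. rewrite Rmult_comm, <- Cmod_mult, E2.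
    eapply Rle_trans; [apply (Cint_le _ (fun t => 2 * Re (g (c + RtoC r * turn t)%C)))|].
    - intros t Ht. apply (path_cont_mult (fun t => RtoC (2 * Re (g (c + RtoC r * turn t)%C)))).
      + now apply path_cont_RtoC, Pr.
      + apply path_cont_conj, turn_cont.
    - exact Pr.
    - intros t _. rewrite Cmod_mult, Cmod_conj, Cmod_turn, Rmult_1_r, Cmod_RtoC_pos; [lra|].
      assert (0 <= Re (g (c + RtoC r * turn t)%C)) by (apply Hpos; now apply circle_in_ball). lra.
    - right. rewrite <- (mean_value g c Rd r Hg Hr) at 1.
      apply (RInt_scal (V := R_CompleteNormedModule) (fun t => Re (g (c + RtoC r * turn t)%C)) 0 1 2).
      apply ex_RInt_unit. intros t Ht. apply path_cont_re. now apply Pg. }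
  assert (HG : 0 <= G) by apply Cmod_ge_0.
  apply Rnot_lt_le. intros Hlt.
  assert (HK : 0 <= 2 * Re (g c)) by (eapply Rle_trans; [|apply (Key (Rd / 2))]; [nra|lra]).
  assert (HG0 : 0 < G) by nra.
  assert (Hq : 2 * Re (g c) / G < Rd) by (apply Rlt_div_l; lra).
  assert (Hq0 : 0 <= 2 * Re (g c) / G) by (apply Rdiv_le_0_compat; lra).
  specialize (Key ((2 * Re (g c) / G + Rd) / 2)).
  assert (E : 2 * Re (g c) = G * (2 * Re (g c) / G)) by (field; lra).
  nra.
Qed.


Lemma disc_ball (z : C) : disc z <-> ball_C (RtoC 0) 1 z.
Proof. unfold disc, ball_C. now replace (z - RtoC 0)%C with z by ring. Qed.

Definition moebius (z u : C) : C := ((u + z) * / (RtoC 1 + Cconj z * u))%C.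

Lemma moebius_disc (z u : C) : disc z -> disc u ->
  (RtoC 1 + Cconj z * u)%C <> RtoC 0 /\ disc (moebius z u).
Proof.
  unfold disc. intros Hz Hu.
  assert (E : Cmod (RtoC 1 + Cconj z * u) ^ 2 - Cmod (u + z) ^ 2
              = (1 - Cmod z ^ 2) * (1 - Cmod u ^ 2)).
  { rewrite !Cmod2_alt. destruct z as [a b], u as [x y].
    unfold Cconj, RtoC, Cplus, Cmult, Re, Im; simpl. ring. }
  generalize (Cmod_ge_0 z) (Cmod_ge_0 u) (Cmod_ge_0 (u + z)) (Cmod_ge_0 (RtoC 1 + Cconj z * u)).
  intros A1 A2 A3 A4.
  assert (0 < (1 - Cmod z ^ 2) * (1 - Cmod u ^ 2)) by (apply Rmult_lt_0_compat; nra).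
  assert (L : Cmod (u + z) < Cmod (RtoC 1 + Cconj z * u)) by nra.
  assert (N : (RtoC 1 + Cconj z * u)%C <> RtoC 0) by (apply Cmod_gt_0; lra).
  split; [exact N|]. unfold moebius. rewrite Cmod_mult, Cmod_inv by exact N.
  apply Rlt_div_l; lra.
Qed.

(** The sharp constant 1 - |z|^2 comes from applying the estimate at the centre
    after moving z to the centre by an automorphism of the disc. *)
Lemma gradient_estimate_disc (g : C -> C) (z : C) :
  holomorphic_on disc g -> (forall w, disc w -> 0 <= Re (g w)) -> disc z ->
  Cmod (C_derive g z) * (1 - Cmod z ^ 2) <= 2 * Re (g z).
Proof.
  intros Hg Hpos Hz.
  assert (M0 : moebius z (RtoC 0) = z).
  { unfold moebius. replace (RtoC 1 + Cconj z * RtoC 0)%C with (RtoC 1) by ring. field. }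
  assert (DM : forall u, disc u -> exists l, is_Cderive (moebius z) u l /\
     (u = RtoC 0 -> l = RtoC (1 - Cmod z ^ 2))).
  { intros u Hu. destruct (moebius_disc z u Hz Hu) as [N _].
    eexists. split.
    - apply (is_Cderive_mult (fun u => u + z)%C (fun u => / (RtoC 1 + Cconj z * u))%C).
      + apply is_Cderive_plus; [apply is_Cderive_id|apply is_Cderive_const].
      + apply (is_Cderive_comp Cinv (fun u => RtoC 1 + Cconj z * u)%C).
        * now apply is_Cderive_inv.
        * apply is_Cderive_plus; [apply is_Cderive_const|]. apply is_Cderive_scal, is_Cderive_id.
    - intros ->. rewrite RtoC_minus, Cmod2_conj.
      replace (RtoC 1 + Cconj z * RtoC 0)%C with (RtoC 1) by ring.
      match goal with |- ?a = ?b => change (@eq C a b) end. field. }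
  assert (Dz := C_derive_is g z (Hg z Hz)).
  assert (Z0 : disc (RtoC 0)) by (unfold disc; rewrite Cmod_0; lra).
  assert (Hc : holomorphic_on (ball_C (RtoC 0) 1) (fun u => g (moebius z u))).
  { intros u Hu. apply disc_ball in Hu. destruct (moebius_disc z u Hz Hu) as [_ Hd].
    destruct (DM u Hu) as [l [Hl _]]. destruct (Hg _ Hd) as [k Hk].
    exists (k * l)%C. now apply is_Cderive_comp. }
  assert (H := gradient_estimate (fun u => g (moebius z u)) (RtoC 0) 1 Rlt_0_1 Hc).
  cbn beta in H. rewrite M0, Rmult_1_r in H.
  destruct (DM (RtoC 0) Z0) as [l [Hl El]]. specialize (El eq_refl).
  assert (E : C_derive (fun u => g (moebius z u)) (RtoC 0) = (C_derive g z * l)%C).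
  { apply is_C_derive_unique. apply is_Cderive_comp; [|exact Hl]. now rewrite M0. }
  rewrite E, Cmod_mult, El, Cmod_RtoC_pos in H.
  - apply H. intros u Hu. apply Hpos. apply disc_ball in Hu. now apply moebius_disc.
  - unfold disc in Hz. generalize (Cmod_ge_0 z). nra.
Qed.

(** Harnack's inequality: by the gradient estimate, Re g (1 + r) / (1 - r)
    increases along every radius. *)
Lemma harnack (g : C -> C) (z : C) :
  holomorphic_on disc g -> (forall w, disc w -> 0 <= Re (g w)) -> disc z ->
  Re (g (RtoC 0)) * (1 - Cmod z) <= 2 * Re (g z).
Proof.
  intros Hg Hpos Hz. set (rho := Cmod z).
  assert (Hrho : 0 <= rho < 1) by (split; [apply Cmod_ge_0|exact Hz]).
  pose (u t := Re (g (on_seg (RtoC 0) z t))).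
  assert (Es : forall t, on_seg (RtoC 0) z t = (RtoC t * z)%C) by (intros; unfold on_seg; ring).
  assert (Hin : forall t, 0 <= t <= 1 -> disc (RtoC t * z)%C).
  { intros t Ht. unfold disc. rewrite Cmod_mult, Cmod_RtoC_pos by lra. fold rho. nra. }
  assert (Du : forall t, 0 <= t <= 1 -> is_derive u t (Re (z * C_derive g (RtoC t * z))%C)).
  { intros t Ht. apply (is_derive_Re (fun s => g (on_seg (RtoC 0) z s))).
    replace (z * C_derive g (RtoC t * z))%C with ((z - RtoC 0) * C_derive g (on_seg (RtoC 0) z t))%C
      by (rewrite Es; ring).
    apply is_derive_on_seg. rewrite Es. apply C_derive_is, Hg. now apply Hin. }
  pose (F t := u t * ((1 + t * rho) / (1 - t * rho))).
  pose (dF t := Re (z * C_derive g (RtoC t * z))%C * ((1 + t * rho) / (1 - t * rho))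
                + u t * (2 * rho / ((1 - t * rho) * (1 - t * rho)))).
  assert (DF : forall t, 0 <= t <= 1 -> is_derive F t (dF t)).
  { intros t Ht. assert (0 < 1 - t * rho) by nra. unfold F, dF.
    evar_last.
    - apply (is_derive_mult u (fun t => (1 + t * rho) / (1 - t * rho)) t).
      + apply Du, Ht.
      + auto_derive; [lra|reflexivity].
      + intros; apply Rmult_comm.
    - unfold plus, mult; simpl. field. lra. }
  destruct (MVT_gen F 0 1 dF) as [c [Hc E]].
  - intros x Hx. rewrite Rmin_left, Rmax_right in Hx by lra. apply DF. lra.
  - intros x Hx. rewrite Rmin_left, Rmax_right in Hx by lra.
    apply derivable_continuous_pt. exists (dF x). apply is_derive_Reals. now apply DF.
  - rewrite Rmin_left, Rmax_right in Hc by lra.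
    assert (GE := gradient_estimate_disc g (RtoC c * z)%C Hg Hpos (Hin c Hc)).
    rewrite Cmod_mult, Cmod_RtoC_pos in GE by lra. fold rho in GE.
    assert (P1 : 0 < 1 - c * rho) by nra. assert (P2 : 0 < 1 + c * rho) by nra.
    assert (Hu : 0 <= u c) by (unfold u; rewrite Es; now apply Hpos, Hin).
    assert (B : - (Cmod (C_derive g (RtoC c * z)) * rho) <= Re (z * C_derive g (RtoC c * z))%C).
    { assert (K := re_le_Cmod (z * C_derive g (RtoC c * z))%C).
      rewrite Cmod_mult in K. fold rho in K. apply Rabs_le_between in K. lra. }
    assert (HdF : 0 <= dF c).
    { unfold dF. set (X := Re (z * C_derive g (RtoC c * z))%C) in *.
      set (G := Cmod (C_derive g (RtoC c * z))) in *.
      assert (Eu : Re (g (RtoC c * z)%C) = u c) by (unfold u; now rewrite Es).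
      rewrite Eu in GE.
      replace (X * ((1 + c * rho) / (1 - c * rho)) + u c * (2 * rho / ((1 - c * rho) * (1 - c * rho))))
        with ((X * (1 - (c * rho) ^ 2) + 2 * rho * u c) / ((1 - c * rho) * (1 - c * rho)))
        by (field; lra).
      apply Rdiv_le_0_compat; [|nra].
      assert (0 <= 1 - (c * rho) ^ 2) by nra.
      assert (- (G * rho) * (1 - (c * rho) ^ 2) <= X * (1 - (c * rho) ^ 2))
        by now apply Rmult_le_compat_r.
      assert (rho * (G * (1 - (c * rho) ^ 2)) <= rho * (2 * u c)) by (apply Rmult_le_compat_l; lra).
      lra. }
    assert (E1 : F 1 = Re (g z) * ((1 + rho) / (1 - rho))).
    { unfold F, u. rewrite Es, !Rmult_1_l. now replace (RtoC 1 * z)%C with z by ring. }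
    assert (E0 : F 0 = Re (g (RtoC 0))).
    { unfold F, u. rewrite Es. replace (RtoC 0 * z)%C with (RtoC 0) by ring. field. }
    assert (Hz0 : 0 <= Re (g z)) by now apply Hpos.
    assert (L : Re (g (RtoC 0)) <= Re (g z) * ((1 + rho) / (1 - rho))) by lra.
    replace (Re (g z) * ((1 + rho) / (1 - rho))) with (Re (g z) * (1 + rho) / (1 - rho)) in L
      by (field; lra).
    apply Rle_div_r in L; [|lra]. nra.
Qed.

(** * The inverse of a Riemann map onto a convex domain is Lipschitz *)

(** If the infimum D of the distances were not attained, every point of a large
    square would have a neighbourhood in which the distances exceed D by a
    positive amount, and compactness would make this amount uniform. *)
Lemma nearest_complement_point (S : C -> Prop) (w : C) :
  open S -> (exists z, ~ S z) ->
  exists b, ~ S b /\ forall z, ~ S z -> Cmod (b - w) <= Cmod (z - w).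
Proof.
  intros OS [z0 Hz0].
  destruct (completeness (fun x => exists z, ~ S z /\ x = - Cmod (z - w))) as [m [Um Lm]].
  - exists 0. intros x [z [_ ->]]. generalize (Cmod_ge_0 (z - w)). lra.
  - now exists (- Cmod (z0 - w)), z0.
  - set (D := - m).
    assert (HD : forall z, ~ S z -> D <= Cmod (z - w)).
    { intros z Hz. assert (- Cmod (z - w) <= m) by (apply Um; now exists z). unfold D; lra. }
    destruct (classic (exists b, ~ S b /\ Cmod (b - w) <= D)) as [[b [Hb E]] | Hno].
    { exists b. split; [exact Hb|]. intros z Hz. specialize (HD z Hz). lra. }
    exfalso.
    assert (Hloc : forall y : R * R, exists d : posreal, forall b, ~ S b ->
       Rabs (Re b - fst y) < d -> Rabs (Im b - snd y) < d -> D + d <= Cmod (b - w)).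
    { intros y.
      assert (Hclose : forall (b : C) d, Rabs (Re b - fst y) < d -> Rabs (Im b - snd y) < d ->
         Cmod (b - y) < 2 * d).
      { intros b d H1 H2. eapply Rle_lt_trans; [apply Cmod_le_abs|].
        change (Rabs (Re b - fst y) + Rabs (Im b - snd y) < 2 * d). lra. }
      destruct (classic (S y)) as [Sy | Ny].
      - destruct (open_Cmod S y OS Sy) as [d Hd]. exists (pos_div_2 d). simpl.
        intros b Hb H1 H2. exfalso. apply Hb, Hd. specialize (Hclose b (d / 2) H1 H2). lra.
      - assert (Hy : D < Cmod (y - w)) by (apply Rnot_le_lt; intros K; apply Hno; now exists y).
        assert (Hp : 0 < (Cmod (y - w) - D) / 3) by lra.
        exists (mkposreal _ Hp). simpl. intros b Hb H1 H2. specialize (Hclose b _ H1 H2).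
        generalize (Cmod_between y b w). rewrite (Cmod_minus_sym y b). lra. }
    pose (delta u v := proj1_sig (constructive_indefinite_description _ (Hloc (u, v)))).
    assert (Hdelta : forall u v b, ~ S b -> Rabs (Re b - u) < delta u v ->
       Rabs (Im b - v) < delta u v -> D + delta u v <= Cmod (b - w)).
    { intros u v. unfold delta.
      exact (proj2_sig (constructive_indefinite_description _ (Hloc (u, v)))). }
    destruct (compactness_value_2d (Re w - (D + 1)) (Re w + (D + 1))
       (Im w - (D + 1)) (Im w + (D + 1)) delta) as [d Hd].
    assert (Hmin : 0 < Rmin d 1) by (apply Rmin_glb_lt; [apply cond_pos|lra]).
    enough (m <= m - Rmin d 1) by lra.
    apply Lm. intros x [b [Hb ->]].
    enough (D + Rmin d 1 <= Cmod (b - w)) by (unfold D in *; lra).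
    apply Rnot_lt_le. intros Hlt. generalize (Rmin_l d 1) (Rmin_r d 1). intros L1 L2.
    assert (X := re_le_Cmod (b - w)). assert (Y := im_le_Cmod (b - w)).
    rewrite re_minus in X. rewrite im_minus in Y. apply Rabs_le_between in X, Y.
    apply (Hd (Re b) (Im b)); try lra.
    intros [u [v [_ [_ [H1 [H2 H3]]]]]]. specialize (Hdelta u v b Hb H1 H2). lra.
Qed.

Lemma Re_conj_mult (n : C) : Re (Cconj n * n)%C = Cmod n ^ 2.
Proof. rewrite Cmult_comm, <- Cmod2_conj. reflexivity. Qed.

(** If some point of S were on the wrong side, b would lie between a point of S
    and a point of the ball around w, which is contained in S. *)
Lemma supporting_half_plane (S : C -> Prop) (w b z : C) :
  open S -> convex S -> S w -> ~ S b ->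
  (forall y, ~ S y -> Cmod (b - w) <= Cmod (y - w)) -> S z ->
  0 < Re (Cconj (w - b) * (z - b))%C.
Proof.
  intros OS CS Sw Nb Hb Sz. set (n := (w - b)%C).
  assert (Hn : 0 < Cmod n).
  { apply Cmod_gt_0. intros E. apply Nb. replace b with w; [exact Sw|].
    apply Ceq_minus. exact E. }
  assert (Strict : forall y, S y -> ~ Re (Cconj n * (y - b))%C < 0).
  { intros y Sy Hq. set (q := Re (Cconj n * (y - b))%C) in *. set (m := Cmod (y - b)).
    assert (Hm : 0 <= m) by apply Cmod_ge_0.
    set (e := - q / (m * m + 1)).
    assert (He : 0 < e) by (apply Rdiv_lt_0_compat; nra).
    assert (Ee : e * (m * m + 1) = - q) by (unfold e; field; nra).
    set (x := (b + RtoC e * (b - y))%C).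
    assert (Ex : Cmod (x - w) ^ 2 = Cmod n ^ 2 + 2 * e * q + e ^ 2 * m ^ 2).
    { unfold m, q, x, n. rewrite !Cmod2_alt. destruct w, b, y.
      unfold Cconj, RtoC, Re, Im; simpl. ring. }
    assert (Sx : S x).
    { apply NNPP. intros Nx. specialize (Hb x Nx). rewrite (Cmod_minus_sym b w) in Hb. fold n in Hb.
      assert (Cmod n ^ 2 <= Cmod (x - w) ^ 2) by (apply pow_incr; lra). nra. }
    apply Nb. replace b with (RtoC (1 - e / (1 + e)) * x + RtoC (e / (1 + e)) * y)%C.
    - apply CS; auto. split; [apply Rdiv_le_0_compat; lra|apply Rle_div_l; lra].
    - unfold x. replace (1 - e / (1 + e)) with (/ (1 + e)) by (field; lra).
      unfold Rdiv. rewrite RtoC_mult, RtoC_inv by lra. rewrite RtoC_plus.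
      field. cbn beta. rewrite <- RtoC_plus. intros E; apply RtoC_inj in E; lra. }
  apply Rnot_le_lt. intros Hle.
  destruct (open_Cmod S z OS Sz) as [d Hd].
  assert (Hk : 0 < d / (2 * Cmod n)) by (apply Rdiv_lt_0_compat; [apply cond_pos|lra]).
  set (k := d / (2 * Cmod n)) in *.
  apply (Strict (z - RtoC k * n)%C).
  - apply Hd. replace (z - RtoC k * n - z)%C with (- (RtoC k * n))%C by ring.
    rewrite Cmod_opp, Cmod_mult, Cmod_RtoC_pos by lra. unfold k.
    replace (d / (2 * Cmod n) * Cmod n) with (d / 2) by (field; lra).
    generalize (cond_pos d). lra.
  - replace (Cconj n * (z - RtoC k * n - b))%C
      with (Cconj n * (z - b) - RtoC k * (Cconj n * n))%C by ring.
    rewrite re_minus, re_scal_l, Re_conj_mult. assert (0 < k * Cmod n ^ 2) by (apply Rmult_lt_0_compat; [exact Hk|now apply pow_lt]). lra.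
Qed.

Lemma unimodular_rotation (a : C) : exists o, Cmod o = 1 /\ (o * a)%C = RtoC (Cmod a).
Proof.
  destruct (Ceq_dec a (RtoC 0)) as [-> | N].
  - exists (RtoC 1). rewrite Cmod_1, Cmod_0. split; [reflexivity|ring].
  - assert (Hm := proj1 (Cmod_gt_0 a) N).
    assert (N' : RtoC (Cmod a) <> RtoC 0) by (intros E; apply RtoC_inj in E; lra).
    exists (Cconj a * / RtoC (Cmod a))%C. split.
    + rewrite Cmod_mult, Cmod_conj, Cmod_inv, Cmod_RtoC_pos; auto; [field; lra|lra].
    + replace (Cconj a * / RtoC (Cmod a) * a)%C with (a * Cconj a * / RtoC (Cmod a))%C by ring.
      rewrite <- Cmod2_conj. simpl. rewrite Rmult_1_r, RtoC_mult. field. exact N'.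
Qed.

(** Let R be the distance from w to the complement, b a nearest point there and
    zeta = h(w). Harnack's inequality for the distance of g to the supporting
    line at b bounds 1 - |zeta| by a multiple of R, and the gradient estimate for
    h on the ball of radius R bounds R |h'(w)| by 2 (1 - |zeta|). *)
Lemma convex_inverse_lipschitz (S : C -> Prop) (g h : C -> C) :
  open S -> convex S -> (exists z, ~ S z) ->
  holomorphic_on disc g -> (forall z, disc z -> S (g z)) ->
  holomorphic_on S h -> (forall w, S w -> disc (h w)) -> (forall w, S w -> g (h w) = w) ->
  exists K, forall w w', S w -> S w' -> Cmod (h w' - h w) <= K * Cmod (w' - w).
Proof.
  intros OS CS NS Hg Sg Hh Dh Hgh.
  assert (D0 : disc (RtoC 0)) by (unfold disc; rewrite Cmod_0; lra).
  set (p0 := g (RtoC 0)). assert (Sp0 : S p0) by now apply Sg.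
  destruct (open_Cmod S p0 OS Sp0) as [d0 Hd0]. assert (Pd0 := cond_pos d0).
  exists (8 / d0). intros w w' Sw Sw'. apply (Cderive_lipschitz S); auto. clear w w' Sw Sw'.
  intros w Sw. exists (C_derive h w). split; [now apply C_derive_is, Hh|].
  destruct (nearest_complement_point S w OS NS) as [b [Nb Hb]].
  set (n := (w - b)%C). set (R0 := Cmod n).
  assert (HR : 0 < R0).
  { apply Cmod_gt_0. intros E. apply Nb. replace b with w; [exact Sw|]. apply Ceq_minus, E. }
  assert (Ball : forall z, ball_C w R0 z -> S z).
  { intros z Hz. apply NNPP. intros Nz. specialize (Hb z Nz). unfold ball_C, R0, n in *.
    rewrite (Cmod_minus_sym b w) in Hb. lra. }
  assert (Half : forall z, S z -> 0 < Re (Cconj n * (z - b))%C)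
    by (intros z Sz; now apply (supporting_half_plane S)).
  assert (H1 := harnack (fun u => Cconj n * (g u - b))%C (h w)). cbn beta in H1.
  rewrite (Hgh w Sw) in H1. fold n in H1. rewrite Re_conj_mult in H1. fold R0 in H1. fold p0 in H1.
  assert (H2 : Re (Cconj n * (p0 - b))%C * (1 - Cmod (h w)) <= 2 * R0 ^ 2).
  { apply H1.
    - intros u Hu. destruct (Hg u Hu) as [l Hl]. eexists. apply is_Cderive_scal.
      apply is_Cderive_minus; [exact Hl|apply is_Cderive_const].
    - intros u Hu. left. now apply Half, Sg.
    - now apply Dh. }
  assert (H3 : d0 / 2 * R0 <= Re (Cconj n * (p0 - b))%C).
  { assert (Sq : S (p0 - RtoC (d0 / (2 * R0)) * n)%C).
    { apply Hd0. replace (p0 - RtoC (d0 / (2 * R0)) * n - p0)%C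
        with (- (RtoC (d0 / (2 * R0)) * n))%C by ring.
      rewrite Cmod_opp, Cmod_mult, Cmod_RtoC_pos by (apply Rdiv_le_0_compat; lra). fold R0.
      replace (d0 / (2 * R0) * R0) with (d0 / 2) by (field; lra). lra. }
    apply Half in Sq.
    replace (Cconj n * (p0 - RtoC (d0 / (2 * R0)) * n - b))%C
      with (Cconj n * (p0 - b) - RtoC (d0 / (2 * R0)) * (Cconj n * n))%C in Sq by ring.
    rewrite re_minus, re_scal_l, Re_conj_mult in Sq. fold R0 in Sq.
    replace (d0 / (2 * R0) * R0 ^ 2) with (d0 / 2 * R0) in Sq by (field; lra). lra. }
  assert (Dw : Cmod (h w) < 1) by (apply Dh, Sw).
  assert (H4 : d0 * (1 - Cmod (h w)) <= 4 * R0).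
  { apply Rmult_le_reg_l with (R0 / 2); [lra|].
    apply Rle_trans with (Re (Cconj n * (p0 - b))%C * (1 - Cmod (h w))); [|lra].
    replace (R0 / 2 * (d0 * (1 - Cmod (h w)))) with (d0 / 2 * R0 * (1 - Cmod (h w))) by field.
    apply Rmult_le_compat_r; lra. }
  destruct (unimodular_rotation (h w)) as [o [Ho Eo]].
  pose (k z := (RtoC 1 - o * h z)%C).
  assert (Dk : forall z, S z -> is_Cderive k z (RtoC 0 - o * C_derive h z)%C).
  { intros z Sz. apply is_Cderive_minus; [apply is_Cderive_const|].
    apply is_Cderive_scal, C_derive_is, Hh, Sz. }
  assert (H5 := gradient_estimate k w R0 HR).
  rewrite (is_C_derive_unique k w _ (Dk w Sw)) in H5.
  replace (RtoC 0 - o * C_derive h w)%C with (- (o * C_derive h w))%C in H5 by ring.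
  rewrite Cmod_opp, Cmod_mult, Ho, Rmult_1_l in H5.
  assert (Ek : Re (k w) = 1 - Cmod (h w)) by (unfold k; rewrite Eo; reflexivity).
  rewrite Ek in H5.
  assert (H6 : Cmod (C_derive h w) * R0 <= 2 * (1 - Cmod (h w))).
  { apply H5.
    - intros z Hz. exists (RtoC 0 - o * C_derive h z)%C. now apply Dk, Ball.
    - intros z Hz. unfold k. rewrite re_minus.
      assert (B : Re (o * h z)%C <= 1).
      { eapply Rle_trans; [apply Rle_abs|]. eapply Rle_trans; [apply re_le_Cmod|].
        rewrite Cmod_mult, Ho. assert (Cmod (h z) < 1) by now apply Dh, Ball. lra. }
      change (Re (RtoC 1)) with 1. lra. }
  apply Rmult_le_reg_r with R0; [exact HR|]. eapply Rle_trans; [exact H6|].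
  apply Rmult_le_reg_l with d0; [exact Pd0|].
  replace (d0 * (8 / d0 * R0)) with (8 * R0) by (field; lra). lra.
Qed.

(** * Limits and continuous extensions to closure points *)

Lemma closure_point (S : C -> Prop) (z : C) (d : posreal) :
  closure S z -> exists w, S w /\ Cmod (w - z) < d.
Proof.
  intros H. destruct (H (fun w => Cmod (w - z) < d)) as [w [Hw Sw]].
  - apply locally_Cmod. now exists d.
  - now exists w.
Qed.

Lemma closure_subset (S : C -> Prop) (z : C) : S z -> closure S z.
Proof. intros Hz V HV. exists z. split; [exact (locally_singleton z V HV)|exact Hz]. Qed.

Lemma within_closure_proper (S : C -> Prop) (z : C) :
  closure S z -> ProperFilter (within S (locally z)).
Proof.
  intros H. constructor.
  - intros P HP. destruct (H _ HP) as [w [Hw Sw]]. exists w. now apply Hw.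
  - apply within_filter, locally_filter.
Qed.

Lemma ball_C_Cmod (x y : C) (e : posreal) :
  ball (x : C_CompleteNormedModule) e y -> Cmod (y - x) < 2 * e.
Proof.
  intros [H1 H2]. eapply Rle_lt_trans; [apply Cmod_le_abs|].
  change (Rabs (Re y - Re x) < e) in H1. change (Rabs (Im y - Im x) < e) in H2.
  rewrite re_minus, im_minus. lra.
Qed.

Lemma extension_cauchy (S : C -> Prop) (g : C -> C) (z : C) :
  closure S z ->
  (forall eps : posreal, exists (d : posreal) (x : C), forall w,
     S w -> Cmod (w - z) < d -> Cmod (g w - x) < eps) ->
  has_lim S g z (extension S g z).
Proof.
  intros Hz Hc. assert (PF := within_closure_proper S z Hz).
  set (F := filtermap g (within S (locally z))).
  assert (PF' : ProperFilter F) by (apply filtermap_proper_filter; exact PF).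
  assert (HF : forall eps : posreal, F (ball (extension S g z : C_CompleteNormedModule) eps)).
  { apply (complete_cauchy (T := C_CompleteNormedModule) F PF').
    intros eps. destruct (Hc eps) as [d [x Hx]]. exists x.
    change (locally z (fun w => S w -> ball (x : C_CompleteNormedModule) eps (g w))).
    apply locally_Cmod. exists d. intros w Hw Sw.
    apply C_NormedModule_mixin_compat1. now apply Hx. }
  intros eps. specialize (HF (pos_div_2 eps)).
  apply (proj1 (locally_Cmod z _)) in HF. destruct HF as [d Hd].
  exists d. intros w Sw Hw. specialize (Hd w Hw Sw). apply ball_C_Cmod in Hd. simpl in Hd. lra.
Qed.

Lemma has_lim_unique (S : C -> Prop) (g : C -> C) (z L L' : C) :
  closure S z -> has_lim S g z L -> has_lim S g z L' -> L = L'.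
Proof.
  intros Hz H H'. apply Ceq_minus, Cmod_eq_0, Rle_antisym; [|apply Cmod_ge_0].
  apply le_epsilon. intros eps Heps. rewrite Rplus_0_l.
  set (e := pos_div_2 (mkposreal eps Heps)).
  destruct (H e) as [d Hd]. destruct (H' e) as [d' Hd'].
  destruct (closure_point S z (pos_min d d') Hz) as [w [Sw Hw]].
  simpl in Hw.
  assert (A := Hd w Sw (Rlt_le_trans _ _ _ Hw (Rmin_l _ _))).
  assert (B := Hd' w Sw (Rlt_le_trans _ _ _ Hw (Rmin_r _ _))).
  generalize (Cmod_between L (g w) L'). rewrite (Cmod_minus_sym L (g w)).
  unfold e in *; simpl in *. lra.
Qed.

Lemma extension_lim (S : C -> Prop) (g : C -> C) (z L : C) :
  closure S z -> has_lim S g z L -> extension S g z = L.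
Proof.
  intros Hz H. apply (has_lim_unique S g z); auto. apply extension_cauchy; [exact Hz|].
  intros eps. destruct (H eps) as [d Hd]. now exists d, L.
Qed.

Lemma has_lim_ext (S : C -> Prop) (f g : C -> C) (z L : C) :
  (forall w, S w -> f w = g w) -> has_lim S f z L -> has_lim S g z L.
Proof.
  intros E H eps. destruct (H eps) as [d Hd]. exists d. intros w Sw Hw.
  rewrite <- E by exact Sw. now apply Hd.
Qed.

Lemma has_lim_lin (S : C -> Prop) (f g : C -> C) (a z L L' : C) :
  has_lim S f z L -> has_lim S g z L' -> has_lim S (fun w => f w + a * g w)%C z (L + a * L')%C.
Proof.
  intros Hf Hg eps. destruct (Hf (pos_div_2 eps)) as [d Hd]. simpl in Hd.
  assert (Ha := Cmod_ge_0 a). assert (He := cond_pos eps).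
  assert (Hp : 0 < eps / (2 * (1 + Cmod a))) by (apply Rdiv_lt_0_compat; lra).
  destruct (Hg (mkposreal _ Hp)) as [d' Hd']. simpl in Hd'.
  exists (pos_min d d'). simpl. intros w Sw Hw.
  specialize (Hd w Sw (Rlt_le_trans _ _ _ Hw (Rmin_l _ _))).
  specialize (Hd' w Sw (Rlt_le_trans _ _ _ Hw (Rmin_r _ _))).
  replace (f w + a * g w - (L + a * L'))%C with ((f w - L) + a * (g w - L'))%C by ring.
  eapply Rle_lt_trans; [apply Cmod_triangle|]. rewrite Cmod_mult.
  apply Rlt_div_r in Hd'; [|lra]. generalize (Cmod_ge_0 (g w - L')). nra.
Qed.

(** The limit at a point y of X near z is approximated by a value of g at a point of
    S near y; that point is near z as well. *)
Lemma extension_continuous (S X : C -> Prop) (g : C -> C) :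
  (forall z, X z -> closure S z) -> (forall z, X z -> has_lim S g z (extension S g z)) ->
  forall z, X z -> cont_within X (extension S g) z.
Proof.
  intros HX Hl z Xz eps. destruct (Hl z Xz (pos_div_2 eps)) as [d Hd]. simpl in Hd.
  exists (pos_div_2 d). simpl. intros y Xy Hy.
  destruct (Hl y Xy (pos_div_2 eps)) as [d' Hd']. simpl in Hd'.
  destruct (closure_point S y (pos_min (pos_div_2 d) d') (HX y Xy))
    as [w [Sw Hw]]. simpl in Hw.
  destruct (Rlt_Rmin _ _ _ Hw) as [W1 W2].
  specialize (Hd' w Sw W2).
  assert (B : Cmod (g w - extension S g z) < eps / 2).
  { apply Hd; [exact Sw|]. eapply Rle_lt_trans; [apply (Cmod_between w y z)|]. lra. }
  generalize (Cmod_between (extension S g y) (g w) (extension S g z)).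
  rewrite (Cmod_minus_sym (extension S g y) (g w)). lra.
Qed.

Lemma extends_has_lim (S J : C -> Prop) (g : C -> C) (z : C) :
  extends_continuously S J g -> closure S z -> S z \/ J z -> has_lim S g z (extension S g z).
Proof.
  intros [G [EG CG]] Hz HX.
  assert (H : has_lim S g z (G z)).
  { apply (has_lim_ext S G); [exact EG|]. intros eps.
    destruct (proj1 (filterlim_within_C _ _ _ _) (CG z HX) eps) as [d Hd].
    exists d. intros w Sw Hw. apply Hd; auto. }
  now rewrite (extension_lim S g z (G z) Hz H).
Qed.

Lemma extends_of_lims (S J : C -> Prop) (g : C -> C) :
  (forall z, S z \/ J z -> closure S z) -> (forall z, S z -> cont_within S g z) ->
  (forall z, S z \/ J z -> has_lim S g z (extension S g z)) -> extends_continuously S J g.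
Proof.
  intros HX Hc Hl. exists (extension S g). split.
  - intros z Sz. apply extension_lim; [now apply closure_subset|now apply Hc].
  - intros z Hz. apply (proj2 (filterlim_within_C _ _ _ _)).
    now apply (extension_continuous S (fun z => S z \/ J z)).
Qed.

(** Uniform continuity on bounded parts only: a primitive of a bounded function
    on an unbounded domain may be unbounded, and then a second primitive need not
    be uniformly continuous. *)
Definition unif_cont_bdd (S : C -> Prop) (g : C -> C) : Prop :=
  forall (M : R) (eps : posreal), exists d : posreal, forall w w',
    S w -> S w' -> Cmod w <= M -> Cmod w' <= M -> Cmod (w - w') < d -> Cmod (g w - g w') < eps.

Definition loc_bounded (S : C -> Prop) (g : C -> C) : Prop :=
  forall M : R, exists B : R, forall z, S z -> Cmod z <= M -> Cmod (g z) <= B.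

Lemma unif_cont_bdd_lim (S : C -> Prop) (g : C -> C) (z : C) :
  unif_cont_bdd S g -> closure S z -> has_lim S g z (extension S g z).
Proof.
  intros Hu Hz. apply extension_cauchy; [exact Hz|]. intros eps.
  destruct (Hu (Cmod z + 1) eps) as [d Hd].
  set (e := pos_min (pos_div_2 d) (mkposreal 1 Rlt_0_1)).
  destruct (closure_point S z e Hz) as [w0 [S0 H0]].
  assert (B : forall w, Cmod (w - z) < e -> Cmod w <= Cmod z + 1 /\ Cmod (w - z) < d / 2).
  { intros w Hw. unfold e in Hw; simpl in Hw.
    destruct (Rlt_Rmin _ _ _ Hw) as [W1 W2]. split; [|exact W1].
    generalize (Cmod_ge_minus w z). lra. }
  exists e, (g w0). intros w Sw Hw. destruct (B w Hw) as [B1 B2]. destruct (B w0 H0) as [B3 B4].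
  apply Hd; auto. eapply Rle_lt_trans; [apply (Cmod_between w z w0)|].
  rewrite (Cmod_minus_sym z w0). lra.
Qed.

Lemma unif_cont_bdd_extends (S J : C -> Prop) (g : C -> C) :
  (forall z, S z \/ J z -> closure S z) -> unif_cont_bdd S g -> extends_continuously S J g.
Proof.
  intros HX Hu. apply extends_of_lims; [exact HX| |].
  - intros z Sz eps. destruct (Hu (Cmod z + 1) eps) as [d Hd].
    exists (pos_min d (mkposreal 1 Rlt_0_1)). simpl.
    intros w Sw Hw. generalize (Cmod_ge_minus w z). intros.
    destruct (Rlt_Rmin _ _ _ Hw) as [W1 W2].
    apply Hd; auto; lra.
  - intros z Hz. apply unif_cont_bdd_lim; auto.
Qed.

(** * Iterated derivatives and antiderivatives *)

Lemma C_derive_n_S (n : nat) (f : C -> C) (z : C) :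
  C_derive_n (S n) f z = C_derive_n n (C_derive f) z.
Proof. unfold C_derive_n. now rewrite Nat.iter_succ_r. Qed.

Lemma holomorphic_ext (S : C -> Prop) (f g : C -> C) :
  open S -> (forall z, S z -> f z = g z) -> holomorphic_on S f ->
  holomorphic_on S g /\ forall z, S z -> C_derive g z = C_derive f z.
Proof.
  intros OS E Hf.
  assert (K : forall z, S z -> is_Cderive g z (C_derive f z)).
  { intros z Sz. destruct (open_Cmod S z OS Sz) as [d Hd].
    apply (is_Cderive_local f g z _ d); [|now apply C_derive_is, Hf].
    intros w Hw. now apply E, Hd. }
  split.
  - intros z Sz. exists (C_derive f z). now apply K.
  - intros z Sz. now apply is_C_derive_unique, K.
Qed.

Lemma C_derive_n_ext (S : C -> Prop) (f g : C -> C) (n : nat) :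
  open S -> (forall z, S z -> f z = g z) -> holomorphic_on S f ->
  forall z, S z -> C_derive_n n g z = C_derive_n n f z.
Proof.
  intros OS E Hf. induction n as [|n IH]; intros z Sz; [symmetry; now apply E|].
  apply (holomorphic_ext S (C_derive_n n f) (C_derive_n n g)); auto.
  - intros w Sw. symmetry. now apply IH.
  - now apply C_derive_n_holomorphic.
Qed.

(** [C_derive] has an unspecified value where there is no derivative, so linearity
    needs the derivatives of all lower orders to be differentiable. *)
Lemma C_derive_n_lin (S : C -> Prop) (f g : C -> C) (a : C) (n : nat) :
  open S -> holomorphic_on S f -> holomorphic_on S g ->
  forall z, S z -> C_derive_n n (fun w => f w + a * g w)%C z
                   = (C_derive_n n f z + a * C_derive_n n g z)%C.
Proof.
  intros OS Hf Hg.
  assert (D : forall f g, holomorphic_on S f -> holomorphic_on S g -> forall z, S z ->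
    is_Cderive (fun w => f w + a * g w)%C z (C_derive f z + a * C_derive g z)%C).
  { intros f' g' Hf' Hg' z Sz. apply is_Cderive_plus; [now apply C_derive_is, Hf'|].
    now apply is_Cderive_scal, C_derive_is, Hg'. }
  induction n as [|n IH]; intros z Sz; [reflexivity|].
  assert (Hfn := C_derive_n_holomorphic S f n OS Hf).
  assert (Hgn := C_derive_n_holomorphic S g n OS Hg).
  change (C_derive (C_derive_n n (fun w => f w + a * g w)%C) z =
    (C_derive (C_derive_n n f) z + a * C_derive (C_derive_n n g) z)%C).
  rewrite <- (is_C_derive_unique _ z _ (D _ _ Hfn Hgn z Sz)).
  apply (holomorphic_ext S (fun w => C_derive_n n f w + a * C_derive_n n g w)%C); auto.
  - intros w Sw. symmetry. now apply IH.
  - intros w Sw. eexists. now apply D.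
Qed.

(** Elements of A^p vanish off Omega by convention. *)
Definition cut (S : C -> Prop) (f : C -> C) (z : C) : C :=
  if excluded_middle_informative (S z) then f z else RtoC 0.

Lemma cut_in (S : C -> Prop) (f : C -> C) (z : C) : S z -> cut S f z = f z.
Proof. intros H. unfold cut. now destruct (excluded_middle_informative (S z)). Qed.

Lemma cut_out (S : C -> Prop) (f : C -> C) (z : C) : ~ S z -> cut S f z = RtoC 0.
Proof. intros H. unfold cut. now destruct (excluded_middle_informative (S z)). Qed.

Lemma unif_cont_bdd_ext (S : C -> Prop) (f g : C -> C) :
  (forall z, S z -> f z = g z) -> unif_cont_bdd S f -> unif_cont_bdd S g.
Proof.
  intros E H M eps. destruct (H M eps) as [d Hd]. exists d. intros w w' Sw Sw'.
  rewrite <- !E by assumption. now apply Hd.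
Qed.

Lemma loc_bounded_ext (S : C -> Prop) (f g : C -> C) :
  (forall z, S z -> f z = g z) -> loc_bounded S f -> loc_bounded S g.
Proof.
  intros E H M. destruct (H M) as [B HB]. exists B. intros z Sz. rewrite <- E by exact Sz.
  now apply HB.
Qed.

Lemma primitive_regular (S : C -> Prop) (F f : C -> C) (z0 : C) :
  convex S -> S z0 -> (forall z, S z -> is_Cderive F z (f z)) -> loc_bounded S f ->
  unif_cont_bdd S F /\ loc_bounded S F.
Proof.
  intros CS S0 HF Hb.
  assert (Lip : forall M, exists K, 0 < K /\ forall w w', S w -> S w' -> Cmod w <= M -> Cmod w' <= M ->
     Cmod (F w - F w') <= K * Cmod (w - w')).
  { intros M. destruct (Hb M) as [B HB]. exists (Rmax B 1).
    assert (B1 := Rmax_l B 1). assert (B2 := Rmax_r B 1). split; [lra|].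
    intros w w' Sw Sw' Hw Hw'.
    assert (E0 : forall z, (z - RtoC 0)%C = z) by (intros; ring).
    apply (Cderive_lipschitz (fun z => S z /\ Cmod (z - RtoC 0) <= M)); rewrite ?E0; auto.
    - now apply closed_ball_convex.
    - intros z [Sz Hz]. rewrite E0 in Hz. exists (f z). split; [now apply HF|].
      specialize (HB z Sz Hz). lra. }
  split.
  - intros M eps. destruct (Lip M) as [K [HK HL]].
    assert (Hd : 0 < eps / K) by (apply Rdiv_lt_0_compat; [apply cond_pos|exact HK]).
    exists (mkposreal _ Hd). simpl. intros w w' Sw Sw' Hw Hw' Hd'.
    eapply Rle_lt_trans; [now apply HL|]. apply Rlt_div_r in Hd'; [|exact HK]. lra.
  - intros M. set (M' := Rmax M (Cmod z0)). destruct (Lip M') as [K [HK HL]].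
    exists (K * (M + Cmod z0) + Cmod (F z0)). intros z Sz Hz.
    assert (L1 := Rmax_l M (Cmod z0)). assert (L2 := Rmax_r M (Cmod z0)). fold M' in L1, L2.
    assert (HL' := HL z z0 Sz S0 (Rle_trans _ _ _ Hz L1) L2).
    generalize (Cmod_ge_minus (F z) (F z0)) (Cmod_triangle_minus z z0). intros A1 A2.
    assert (K * Cmod (z - z0) <= K * (M + Cmod z0)) by (apply Rmult_le_compat_l; lra). lra.
Qed.

(** Convexity enters twice: it provides primitives, and it makes them Lipschitz
    on bounded parts of S, so that they extend to all closure points. *)
Lemma iterated_antiderivative (S : C -> Prop) (P : C -> C) (z0 : C) (p : nat) :
  convex S -> open S -> S z0 -> holomorphic_on S P -> unif_cont_bdd S P -> loc_bounded S P ->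
  exists w, (forall z, ~ S z -> w z = RtoC 0) /\ holomorphic_on S w /\
    (forall l, (l <= p)%nat -> unif_cont_bdd S (C_derive_n l w) /\ loc_bounded S (C_derive_n l w)) /\
    forall z, S z -> C_derive_n p w z = P z.
Proof.
  intros CS OS S0 HP UP BP. induction p as [|p IH].
  - exists (cut S P). assert (E : forall z, S z -> P z = cut S P z)
      by (intros; symmetry; now apply cut_in).
    split; [intros; now apply cut_out|]. split; [now apply (holomorphic_ext S P)|]. split.
    + intros l Hl. replace l with 0%nat by lia. split.
      * now apply (unif_cont_bdd_ext S P).
      * now apply (loc_bounded_ext S P).
    + intros z Sz. now apply cut_in.
  - destruct IH as [w [_ [Hw [Rw Ew]]]]. pose (F z := seg w z0 z).
    assert (HF : forall z, S z -> is_Cderive F z (w z)).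
    { apply convex_primitive; auto.
      - intros z Sz. now apply (holomorphic_cont S).
      - intros a b c Sa Sb Sc. now apply (goursat S). }
    assert (FH : holomorphic_on S F) by (intros z Sz; exists (w z); now apply HF).
    assert (E : forall z, S z -> F z = cut S F z) by (intros; symmetry; now apply cut_in).
    destruct (holomorphic_ext S F (cut S F) OS E FH) as [H1 H2].
    assert (D1 : forall z, S z -> w z = C_derive (cut S F) z).
    { intros z Sz. rewrite H2 by exact Sz. symmetry. now apply is_C_derive_unique, HF. }
    assert (Dn : forall l z, S z -> C_derive_n l w z = C_derive_n (Datatypes.S l) (cut S F) z).
    { intros l z Sz. rewrite C_derive_n_S. symmetry. now apply (C_derive_n_ext S w). }
    exists (cut S F). split; [intros; now apply cut_out|]. split; [exact H1|]. split.
    + intros [|l] Hl.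
      * destruct (primitive_regular S F w z0) as [R1 R2]; auto.
        { apply (Rw 0%nat). lia. }
        split; [now apply (unif_cont_bdd_ext S F)|now apply (loc_bounded_ext S F)].
      * destruct (Rw l) as [R1 R2]; [lia|]. split.
        -- now apply (unif_cont_bdd_ext S (C_derive_n l w) _ (Dn l)).
        -- now apply (loc_bounded_ext S (C_derive_n l w) _ (Dn l)).
    + intros z Sz. rewrite <- Dn by exact Sz. now apply Ew.
Qed.

(** * A lacunary series in the disc algebra *)

(** The ratios 1/16 and 1024 serve two purposes. As 1024 / 16 = 64 is large, the
    terms before the k-th one together vary by much less than 16^-k over half a
    period of that term. As 16^2 < 1024, the oscillation 16^-k on intervals of
    length 1024^-k is much larger than the square root of that length. *)
Fixpoint lacunary_sum (n : nat) (z : C) : C :=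
  match n with
  | O => RtoC 0
  | S k => (lacunary_sum k z + RtoC ((1 / 16) ^ k) * z ^ (1024 ^ k))%C
  end.

Lemma Cmod_pow_le_1 (z : C) (n : nat) : Cmod z <= 1 -> Cmod (z ^ n)%C <= 1.
Proof.
  intros H. rewrite Cmod_pow. rewrite <- (pow1 n). apply pow_incr. split; [apply Cmod_ge_0|exact H].
Qed.

Lemma sixteenth_pow_pos (n : nat) : 0 < (1 / 16) ^ n.
Proof. apply pow_lt. lra. Qed.

Lemma lacunary_sum_step (z : C) (n : nat) :
  Cmod z <= 1 -> Cmod (lacunary_sum (S n) z - lacunary_sum n z) <= (1 / 2) ^ n.
Proof.
  intros Hz. cbn [lacunary_sum].
  replace (lacunary_sum n z + RtoC ((1 / 16) ^ n) * z ^ (1024 ^ n) - lacunary_sum n z)%C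
    with (RtoC ((1 / 16) ^ n) * z ^ (1024 ^ n))%C by ring.
  assert (H16 := sixteenth_pow_pos n).
  rewrite Cmod_mult, Cmod_RtoC_pos by lra.
  apply Rle_trans with ((1 / 16) ^ n * 1).
  - apply Rmult_le_compat_l; [lra|now apply Cmod_pow_le_1].
  - rewrite Rmult_1_r. apply pow_incr. lra.
Qed.

Lemma geometric_cauchy_lim_C (u : nat -> C) :
  (forall n, Cmod (u (S n) - u n) <= (1 / 2) ^ n) ->
  exists l, forall n, Cmod (u n - l) <= 4 * (1 / 2) ^ n.
Proof.
  intros H.
  destruct (geometric_cauchy_lim (fun n => Re (u n))) as [x Hx].
  { intros n. rewrite <- re_minus. eapply Rle_trans; [apply re_le_Cmod|apply H]. }
  destruct (geometric_cauchy_lim (fun n => Im (u n))) as [y Hy].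
  { intros n. rewrite <- im_minus. eapply Rle_trans; [apply im_le_Cmod|apply H]. }
  exists (x, y). intros n. specialize (Hx n). specialize (Hy n). cbn beta in *.
  eapply Rle_trans; [apply Cmod_le_abs|]. rewrite re_minus, im_minus.
  change (Re (x, y)) with x. change (Im (x, y)) with y. lra.
Qed.

Lemma lacunary_ex (z : C) :
  exists l, Cmod z <= 1 -> forall n, Cmod (lacunary_sum n z - l) <= 4 * (1 / 2) ^ n.
Proof.
  destruct (Rle_lt_dec (Cmod z) 1) as [H | H].
  - destruct (geometric_cauchy_lim_C (fun n => lacunary_sum n z)) as [l Hl].
    + intros n. now apply lacunary_sum_step.
    + now exists l.
  - exists (RtoC 0). lra.
Qed.

(** On the closed disc this is the sum of the series with terms z^(1024^k) / 16^k. *)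
Definition lacunary (z : C) : C :=
  proj1_sig (constructive_indefinite_description _ (lacunary_ex z)).

Lemma lacunary_approx (z : C) (n : nat) :
  Cmod z <= 1 -> Cmod (lacunary_sum n z - lacunary z) <= 4 * (1 / 2) ^ n.
Proof.
  intros H. unfold lacunary.
  exact (proj2_sig (constructive_indefinite_description _ (lacunary_ex z)) H n).
Qed.

Lemma lacunary_bounded (z : C) : Cmod z <= 1 -> Cmod (lacunary z) <= 4.
Proof.
  intros H. generalize (lacunary_approx z 0 H). simpl.
  replace (RtoC 0 - lacunary z)%C with (- lacunary z)%C by ring. rewrite Cmod_opp. lra.
Qed.

Lemma Cpow_lipschitz (z w : C) (n : nat) :
  Cmod z <= 1 -> Cmod w <= 1 -> Cmod (z ^ n - w ^ n)%C <= INR n * Cmod (z - w).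
Proof.
  intros Hz Hw. induction n as [|n IH].
  - simpl. rewrite Cmod_diag. lra.
  - rewrite S_INR, !Cpow_S.
    replace (z * z ^ n - w * w ^ n)%C with (z * (z ^ n - w ^ n) + (z - w) * w ^ n)%C by ring.
    eapply Rle_trans; [apply Cmod_triangle|]. rewrite !Cmod_mult.
    generalize (Cmod_ge_0 (z ^ n - w ^ n)) (Cmod_ge_0 (z - w)) (Cmod_pow_le_1 w n Hw)
      (Cmod_ge_0 z) (Cmod_ge_0 (w ^ n)%C). intros. nra.
Qed.

Lemma lacunary_sum_lipschitz (n : nat) :
  exists K, 0 < K /\ forall z w, Cmod z <= 1 -> Cmod w <= 1 ->
    Cmod (lacunary_sum n z - lacunary_sum n w) <= K * Cmod (z - w).
Proof.
  induction n as [|n [K [HK IH]]].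
  - exists 1. split; [lra|]. intros z w _ _. simpl.
    rewrite Cmod_diag. generalize (Cmod_ge_0 (z - w)). lra.
  - assert (H16 := sixteenth_pow_pos n). assert (HI := pos_INR (1024 ^ n)).
    exists (K + (1 / 16) ^ n * INR (1024 ^ n)). split.
    { assert (0 <= (1 / 16) ^ n * INR (1024 ^ n)) by (apply Rmult_le_pos; lra). lra. }
    intros z w Hz Hw. cbn [lacunary_sum].
    replace (lacunary_sum n z + RtoC ((1 / 16) ^ n) * z ^ (1024 ^ n)
             - (lacunary_sum n w + RtoC ((1 / 16) ^ n) * w ^ (1024 ^ n)))%C
      with ((lacunary_sum n z - lacunary_sum n w)
            + RtoC ((1 / 16) ^ n) * (z ^ (1024 ^ n) - w ^ (1024 ^ n)))%C by ring.
    eapply Rle_trans; [apply Cmod_triangle|]. rewrite Cmod_mult, Cmod_RtoC_pos by lra.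
    specialize (IH z w Hz Hw). assert (L := Cpow_lipschitz z w (1024 ^ n) Hz Hw).
    apply (Rmult_le_compat_l ((1 / 16) ^ n)) in L; lra.
Qed.

Lemma lacunary_unif_cont (eps : posreal) :
  exists d : posreal, forall z w, Cmod z <= 1 -> Cmod w <= 1 -> Cmod (z - w) < d ->
    Cmod (lacunary z - lacunary w) < eps.
Proof.
  destruct (pow_half_small (eps / 16)) as [n Hn]; [generalize (cond_pos eps); lra|].
  destruct (lacunary_sum_lipschitz n) as [K [HK HL]].
  assert (Hd : 0 < eps / (2 * K)) by (apply Rdiv_lt_0_compat; [apply cond_pos|lra]).
  exists (mkposreal _ Hd). simpl. intros z w Hz Hw Hzw. apply Rlt_div_r in Hzw; [|lra].
  specialize (HL z w Hz Hw).
  assert (A := lacunary_approx z n Hz). assert (B := lacunary_approx w n Hw).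
  generalize (Cmod_between (lacunary z) (lacunary_sum n z) (lacunary w))
    (Cmod_between (lacunary_sum n z) (lacunary_sum n w) (lacunary w)).
  rewrite (Cmod_minus_sym (lacunary z) (lacunary_sum n z)). lra.
Qed.

Lemma lacunary_sum_holomorphic (n : nat) (z : C) : ex_Cderive (lacunary_sum n) z.
Proof.
  induction n as [|n [l IH]].
  - exists (RtoC 0). apply is_Cderive_const.
  - destruct (is_Cderive_pow (1024 ^ n) z) as [k Hk].
    exists (l + RtoC ((1 / 16) ^ n) * k)%C. apply (is_Cderive_plus (lacunary_sum n)); [exact IH|].
    now apply is_Cderive_scal.
Qed.

Lemma disc_open : open disc.
Proof.
  intros z Hz. apply locally_Cmod. assert (Hp : 0 < 1 - Cmod z) by (unfold disc in Hz; lra).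
  exists (mkposreal _ Hp). simpl. intros w Hw. unfold disc.
  generalize (Cmod_ge_minus w z). lra.
Qed.

Lemma disc_convex : convex disc.
Proof.
  intros z w t Hz Hw Ht. apply disc_ball, ball_C_convex; [now apply disc_ball in Hz|now apply disc_ball in Hw|exact Ht].
Qed.

(** A uniform limit of polynomials has vanishing triangle integrals, so it is
    the derivative of a holomorphic function. *)
Lemma lacunary_holomorphic : holomorphic_on disc lacunary.
Proof.
  assert (HC : forall z, disc z -> cont_at lacunary z).
  { intros z Hz eps. destruct (lacunary_unif_cont eps) as [d Hd].
    destruct (open_Cmod disc z disc_open Hz) as [d' Hd'].
    exists (pos_min d d'). simpl. intros w _ Hw.
    apply Hd; [|left; exact Hz|].
    - left. apply Hd'. eapply Rlt_le_trans; [exact Hw|apply Rmin_r].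
    - eapply Rlt_le_trans; [exact Hw|apply Rmin_l]. }
  assert (Hn : forall n z, cont_at (lacunary_sum n) z).
  { intros n z. destruct (lacunary_sum_holomorphic n z) as [l Hl].
    apply (is_Cderive_cont _ _ _ _ Hl). }
  assert (HT : forall a b c, disc a -> disc b -> disc c -> tri lacunary a b c = RtoC 0).
  { intros a b c Ha Hb Hc. set (P := Cmod (b - a) + Cmod (c - b) + Cmod (a - c)).
    assert (HP : 0 <= P).
    { unfold P. generalize (Cmod_ge_0 (b - a)) (Cmod_ge_0 (c - b)) (Cmod_ge_0 (a - c)). lra. }
    assert (Key : forall n, Cmod (tri lacunary a b c) <= P * (4 * (1 / 2) ^ n)).
    { intros n.
      assert (G := goursat disc (lacunary_sum n) a b c disc_convex
        (fun z _ => lacunary_sum_holomorphic n z) Ha Hb Hc).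
      assert (E : tri (fun z => lacunary z - lacunary_sum n z)%C a b c = tri lacunary a b c).
      { rewrite <- (Cplus_0_r (tri lacunary a b c)), <- (Copp_0), <- G. unfold tri.
        rewrite !seg_minus by (apply (seg_cont_of _ disc); auto using disc_convex). ring. }
      rewrite <- E. apply (tri_bound _ disc); auto using disc_convex.
      - intros z Hz eps. destruct (HC z Hz (pos_div_2 eps)) as [d Hd].
        destruct (Hn n z (pos_div_2 eps)) as [d' Hd']. simpl in Hd, Hd'.
        exists (pos_min d d'). simpl. intros w _ Hw.
        specialize (Hd w I (Rlt_le_trans _ _ _ Hw (Rmin_l _ _))).
        specialize (Hd' w I (Rlt_le_trans _ _ _ Hw (Rmin_r _ _))).
        replace (lacunary w - lacunary_sum n w - (lacunary z - lacunary_sum n z))%C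
          with ((lacunary w - lacunary z) - (lacunary_sum n w - lacunary_sum n z))%C by ring.
        eapply Rle_lt_trans; [apply Cmod_triangle_minus|]. lra.
      - intros z Hz. rewrite Cmod_minus_sym. apply lacunary_approx. left. exact Hz. }
    apply Cmod_eq_0, Rle_antisym; [|apply Cmod_ge_0].
    apply le_epsilon. intros eps Heps. rewrite Rplus_0_l.
    destruct (pow_half_small (eps / (4 * (P + 1)))) as [n Hn'].
    { apply Rdiv_lt_0_compat; lra. }
    apply Rlt_div_r in Hn'; [|lra]. specialize (Key n). generalize (pow_half_pos n). intros. nra. }
  assert (D0 : disc (RtoC 0)) by (unfold disc; rewrite Cmod_0; lra).
  assert (HF := convex_primitive disc lacunary (RtoC 0) disc_convex disc_open D0 HC HT).
  set (F := fun w => seg lacunary (RtoC 0) w) in *.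
  assert (FH : holomorphic_on disc F) by (intros z Hz; exists (lacunary z); now apply HF).
  apply (holomorphic_ext disc (C_derive F)).
  - apply disc_open.
  - intros z Hz. now apply is_C_derive_unique, HF.
  - apply derivative_holomorphic; [apply disc_open|exact FH].
Qed.

(** * Oscillation of the lacunary series on the circle *)

Lemma cis_opp (t : R) : cis (- t) = Cconj (cis t).
Proof. unfold cis, Cconj; simpl. now rewrite cos_neg, sin_neg. Qed.

Lemma cis_pow (s : R) (n : nat) : (cis s ^ n)%C = cis (INR n * s).
Proof.
  induction n as [|n IH].
  - simpl. now rewrite Rmult_0_l, cis_0.
  - rewrite Cpow_S, IH, <- cis_plus, S_INR. f_equal. ring.
Qed.

Lemma cis_2PI_nat (n : nat) : cis (2 * PI * INR n) = RtoC 1.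
Proof.
  replace (2 * PI * INR n) with (INR n * (2 * PI)) by ring. rewrite <- cis_pow.
  replace (cis (2 * PI)) with (RtoC 1) by (unfold cis; rewrite cos_2PI, sin_2PI; reflexivity).
  apply Cpow_1_l.
Qed.

Lemma cis_2PI_Z (m : Z) : cis (2 * PI * IZR m) = RtoC 1.
Proof.
  destruct (Z.le_gt_cases 0 m) as [H | H].
  - rewrite <- (Z2Nat.id m H), <- INR_IZR_INZ. apply cis_2PI_nat.
  - replace (2 * PI * IZR m) with (- (2 * PI * IZR (- m))) by (rewrite opp_IZR; ring).
    rewrite <- (Z2Nat.id (- m)) by lia. rewrite <- INR_IZR_INZ, cis_opp, cis_2PI_nat.
    unfold Cconj, RtoC; simpl. f_equal. ring.
Qed.

Lemma cis_lipschitz (s t : R) : Cmod (cis t - cis s) <= Rabs (t - s).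
Proof.
  assert (E : forall x, cis x = Cexp (0, x)).
  { intros x. unfold Cexp, Re, Im; simpl. rewrite exp_0. ring. }
  rewrite !E.
  eapply Rle_trans; [apply (Cderive_lipschitz (fun z => Re z = 0) Cexp 1 (0, s) (0, t))|].
  - intros z w x Hz Hw _. rewrite re_plus, !re_scal_l, Hz, Hw. ring.
  - reflexivity.
  - reflexivity.
  - intros z Hz. exists (Cexp z). split; [apply is_Cderive_Cexp|].
    rewrite Cmod_Cexp, Hz, exp_0. lra.
  - rewrite Rmult_1_l. right.
    replace ((0, t) - (0, s))%C with (Ci * RtoC (t - s))%C
      by (unfold Ci, RtoC, Cminus, Cplus, Copp, Cmult; simpl; f_equal; ring).
    now rewrite Cmod_mult, Cmod_Ci, Cmod_R, Rmult_1_l.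
Qed.

Lemma unimodular_cis (o : C) : Cmod o = 1 -> exists b, cis b = o.
Proof.
  intros H. destruct o as [x y].
  assert (E : x * x + y * y = 1).
  { assert (K := Cmod2_alt (x, y)). rewrite H in K. unfold Re, Im in K; simpl in K. lra. }
  assert (Hx : -1 <= x <= 1) by nra.
  assert (Es : sqrt (1 - x²) = Rabs y).
  { rewrite <- sqrt_Rsqr_abs. f_equal. unfold Rsqr. lra. }
  destruct (Rle_lt_dec 0 y) as [Hy | Hy].
  - exists (acos x). unfold cis. rewrite cos_acos, sin_acos, Es, Rabs_pos_eq by lra. reflexivity.
  - exists (- acos x). unfold cis. rewrite cos_neg, sin_neg, cos_acos, sin_acos, Es by lra.
    rewrite Rabs_left by lra. f_equal. ring.
Qed.

Lemma phase_in_period (a : C) (lam t : R) : 0 < lam ->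
  exists s, t <= s <= t + 2 * PI / lam /\ (a * cis (lam * s))%C = RtoC (Cmod a).
Proof.
  intros Hl. destruct (unimodular_rotation a) as [o [Ho Eo]].
  destruct (unimodular_cis o Ho) as [b Hb]. assert (HPI := PI_RGT_0).
  destruct (archimed ((lam * t - b) / (2 * PI))) as [U1 U2].
  set (m := up ((lam * t - b) / (2 * PI))) in *.
  exists ((b + 2 * PI * IZR m) / lam). split; [split|].
  - apply Rle_div_r; [lra|]. apply Rlt_gt, Rlt_div_l in U1; lra.
  - replace (t + 2 * PI / lam) with ((t * lam + 2 * PI) / lam) by (field; lra).
    apply Rmult_le_compat_r; [left; now apply Rinv_0_lt_compat|].
    assert (U3 : IZR m - 1 <= (lam * t - b) / (2 * PI)) by lra.
    apply Rle_div_r in U3; lra.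
  - replace (lam * ((b + 2 * PI * IZR m) / lam)) with (b + 2 * PI * IZR m) by (field; lra).
    rewrite cis_plus, cis_2PI_Z, Hb, <- Eo. ring.
Qed.

Lemma lacunary_sum_cis_lipschitz (n : nat) (s t : R) :
  Cmod (lacunary_sum n (cis t) - lacunary_sum n (cis s)) <= 64 ^ n / 63 * Rabs (t - s).
Proof.
  induction n as [|n IH].
  - cbn [lacunary_sum]. rewrite Cmod_diag.
    apply Rmult_le_pos; [simpl; lra|apply Rabs_pos].
  - cbn [lacunary_sum]. rewrite !cis_pow.
    set (x := INR (1024 ^ n) * t). set (y := INR (1024 ^ n) * s).
    replace (lacunary_sum n (cis t) + RtoC ((1 / 16) ^ n) * cis x
             - (lacunary_sum n (cis s) + RtoC ((1 / 16) ^ n) * cis y))%C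
      with ((lacunary_sum n (cis t) - lacunary_sum n (cis s))
            + RtoC ((1 / 16) ^ n) * (cis x - cis y))%C by ring.
    eapply Rle_trans; [apply Cmod_triangle|].
    assert (H16 := sixteenth_pow_pos n). rewrite Cmod_mult, Cmod_RtoC_pos by lra.
    assert (L : Cmod (cis x - cis y) <= 1024 ^ n * Rabs (t - s)).
    { eapply Rle_trans; [apply cis_lipschitz|]. unfold x, y.
      rewrite <- Rmult_minus_distr_l, Rabs_mult, (Rabs_pos_eq (INR _)) by apply pos_INR.
      rewrite pow_INR. replace (INR 1024) with 1024 by (rewrite INR_IZR_INZ; reflexivity). lra. }
    apply (Rmult_le_compat_l ((1 / 16) ^ n)) in L; [|lra].
    rewrite <- Rmult_assoc, <- Rpow_mult_distr in L.
    replace (1 / 16 * 1024) with 64 in L by field.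
    replace (64 ^ S n / 63) with (64 ^ n / 63 + 64 ^ n) by (simpl; field).
    rewrite Rmult_plus_distr_r. lra.
Qed.

(** A shift by half a period of the k-th term is a multiple of a full period for
    the terms after it, which therefore cancel; the terms before it vary slowly. *)
Lemma lacunary_oscillation (a : C) (t : R) (k : nat) :
  exists s, t <= s <= t + 2 * PI / 1024 ^ k /\
    Cmod a * (1 / 16) ^ k <=
      Re (a * (lacunary (cis s) - lacunary (cis (s + PI / 1024 ^ k))))%C.
Proof.
  set (lam := 1024 ^ k). assert (Hlam : 0 < lam) by (apply pow_lt; lra).
  assert (HPI := PI_RGT_0).
  destruct (phase_in_period a lam t Hlam) as [s [Hs Ea]].
  exists s. split; [exact Hs|]. set (s' := s + PI / lam).
  assert (EI : INR (1024 ^ k) = lam).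
  { rewrite pow_INR. unfold lam. f_equal. rewrite INR_IZR_INZ. reflexivity. }
  assert (High : forall n, (k < n)%nat -> (cis s' ^ (1024 ^ n))%C = (cis s ^ (1024 ^ n))%C).
  { intros n Hn. replace n with (k + S (n - S k))%nat by lia. set (m := (n - S k)%nat).
    rewrite !cis_pow, Nat.pow_add_r, mult_INR, EI. unfold s'.
    replace (lam * INR (1024 ^ S m) * (s + PI / lam))
      with (lam * INR (1024 ^ S m) * s + PI * INR (1024 ^ S m)) by (field; lra).
    rewrite cis_plus. replace (1024 ^ S m)%nat with (2 * (512 * 1024 ^ m))%nat at 2
      by (rewrite Nat.pow_succ_r'; lia).
    rewrite (mult_INR 2). change (INR 2) with 2. rewrite <- Rmult_assoc, (Rmult_comm PI 2), cis_2PI_nat.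
    ring. }
  assert (Tail : forall n, (S k <= n)%nat ->
     (lacunary_sum n (cis s) - lacunary_sum n (cis s')
      = lacunary_sum (S k) (cis s) - lacunary_sum (S k) (cis s'))%C).
  { intros n Hn. induction Hn as [|n Hn IH]; [reflexivity|].
    rewrite <- IH. cbn [lacunary_sum]. rewrite (High n) by lia. ring. }
  assert (C1 : forall x, Cmod (cis x) <= 1) by (intros; rewrite Cmod_cis; lra).
  assert (EW : (lacunary (cis s) - lacunary (cis s')
                = lacunary_sum (S k) (cis s) - lacunary_sum (S k) (cis s'))%C).
  { apply Ceq_minus, Cmod_eq_0, Rle_antisym; [|apply Cmod_ge_0].
    apply le_epsilon. intros eps Heps. rewrite Rplus_0_l.
    destruct (pow_half_small (eps / 8)) as [N HN]; [lra|]. set (n := (S k + N)%nat).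
    assert (Hn : (1 / 2) ^ n <= (1 / 2) ^ N).
    { unfold n. rewrite pow_add. generalize (pow_half_pos N).
      assert (L1 : (1 / 2) ^ S k <= 1 ^ S k) by (apply pow_incr; lra). rewrite pow1 in L1. intros; nra. }
    rewrite <- (Tail n) by (unfold n; lia).
    assert (A := lacunary_approx (cis s) n (C1 s)).
    assert (B := lacunary_approx (cis s') n (C1 s')).
    replace (lacunary (cis s) - lacunary (cis s') - (lacunary_sum n (cis s) - lacunary_sum n (cis s')))%C
      with ((lacunary_sum n (cis s') - lacunary (cis s')) - (lacunary_sum n (cis s) - lacunary (cis s)))%C
      by ring.
    eapply Rle_trans; [apply Cmod_triangle_minus|]. lra. }
  rewrite EW. cbn [lacunary_sum].
  assert (Ek : (cis s' ^ (1024 ^ k))%C = (- cis (lam * s))%C).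
  { rewrite cis_pow, EI. unfold s'.
    replace (lam * (s + PI / lam)) with (lam * s + PI) by (field; lra).
    rewrite cis_plus. unfold cis at 2. rewrite cos_PI, sin_PI.
    replace (-1, 0) with (- RtoC 1)%C by (unfold RtoC, Copp; simpl; f_equal; ring). ring. }
  rewrite Ek, cis_pow, EI.
  set (D := (lacunary_sum k (cis s') - lacunary_sum k (cis s))%C).
  replace (a * (lacunary_sum k (cis s) + RtoC ((1 / 16) ^ k) * cis (lam * s)
       - (lacunary_sum k (cis s') + RtoC ((1 / 16) ^ k) * - cis (lam * s))))%C
    with (RtoC (2 * (1 / 16) ^ k) * (a * cis (lam * s)) - a * D)%C
    by (unfold D; rewrite RtoC_mult; ring).
  rewrite Ea, re_minus, re_scal_l. change (Re (RtoC (Cmod a))) with (Cmod a).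
  assert (HD : Cmod D <= (1 / 16) ^ k).
  { unfold D. eapply Rle_trans; [apply lacunary_sum_cis_lipschitz|].
    replace (s' - s) with (PI / lam) by (unfold s'; ring).
    rewrite Rabs_pos_eq by (apply Rdiv_le_0_compat; lra).
    replace (64 ^ k / 63 * (PI / lam)) with (PI / 63 * (64 ^ k / lam)) by (field; lra).
    replace (64 ^ k / lam) with ((1 / 16) ^ k).
    - assert (H16 := sixteenth_pow_pos k). assert (PI <= 4) by apply PI_4. nra.
    - unfold lam. rewrite <- (Rmult_1_r ((1 / 16) ^ k)). unfold Rdiv at 2.
      replace 64 with (1 / 16 * 1024) by field. rewrite Rpow_mult_distr. field.
      apply Rgt_not_eq. exact Hlam. }
  assert (B : Re (a * D)%C <= Cmod a * (1 / 16) ^ k).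
  { eapply Rle_trans; [apply Rle_abs|]. eapply Rle_trans; [apply re_le_Cmod|].
    rewrite Cmod_mult. apply Rmult_le_compat_l; [apply Cmod_ge_0|exact HD]. }
  lra.
Qed.

(** * Perturbing by multiples of the lacunary series *)

Lemma pigeonhole (P : nat -> nat -> Prop) (A B : nat) :
  (forall m, (m < A)%nat -> exists j, (j < B)%nat /\ P m j) -> (B < A)%nat ->
  exists m m' j, m <> m' /\ (m < A)%nat /\ (m' < A)%nat /\ P m j /\ P m' j.
Proof.
  intros H HBA. apply NNPP. intros Hno.
  assert (HF : forall m, exists j, (m < A)%nat -> (j < B)%nat /\ P m j).
  { intros m. destruct (lt_dec m A) as [L | L].
    - destruct (H m L) as [j Hj]. now exists j.
    - exists 0%nat. intros; lia. }
  pose (F m := proj1_sig (constructive_indefinite_description _ (HF m))).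
  assert (HF' : forall m, (m < A)%nat -> (F m < B)%nat /\ P m (F m)).
  { intros m. unfold F. exact (proj2_sig (constructive_indefinite_description _ (HF m))). }
  assert (ND : NoDup (map F (seq 0 A))).
  { apply NoDup_map_NoDup_ForallPairs; [|apply seq_NoDup].
    intros m m' Hm Hm' E. apply in_seq in Hm, Hm'. apply NNPP. intros N. apply Hno.
    exists m, m', (F m). destruct (HF' m) as [_ P1]; [lia|]. destruct (HF' m') as [_ P2]; [lia|].
    rewrite <- E in P2. repeat split; auto; lia. }
  assert (L := NoDup_incl_length ND (l' := seq 0 B)).
  rewrite length_map, !length_seq in L. enough (A <= B)%nat by lia. apply L.
  intros j Hj. apply in_map_iff in Hj. destruct Hj as [m [<- Hm]]. apply in_seq in Hm.
  apply in_seq. destruct (HF' m); lia.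
Qed.

(** D is the set of parameters at which v is a boundary value. Asking for a whole
    neighbourhood of t inside D leaves room to test the oscillation of v near t,
    and is a closed condition on t when D is closed. *)
Definition slow_at (D : R -> Prop) (M : R) (v : R -> R) (t : R) : Prop :=
  Rabs t <= M /\ (forall s, Rabs (s - t) <= 1 / M -> D s) /\
  forall s, Rabs (s - t) <= 1 / M -> Rabs (v s - v t) <= M * Rabs (s - t).

(** If two coefficients a, a' have witnesses in a common interval of length
    pi / 1024^k, then the difference of the two functions, which is a - a' times
    the series up to a rotation and a real part, oscillates little near that
    interval, while the series oscillates by 1 / 16^k there. *)
Lemma slow_close (D : R -> Prop) (M : R) (v0 : R -> R) (kap a a' : C) (v v' : R -> R) (t t' : R)
  (k : nat) :
  0 < M -> Cmod kap = 1 ->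
  (forall s, D s -> v s = v0 s + Re (kap * (a * lacunary (cis s)))%C) ->
  (forall s, D s -> v' s = v0 s + Re (kap * (a' * lacunary (cis s)))%C) ->
  slow_at D M v t -> slow_at D M v' t' -> Rabs (t - t') <= PI / 1024 ^ k ->
  16 * M <= 1024 ^ k -> Cmod (a - a') * 64 ^ k <= 56 * M.
Proof.
  intros HM Hkap Ev Ev' [_ [HD Hv]] [_ [HD' Hv']] Htt Hk.
  set (lam := 1024 ^ k) in *. assert (Hlam : 0 < lam) by (apply pow_lt; lra).
  assert (HPI := PI_RGT_0). assert (HPI4 := PI_4).
  destruct (lacunary_oscillation (kap * (a - a'))%C t k) as [s [Hs Hosc]]. fold lam in Hs, Hosc.
  rewrite Cmod_mult, Hkap, Rmult_1_l in Hosc.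
  set (eta := PI / lam) in *. assert (Heta : 0 < eta) by (apply Rdiv_lt_0_compat; lra).
  replace (2 * PI / lam) with (2 * eta) in Hs by (unfold eta; field; lra).
  assert (Hsmall : 4 * eta <= 1 / M).
  { apply Rmult_le_reg_r with M; [exact HM|]. replace (1 / M * M) with 1 by (field; lra).
    apply Rmult_le_reg_r with lam; [exact Hlam|].
    replace (4 * eta * M * lam) with (4 * (PI * M)) by (unfold eta; field; lra).
    assert (PI * M <= 4 * M) by (apply Rmult_le_compat_r; lra). lra. }
  set (s' := s + eta) in *.
  assert (B1 : Rabs (s - t) <= 2 * eta) by (apply Rabs_le; lra).
  assert (B2 : Rabs (s' - t) <= 3 * eta) by (unfold s'; apply Rabs_le; lra).
  apply Rabs_le_between in Htt.
  assert (B3 : Rabs (s - t') <= 3 * eta) by (apply Rabs_le; lra).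
  assert (B4 : Rabs (s' - t') <= 4 * eta) by (unfold s'; apply Rabs_le; lra).
  assert (Ds : D s) by (apply HD; lra). assert (Ds' : D s') by (apply HD; lra).
  assert (V1 := Hv s ltac:(lra)). assert (V2 := Hv s' ltac:(lra)).
  assert (V3 := Hv' s ltac:(lra)). assert (V4 := Hv' s' ltac:(lra)).
  assert (E : (v s - v' s) - (v s' - v' s')
     = Re (kap * (a - a') * (lacunary (cis s) - lacunary (cis s')))%C).
  { rewrite !Ev, !Ev' by assumption.
    replace (kap * (a - a') * (lacunary (cis s) - lacunary (cis s')))%C
      with (kap * (a * lacunary (cis s)) - kap * (a' * lacunary (cis s))
            - (kap * (a * lacunary (cis s')) - kap * (a' * lacunary (cis s'))))%C by ring.
    rewrite !re_minus. ring. }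
  rewrite <- E in Hosc.
  apply (Rmult_le_compat_l M) in B1, B2, B3, B4; try lra.
  apply Rabs_le_between in V1, V2, V3, V4.
  assert (Hm : Cmod (a - a') * (1 / 16) ^ k <= 12 * M * eta) by lra.
  assert (E64 : 64 ^ k = (1 / 16) ^ k * lam).
  { unfold lam. rewrite <- Rpow_mult_distr. f_equal. field. }
  rewrite E64, <- Rmult_assoc.
  apply Rle_trans with (12 * M * eta * lam); [now apply Rmult_le_compat_r; [lra|]|].
  replace (12 * M * eta * lam) with (12 * M * PI) by (unfold eta; field; lra). nra.
Qed.

Lemma pow_unbounded (x : R) : exists k : nat, x < 2 ^ k.
Proof.
  destruct (Pow_x_infinity 2 ltac:(rewrite Rabs_pos_eq; lra) (x + 1)) as [N HN].
  exists N. specialize (HN N (le_n N)). rewrite Rabs_pos_eq in HN; [lra|]. left. apply pow_lt. lra.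
Qed.

(** By [slow_close] the slow coefficients with a slow point in a given short
    interval lie in a set of small diameter; the intervals are too few for these
    sets to cover a fine square grid of coefficients. *)
Lemma exists_not_slow (D : R -> Prop) (N : nat) (v0 : R -> R) (v : C -> R -> R) (kap : C)
  (a0 : C) (eps : R) :
  (1 <= N)%nat -> Cmod kap = 1 -> 0 < eps ->
  (forall a s, D s -> v a s = v0 s + Re (kap * (a * lacunary (cis s)))%C) ->
  exists a, Cmod (a - a0) < eps /\ ~ exists t, slow_at D (INR N) (v a) t.
Proof.
  intros HN Hkap Heps Ev. apply NNPP. intros Hno.
  set (M := INR N). assert (HM : 1 <= M) by (change 1 with (INR 1); now apply le_INR).
  assert (HPI := PI_RGT_0).
  assert (Hsl : forall a, Cmod (a - a0) < eps -> exists t, slow_at D M (v a) t).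
  { intros a Ha. apply NNPP. intros K. apply Hno. now exists a. }
  destruct (pow_unbounded (Rmax (16 * M) (448 * M * M / eps))) as [k Hk].
  assert (K1 := Rle_lt_trans _ _ _ (Rmax_l _ _) Hk). assert (K2 := Rle_lt_trans _ _ _ (Rmax_r _ _) Hk).
  apply Rlt_div_l in K2; [|lra].
  (* There are at most N 1024^k intervals of length pi / 1024^k in [-M, M], so the
     grid has to have more than 32^k sqrt N points on a side. Up to factors that
     depend on N, its mesh is eps / 32^k, while the bound 56 M / 64^k of
     [slow_close] is smaller by 2^k. *)
  set (n := (N * 32 ^ k + 1)%nat).
  assert (E32 : INR (32 ^ k) = 32 ^ k) by (rewrite pow_INR, (INR_IZR_INZ 32); reflexivity).
  assert (H32 : 1 <= 32 ^ k) by (apply pow_R1_Rle; lra).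
  assert (Hn : INR n = M * 32 ^ k + 1) by (unfold n; rewrite plus_INR, mult_INR, E32; reflexivity).
  set (del := eps / (4 * INR n)).
  assert (Hdel : 0 < del) by (apply Rdiv_lt_0_compat; [lra|rewrite Hn; nra]).
  pose (A m := (a0 + (RtoC (del * INR (m mod n)) + Ci * RtoC (del * INR (m / n))))%C).
  set (lam := 1024 ^ k). assert (Hlam : 0 < lam) by (apply pow_lt; lra).
  assert (n0 : n <> 0%nat) by (unfold n; lia).
  destruct (pigeonhole (fun m j => exists t, slow_at D M (v (A m)) t /\
      INR j <= (t + M) * lam / PI < INR j + 1) (n * n) (N * 1024 ^ k)) as [m [m' [j [Nmm [Hm [Hm' [P P']]]]]]].
  - intros m Hm.
    assert (I1 : INR (m mod n) <= INR n) by (apply le_INR; generalize (Nat.mod_upper_bound m n n0); lia).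
    assert (I2 : INR (m / n) <= INR n).
    { apply le_INR. assert (m / n < n)%nat by (apply Nat.Div0.div_lt_upper_bound; lia). lia. }
    assert (Ha : Cmod (A m - a0) < eps).
    { unfold A. replace (a0 + (RtoC (del * INR (m mod n)) + Ci * RtoC (del * INR (m / n))) - a0)%C
        with (RtoC (del * INR (m mod n)) + Ci * RtoC (del * INR (m / n)))%C by ring.
      eapply Rle_lt_trans; [apply Cmod_triangle|].
      generalize (pos_INR (m mod n)) (pos_INR (m / n)). intros J1 J2.
      rewrite Cmod_mult, Cmod_Ci, !Cmod_RtoC_pos by nra.
      assert (Q : del * INR n = eps / 4) by (unfold del; field; rewrite Hn; nra). nra. }
    destruct (Hsl _ Ha) as [t Ht]. assert (Ht' := Ht). destruct Ht' as [Ht1 _].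
    apply Rabs_le_between in Ht1.
    assert (Hx : 0 <= (t + M) * lam / PI) by (apply Rdiv_le_0_compat; [apply Rmult_le_pos; lra|lra]).
    destruct (nfloor_ex _ Hx) as [j Hj]. exists j. split; [|now exists t].
    apply INR_lt. eapply Rle_lt_trans; [apply Hj|].
    rewrite mult_INR, pow_INR, (INR_IZR_INZ 1024). fold M. change (IZR (Z.of_nat 1024)) with 1024.
    fold lam. apply Rlt_div_l; [lra|].
    assert (2 < PI) by (generalize PI2_3_2; unfold PI2; lra).
    assert (0 < M * lam) by (apply Rmult_lt_0_compat; lra).
    assert ((t + M) * lam <= 2 * M * lam) by (apply Rmult_le_compat_r; lra). nra.
  - apply INR_lt. rewrite !mult_INR, Hn, pow_INR, (INR_IZR_INZ 1024).
    change (IZR (Z.of_nat 1024)) with 1024. fold M.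
    replace 1024 with (32 * 32) by ring. rewrite Rpow_mult_distr.
    assert (0 < M * 32 ^ k) by (apply Rmult_lt_0_compat; lra).
    assert (M * (32 ^ k * 32 ^ k) <= (M * 32 ^ k) * (M * 32 ^ k)).
    { replace (M * 32 ^ k * (M * 32 ^ k)) with (M * (M * (32 ^ k * 32 ^ k))) by ring.
      apply Rmult_le_compat_l; [lra|]. assert (0 < 32 ^ k * 32 ^ k) by nra. nra. }
    nra.
  - destruct P as [t [St [T1 T2]]]. destruct P' as [t' [St' [T3 T4]]].
    assert (Htt : Rabs (t - t') <= PI / lam).
    { assert (Q : Rabs ((t - t') * lam / PI) <= 1).
      { replace ((t - t') * lam / PI) with ((t + M) * lam / PI - (t' + M) * lam / PI) by (field; lra).
        apply Rabs_le. lra. }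
      replace (t - t') with ((t - t') * lam / PI * (PI / lam)) by (field; lra).
      assert (0 < PI / lam) by (apply Rdiv_lt_0_compat; lra).
      rewrite Rabs_mult, (Rabs_pos_eq (PI / lam)) by lra. nra. }
    assert (Hpow : 2 ^ k <= lam) by (apply pow_incr; lra).
    assert (C64 := slow_close D M v0 kap (A m) (A m') (v (A m)) (v (A m')) t t' k
      ltac:(lra) Hkap (Ev (A m)) (Ev (A m')) St St' Htt ltac:(fold lam; lra)).
    assert (Hsep : del <= Cmod (A m - A m')).
    { assert (X : Re (A m - A m')%C = del * (INR (m mod n) - INR (m' mod n)))
        by (unfold A, Ci, RtoC, Re; simpl; ring).
      assert (Y : Im (A m - A m')%C = del * (INR (m / n) - INR (m' / n)))
        by (unfold A, Ci, RtoC, Im; simpl; ring).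
      assert (Sep : forall i i' : nat, i <> i' -> 1 <= Rabs (INR i - INR i')).
      { intros i i' Hi. destruct (Nat.lt_total i i') as [L | [L | L]]; [|lia|].
        - apply le_INR in L. rewrite S_INR in L. rewrite Rabs_left1; lra.
        - apply le_INR in L. rewrite S_INR in L. rewrite Rabs_pos_eq; lra. }
      destruct (Nat.eq_dec (m mod n) (m' mod n)) as [E1 | E1].
      - assert (E2 : (m / n <> m' / n)%nat).
        { intros E2. apply Nmm. rewrite (Nat.div_mod_eq m n), (Nat.div_mod_eq m' n). now rewrite E1, E2. }
        eapply Rle_trans; [|apply im_le_Cmod]. rewrite Y, Rabs_mult, (Rabs_pos_eq del) by lra.
        specialize (Sep _ _ E2). nra.
      - eapply Rle_trans; [|apply re_le_Cmod]. rewrite X, Rabs_mult, (Rabs_pos_eq del) by lra.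
        specialize (Sep _ _ E1). nra. }
    assert (E64 : 64 ^ k = 32 ^ k * 2 ^ k) by (rewrite <- Rpow_mult_distr; f_equal; ring).
    assert (H2 : 0 < 2 ^ k) by (apply pow_lt; lra).
    assert (F1 : del * 64 ^ k <= 56 * M).
    { eapply Rle_trans; [|exact C64]. apply Rmult_le_compat_r; [rewrite E64; nra|exact Hsep]. }
    assert (F2 : eps / (8 * (M * 32 ^ k)) <= del).
    { unfold del. apply Rmult_le_compat_l; [lra|]. apply Rinv_le_contravar; rewrite Hn; nra. }
    assert (F3 : eps / (8 * (M * 32 ^ k)) * 64 ^ k = eps * 2 ^ k / (8 * M))
      by (rewrite E64; field; lra).
    assert (F4 : eps * 2 ^ k / (8 * M) <= 56 * M).
    { rewrite <- F3. eapply Rle_trans; [|exact F1]. apply Rmult_le_compat_r; [rewrite E64; nra|exact F2]. }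
    apply (Rmult_le_compat_r (8 * M)) in F4; [|lra].
    replace (eps * 2 ^ k / (8 * M) * (8 * M)) with (eps * 2 ^ k) in F4 by (field; lra). lra.
Qed.

(** * Baire's theorem for the plane of coefficients *)

(** Nested discs whose radii are at least halved at each step. *)
Lemma baire_plane (V : nat -> C -> Prop) (a0 : C) (eps : R) :
  (forall n a, V n a -> exists r, 0 < r /\ forall b, Cmod (b - a) < r -> V n b) ->
  (forall n a r, 0 < r -> exists b, Cmod (b - a) < r /\ V n b) ->
  0 < eps -> exists a, Cmod (a - a0) < eps /\ forall n, V n a.
Proof.
  intros Hopen Hdense Heps.
  pose (good (n : nat) (c c' : C * R) := 0 < snd c' /\ snd c' <= snd c / 2 /\
     Cmod (fst c' - fst c) <= snd c / 2 /\ forall b, Cmod (b - fst c') < 2 * snd c' -> V n b).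
  assert (Hnext : forall n (c : C * R), exists c', 0 < snd c -> good n c c').
  { intros n [a r]. destruct (Rlt_le_dec 0 r) as [Hr | Hr]; [|exists (a, r); simpl; lra].
    destruct (Hdense n a (r / 2)) as [b [Hb Vb]]; [lra|].
    destruct (Hopen n b Vb) as [q [Hq HV]].
    exists (b, Rmin (r / 2) (q / 2)). intros _. unfold good; cbn [fst snd].
    assert (L1 := Rmin_l (r / 2) (q / 2)). assert (L2 := Rmin_r (r / 2) (q / 2)).
    repeat split; try lra.
    - apply Rmin_glb_lt; lra.
    - intros x Hx. apply HV. lra. }
  pose (next n c := proj1_sig (constructive_indefinite_description _ (Hnext n c))).
  assert (Hn : forall n c, 0 < snd c -> good n c (next n c)).
  { intros n c. unfold next. exact (proj2_sig (constructive_indefinite_description _ (Hnext n c))). }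
  set (r0 := Rmin 1 (eps / 2)).
  assert (Hr0 : 0 < r0) by (apply Rmin_glb_lt; lra).
  pose (st := fix st n := match n with O => (a0, r0) | S k => next k (st k) end).
  assert (Hpos : forall n, 0 < snd (st n)).
  { induction n as [|n IH]; [exact Hr0|]. now destruct (Hn n (st n) IH) as [H _]. }
  assert (Hst : forall n, good n (st n) (st (S n))) by (intros n; apply (Hn n (st n)), Hpos).
  assert (Hrad : forall n, snd (st n) <= (1 / 2) ^ n).
  { induction n as [|n IH]; [apply Rmin_l|].
    destruct (Hst n) as [_ [H _]]. simpl ((1 / 2) ^ S n). lra. }
  destruct (geometric_cauchy_lim_C (fun n => fst (st n))) as [l Hl].
  { intros n. destruct (Hst n) as [_ [_ [H _]]]. specialize (Hrad n). specialize (Hpos n). lra. }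
  assert (Hd : forall k n, Cmod (fst (st (n + k)%nat) - fst (st n)) <= snd (st n) - snd (st (n + k)%nat)).
  { induction k as [|k IH]; intros n.
    - rewrite Nat.add_0_r. rewrite Cmod_diag. lra.
    - replace (n + S k)%nat with (S (n + k)) by lia. specialize (IH n).
      destruct (Hst (n + k)%nat) as [_ [H1 [H2 _]]].
      eapply Rle_trans; [apply (Cmod_between _ (fst (st (n + k)%nat)))|]. lra. }
  assert (Hlim : forall n, Cmod (l - fst (st n)) <= snd (st n)).
  { intros n. apply le_epsilon. intros e He.
    destruct (pow_half_small (e / 4)) as [N HN]; [lra|].
    specialize (Hl (n + N)%nat). specialize (Hd N n). cbn beta in Hl.
    assert (Hpw : (1 / 2) ^ (n + N) <= (1 / 2) ^ N).
    { rewrite pow_add. generalize (pow_half_pos N).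
      assert (L1 : (1 / 2) ^ n <= 1 ^ n) by (apply pow_incr; lra). rewrite pow1 in L1. intros; nra. }
    specialize (Hpos (n + N)%nat).
    eapply Rle_trans; [apply (Cmod_between _ (fst (st (n + N)%nat)))|].
    rewrite (Cmod_minus_sym l). lra. }
  exists l. split.
  - eapply Rle_lt_trans; [apply (Hlim 0%nat)|]. simpl. unfold r0. generalize (Rmin_r 1 (eps / 2)). lra.
  - intros n. destruct (Hst n) as [H1 [_ [_ H2]]]. apply H2.
    eapply Rle_lt_trans; [apply Hlim|]. lra.
Qed.

(** * The extended Riemann map *)

Lemma phi_near_finite (Omega : C -> Prop) (phi : C -> option C) (zeta v : C) (eps : R) :
  extended_riemann_map Omega phi -> closed_disc zeta -> phi zeta = Some v -> 0 < eps ->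
  exists d : posreal, forall z, closed_disc z -> Cmod (z - zeta) < d ->
    exists v', phi z = Some v' /\ Cmod (v' - v) < eps.
Proof.
  intros [_ [_ Hc]] Hz E Heps. specialize (Hc zeta Hz). rewrite E in Hc.
  specialize (Hc (fun o => exists v', o = Some v' /\ Cmod (v' - v) < eps)).
  assert (H : sphere_locally (Some v) (fun o => exists v', o = Some v' /\ Cmod (v' - v) < eps)).
  { simpl. apply locally_Cmod. exists (mkposreal eps Heps). intros w Hw. now exists w. }
  specialize (Hc H). apply (proj1 (locally_Cmod zeta _)) in Hc. destruct Hc as [d Hd].
  exists d. intros z Cz Hzd. now apply Hd.
Qed.

Lemma phi_near_infinite (Omega : C -> Prop) (phi : C -> option C) (zeta : C) (M : R) :
  extended_riemann_map Omega phi -> closed_disc zeta -> phi zeta = None ->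
  exists d : posreal, forall z v', closed_disc z -> Cmod (z - zeta) < d ->
    phi z = Some v' -> M < Cmod v'.
Proof.
  intros [_ [_ Hc]] Hz E. specialize (Hc zeta Hz). rewrite E in Hc.
  specialize (Hc (fun o => forall v', o = Some v' -> M < Cmod v')).
  assert (H : sphere_locally None (fun o => forall v', o = Some v' -> M < Cmod v')).
  { simpl. split; [discriminate|]. exists M. intros v Hv v' [= <-]. exact Hv. }
  specialize (Hc H). apply (proj1 (locally_Cmod zeta _)) in Hc. destruct Hc as [d Hd].
  exists d. intros z v' Cz Hzd. now apply Hd.
Qed.

Lemma closed_disc_cis (s : R) : closed_disc (cis s).
Proof. unfold closed_disc. rewrite Cmod_cis. lra. Qed.

(** Approach zeta radially: there the inverse is known, and its Lipschitz bound
    takes over from points of the radius to all points of Omega. *)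
Lemma inverse_boundary_limit (Omega : C -> Prop) (phi : C -> option C) (g h : C -> C) (K : R)
  (zeta v : C) :
  extended_riemann_map Omega phi -> (forall z, disc z -> phi z = Some (g z)) ->
  (forall z, disc z -> Omega (g z)) -> (forall z, disc z -> h (g z) = z) ->
  (forall w w', Omega w -> Omega w' -> Cmod (h w' - h w) <= K * Cmod (w' - w)) ->
  closed_disc zeta -> phi zeta = Some v -> has_lim Omega h v zeta.
Proof.
  intros Hphi Eg Og Hhg HK Cz Ez eps. assert (He := cond_pos eps).
  set (K' := Rabs K + 1). assert (HK' : 0 < K') by (unfold K'; generalize (Rabs_pos K); lra).
  assert (Hd : 0 < eps / (4 * K')) by (apply Rdiv_lt_0_compat; lra).
  destruct (phi_near_finite Omega phi zeta v _ Hphi Cz Ez Hd) as [d Hnear].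
  exists (mkposreal _ Hd). simpl. intros w Ow Hw.
  set (x := Rmin (1 / 2) (Rmin (d / 2) (eps / 4))).
  assert (Hx : 0 < x).
  { repeat apply Rmin_glb_lt; generalize (cond_pos d); lra. }
  assert (X1 : x <= 1 / 2) by apply Rmin_l.
  assert (X2 : x <= d / 2) by (eapply Rle_trans; [apply Rmin_r|apply Rmin_l]).
  assert (X3 : x <= eps / 4) by (eapply Rle_trans; [apply Rmin_r|apply Rmin_r]).
  unfold closed_disc in Cz.
  set (z := (RtoC (1 - x) * zeta)%C).
  assert (Dz : disc z).
  { unfold disc, z. rewrite Cmod_mult, Cmod_RtoC_pos by lra. generalize (Cmod_ge_0 zeta). nra. }
  assert (Hz : Cmod (z - zeta) <= x).
  { unfold z. replace (RtoC (1 - x) * zeta - zeta)%C with (- (RtoC x * zeta))%C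
      by (rewrite RtoC_minus; ring).
    rewrite Cmod_opp, Cmod_mult, Cmod_RtoC_pos by lra. nra. }
  destruct (Hnear z) as [v' [Ev' Hv']].
  { unfold closed_disc. left. exact Dz. }
  { generalize (cond_pos d). lra. }
  rewrite Eg in Ev' by exact Dz. injection Ev' as <-.
  assert (L := HK (g z) w (Og z Dz) Ow). rewrite Hhg in L by exact Dz.
  assert (B : Cmod (w - g z) < eps / (2 * K')).
  { eapply Rle_lt_trans; [apply (Cmod_between w v (g z))|]. rewrite (Cmod_minus_sym v (g z)).
    replace (eps / (2 * K')) with (eps / (4 * K') + eps / (4 * K')) by (field; lra). lra. }
  assert (L' : Cmod (h w - z) < eps / 2).
  { eapply Rle_lt_trans; [exact L|].
    apply Rle_lt_trans with (K' * Cmod (w - g z)).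
    - apply Rmult_le_compat_r; [apply Cmod_ge_0|]. unfold K'. generalize (Rle_abs K). lra.
    - replace (eps / 2) with (K' * (eps / (2 * K'))) by (field; lra).
      apply Rmult_lt_compat_l; auto. }
  eapply Rle_lt_trans; [apply (Cmod_between (h w) z zeta)|]. lra.
Qed.

(** * The space A^p and its seminorms *)

Lemma dist_to_ge (E : C -> Prop) (z : C) (r : R) :
  Rbar_le r (dist_to E z) <-> forall w, E w -> r <= Cmod (z - w).
Proof.
  unfold dist_to. destruct (Glb_Rbar_correct (fun r => exists w, E w /\ r = Cmod (z - w))) as [L G].
  split.
  - intros H w Ew. apply (Rbar_le_trans r _ (Cmod (z - w)) H). apply L. now exists w.
  - intros H. apply G. intros x [w [Ew ->]]. now apply H.
Qed.

Lemma domain_closure (Omega J : C -> Prop) :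
  relatively_open_subset (boundary Omega) J -> forall z, Omega z \/ J z -> closure Omega z.
Proof.
  intros [U [_ HU]] z [Hz | Hz]; [now apply closure_subset|].
  apply HU in Hz. apply Hz.
Qed.

Lemma boundary_of_closure (Omega : C -> Prop) (z : C) :
  closure Omega z -> ~ Omega z -> boundary Omega z.
Proof. intros H N. split; [exact H|]. now apply (closure_subset (fun w => ~ Omega w)). Qed.

(** Points of [Delta] stay away from the part of the boundary outside J, so a
    limit of such points cannot leave Omega and J. *)
Lemma Delta_closed (Omega J : C -> Prop) (m : nat) (z : C) :
  relatively_open_subset (boundary Omega) J -> (1 <= m)%nat ->
  (forall d, 0 < d -> exists z', Delta Omega J m z' /\ Cmod (z' - z) < d) -> Delta Omega J m z.
Proof.
  intros HJ Hm Hz. assert (HX := domain_closure Omega J HJ).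
  assert (HM : 1 <= INR m) by (change 1 with (INR 1); now apply le_INR).
  assert (Hinv : 0 < 1 / INR m) by (apply Rdiv_lt_0_compat; lra).
  assert (Cz : closure Omega z).
  { intros V HV. apply locally_Cmod in HV. destruct HV as [d Hd].
    destruct (Hz (d / 2)) as [z' [[D1 _] Hz']]; [generalize (cond_pos d); lra|].
    destruct (closure_point Omega z' (pos_div_2 d) (HX z' D1)) as [w [Ow Hw]]. simpl in Hw.
    exists w. split; [|exact Ow]. apply Hd.
    eapply Rle_lt_trans; [apply (Cmod_between w z' z)|]. lra. }
  assert (Hdist : forall w, boundary Omega w /\ ~ J w -> 1 / INR m <= Cmod (z - w)).
  { intros w Hw. apply le_epsilon. intros e He. destruct (Hz e He) as [z' [[_ [D2 _]] Hz']].
    assert (D2' := proj1 (dist_to_ge _ _ _) D2 w Hw).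
    generalize (Cmod_between z' z w). lra. }
  split; [|split].
  - destruct (classic (Omega z)) as [Oz | Nz]; [now left|right].
    apply NNPP. intros NJ. assert (B := boundary_of_closure Omega z Cz Nz).
    specialize (Hdist z (conj B NJ)). replace (z - z)%C with (RtoC 0) in Hdist by ring.
    rewrite Cmod_0 in Hdist. lra.
  - now apply dist_to_ge.
  - apply le_epsilon. intros e He. destruct (Hz e He) as [z' [[_ [_ D3]] Hz']].
    generalize (Cmod_ge_minus z z'). rewrite (Cmod_minus_sym z z'). lra.
Qed.

Lemma Ap_deriv_lim (Omega J : C -> Prop) (p l : nat) (f : Ap Omega J p) (z : C) :
  relatively_open_subset (boundary Omega) J -> (l <= p)%nat -> Omega z \/ J z ->
  has_lim Omega (C_derive_n l (Ap_fun f)) z (Ap_deriv f l z).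
Proof.
  intros HJ Hl Hz. destruct f as [f [Hf0 [Hf1 Hf2]]].
  apply (extends_has_lim Omega J); [now apply Hf2|now apply (domain_closure Omega J)|exact Hz].
Qed.

Lemma Ap_holomorphic (Omega J : C -> Prop) (p : nat) (f : Ap Omega J p) :
  holomorphic_on Omega (Ap_fun f).
Proof. apply (proj2_sig f). Qed.

Lemma Ap_lin_lim (Omega J : C -> Prop) (p l : nat) (f g : Ap Omega J p) (a z : C) :
  open Omega -> relatively_open_subset (boundary Omega) J -> (l <= p)%nat -> Omega z \/ J z ->
  has_lim Omega (C_derive_n l (fun z => Ap_fun f z + a * Ap_fun g z)%C) z
    (Ap_deriv f l z + a * Ap_deriv g l z)%C.
Proof.
  intros OO HJ Hl Hz.
  apply (has_lim_ext Omega (fun w => C_derive_n l (Ap_fun f) w + a * C_derive_n l (Ap_fun g) w)%C).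
  - intros w Ow. symmetry. apply (C_derive_n_lin Omega); auto; apply Ap_holomorphic.
  - apply has_lim_lin; now apply Ap_deriv_lim.
Qed.

Lemma in_Ap_lin (Omega J : C -> Prop) (p : nat) (f g : Ap Omega J p) (a : C) :
  open Omega -> relatively_open_subset (boundary Omega) J ->
  in_Ap Omega J p (fun z => Ap_fun f z + a * Ap_fun g z)%C.
Proof.
  intros OO HJ. assert (HX := domain_closure Omega J HJ).
  assert (Hol : holomorphic_on Omega (fun z => Ap_fun f z + a * Ap_fun g z)%C).
  { intros z Oz. destruct (Ap_holomorphic _ _ _ f z Oz) as [k Hk].
    destruct (Ap_holomorphic _ _ _ g z Oz) as [k' Hk'].
    exists (k + a * k')%C. apply is_Cderive_plus; [exact Hk|now apply is_Cderive_scal]. }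
  split; [|split; [exact Hol|]].
  - intros z Nz. destruct (proj2_sig f) as [F0 _], (proj2_sig g) as [G0 _]. unfold Ap_fun.
    rewrite F0, G0 by exact Nz. ring.
  - intros l Hl. apply extends_of_lims; [exact HX| |].
    + intros z Oz. apply (holomorphic_cont Omega); [|exact Oz].
      now apply C_derive_n_holomorphic.
    + intros z Hz. assert (L := Ap_lin_lim Omega J p l f g a z OO HJ Hl Hz).
      now rewrite (extension_lim _ _ _ _ (HX z Hz) L).
Qed.

Lemma Ap_minus_extension (Omega J : C -> Prop) (p l : nat) (f g : Ap Omega J p) (z : C) :
  open Omega -> relatively_open_subset (boundary Omega) J -> (l <= p)%nat -> Omega z \/ J z ->
  extension Omega (C_derive_n l (fun z => Ap_fun g z - Ap_fun f z)%C) z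
    = (Ap_deriv g l z - Ap_deriv f l z)%C.
Proof.
  intros OO HJ Hl Hz. apply extension_lim; [now apply (domain_closure Omega J)|].
  replace (Ap_deriv g l z - Ap_deriv f l z)%C
    with (Ap_deriv g l z + RtoC (-1) * Ap_deriv f l z)%C
    by ring.
  apply (has_lim_ext Omega (C_derive_n l (fun z => Ap_fun g z + RtoC (-1) * Ap_fun f z)%C)).
  - intros w Ow. symmetry. apply (C_derive_n_ext Omega); auto.
    + intros y _. ring.
    + intros y Oy. destruct (Ap_holomorphic _ _ _ g y Oy) as [k Hk].
      destruct (Ap_holomorphic _ _ _ f y Oy) as [k' Hk'].
      eexists. apply is_Cderive_plus; [exact Hk|apply is_Cderive_scal, Hk'].
  - now apply Ap_lin_lim.
Qed.

Lemma seminorm_lt_bound (Omega J : C -> Prop) (p l m : nat) (f g : Ap Omega J p) (eps : R) (z : C) :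
  open Omega -> relatively_open_subset (boundary Omega) J -> (l <= p)%nat ->
  Rbar_lt (seminorm Omega J l m (fun z => Ap_fun g z - Ap_fun f z)%C) eps ->
  Delta Omega J m z -> Cmod (Ap_deriv g l z - Ap_deriv f l z) < eps.
Proof.
  intros OO HJ Hl Hs Hz. unfold seminorm in Hs.
  rewrite <- (Ap_minus_extension Omega J p l f g z OO HJ Hl) by apply Hz.
  match type of Hs with Rbar_lt (Lub_Rbar ?E) _ => destruct (Lub_Rbar_correct E) as [U _] end.
  apply (Rbar_le_lt_trans (Cmod _) _ eps (U _ (or_intror (ex_intro _ z (conj Hz eq_refl)))) Hs).
Qed.

Lemma bound_seminorm_lt (Omega J : C -> Prop) (p l m : nat) (f g : Ap Omega J p) (c eps : R) :
  open Omega -> relatively_open_subset (boundary Omega) J -> (l <= p)%nat ->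
  (forall z, Delta Omega J m z -> Cmod (Ap_deriv g l z - Ap_deriv f l z) <= c) ->
  0 <= c < eps -> Rbar_lt (seminorm Omega J l m (fun z => Ap_fun g z - Ap_fun f z)%C) eps.
Proof.
  intros OO HJ Hl Hb Hc. unfold seminorm.
  match goal with |- Rbar_lt (Lub_Rbar ?E) _ => destruct (Lub_Rbar_correct E) as [_ L] end.
  apply Rbar_le_lt_trans with c; [|apply Hc].
  apply L. intros x [-> | [z [Hz ->]]]; [apply Hc|].
  rewrite (Ap_minus_extension Omega J p l f g z OO HJ Hl) by apply Hz. now apply Hb.
Qed.

(** The bounds of an element of A^p on the sets [Delta], uniform in the finitely
    many seminorms that define a neighbourhood. *)
Lemma Ap_deriv_bounded (Omega J : C -> Prop) (p N : nat) (w : Ap Omega J p) :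
  relatively_open_subset (boundary Omega) J ->
  (forall l, (l <= p)%nat -> loc_bounded Omega (C_derive_n l (Ap_fun w))) ->
  exists B, 0 < B /\ forall l m z, (l <= p)%nat -> (m <= N)%nat -> Delta Omega J m z ->
    Cmod (Ap_deriv w l z) <= B.
Proof.
  intros HJ Hb.
  assert (H1 : forall l, (l <= p)%nat -> exists B, forall z, Omega z \/ J z -> Cmod z <= INR N ->
     Cmod (Ap_deriv w l z) <= B).
  { intros l Hl. destruct (Hb l Hl (INR N + 1)) as [B HB]. exists (B + 1). intros z Hz HN.
    assert (Cz := domain_closure Omega J HJ z Hz).
    destruct (Ap_deriv_lim Omega J p l w z HJ Hl Hz (mkposreal 1 Rlt_0_1)) as [d Hd]. simpl in Hd.
    destruct (closure_point Omega z (pos_min d (mkposreal 1 Rlt_0_1)) Cz)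
      as [y [Oy Hy]]. simpl in Hy.
    destruct (Rlt_Rmin _ _ _ Hy) as [Y1 Y2].
    specialize (Hd y Oy Y1). specialize (HB y Oy). generalize (Cmod_ge_minus y z). intros.
    generalize (Cmod_ge_minus (Ap_deriv w l z) (C_derive_n l (Ap_fun w) y)).
    rewrite Cmod_minus_sym. intros. assert (Cmod (C_derive_n l (Ap_fun w) y) <= B) by (apply HB; lra).
    lra. }
  assert (H2 : forall q, (q <= p)%nat -> exists B, 0 < B /\ forall l z, (l <= q)%nat ->
     Omega z \/ J z -> Cmod z <= INR N -> Cmod (Ap_deriv w l z) <= B).
  { induction q as [|q IH]; intros Hq.
    - destruct (H1 0%nat Hq) as [B HB]. exists (Rmax B 1).
      split; [eapply Rlt_le_trans; [|apply Rmax_r]; lra|].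
      intros l z Hl Hz HN. replace l with 0%nat by lia. eapply Rle_trans; [now apply HB|apply Rmax_l].
    - destruct IH as [B [HB0 HB]]; [lia|]. destruct (H1 (S q) Hq) as [B' HB'].
      exists (Rmax B B'). split; [eapply Rlt_le_trans; [exact HB0|apply Rmax_l]|].
      intros l z Hl Hz HN. destruct (Nat.eq_dec l (S q)) as [-> | Hne].
      + eapply Rle_trans; [now apply HB'|apply Rmax_r].
      + eapply Rle_trans; [apply HB; auto; lia|apply Rmax_l]. }
  destruct (H2 p (le_n p)) as [B [HB0 HB]]. exists B. split; [exact HB0|].
  intros l m z Hl Hm [D1 [_ D3]]. apply HB; auto.
  apply Rle_trans with (INR m); [exact D3|now apply le_INR].
Qed.

(** * Boundary traces *)

(** The factor kap selects the real part (kap = 1) or the imaginary part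
    (kap = -i). *)
Definition trace (phi : C -> option C) (kap : C) (F : C -> C) (s : R) : R :=
  Re (kap * comp_phi F phi (cis s))%C.

(** As N grows these sets exhaust the angles of the points that phi maps into J,
    and on the N-th one the trace is controlled by a seminorm with index m = N. *)
Definition seen (Omega J : C -> Prop) (phi : C -> option C) (N : nat) (s : R) : Prop :=
  exists v, phi (cis s) = Some v /\ Delta Omega J N v.

Definition slow (Omega J : C -> Prop) (p : nat) (phi : C -> option C) (kap : C) (N : nat)
    (f : Ap Omega J p) : Prop :=
  exists t, slow_at (seen Omega J phi N) (INR N) (trace phi kap (Ap_deriv f p)) t.

Lemma trace_Some (phi : C -> option C) (kap : C) (F : C -> C) (s : R) (v : C) :
  phi (cis s) = Some v -> trace phi kap F s = Re (kap * F v)%C.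
Proof. intros E. unfold trace, comp_phi. now rewrite E. Qed.

Lemma Re_unimodular_le (kap z w : C) :
  Cmod kap = 1 -> Rabs (Re (kap * z)%C - Re (kap * w)%C) <= Cmod (z - w).
Proof.
  intros Hk. rewrite <- re_minus. eapply Rle_trans; [apply re_le_Cmod|].
  replace (kap * z - kap * w)%C with (kap * (z - w))%C by ring. rewrite Cmod_mult, Hk. lra.
Qed.

Lemma trace_continuous (Omega J : C -> Prop) (p : nat) (phi : C -> option C) (kap : C) (N : nat)
    (f : Ap Omega J p) (s eps : R) :
  relatively_open_subset (boundary Omega) J -> extended_riemann_map Omega phi ->
  Cmod kap = 1 -> seen Omega J phi N s -> 0 < eps ->
  exists d : posreal, forall s', seen Omega J phi N s' -> Rabs (s' - s) < d ->
    Rabs (trace phi kap (Ap_deriv f p) s' - trace phi kap (Ap_deriv f p) s) < eps.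
Proof.
  intros HJ Hphi Hk [v [Ev Dv]] Heps.
  assert (Hc : cont_within (fun z => Omega z \/ J z) (Ap_deriv f p) v).
  { apply (extension_continuous Omega); [now apply domain_closure| |apply Dv].
    intros z Hz. now apply (Ap_deriv_lim Omega J p p f z HJ (le_n p)). }
  destruct (Hc (mkposreal eps Heps)) as [e He]. simpl in He.
  destruct (phi_near_finite Omega phi (cis s) v e Hphi (closed_disc_cis s) Ev (cond_pos e)) as [d Hd].
  exists d. intros s' [v' [Ev' Dv']] Hs'.
  rewrite (trace_Some _ _ _ _ _ Ev), (trace_Some _ _ _ _ _ Ev').
  eapply Rle_lt_trans; [now apply Re_unimodular_le|].
  apply He; [apply Dv'|].
  destruct (Hd (cis s') (closed_disc_cis s')) as [v'' [E'' Hv'']].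
  - eapply Rle_lt_trans; [apply cis_lipschitz|exact Hs'].
  - rewrite Ev' in E''. now injection E'' as <-.
Qed.

Lemma seen_closed (Omega J : C -> Prop) (phi : C -> option C) (N : nat) (s : R) :
  relatively_open_subset (boundary Omega) J -> extended_riemann_map Omega phi -> (1 <= N)%nat ->
  (forall d, 0 < d -> exists s', seen Omega J phi N s' /\ Rabs (s' - s) < d) ->
  seen Omega J phi N s.
Proof.
  intros HJ Hphi HN H. destruct (phi (cis s)) as [v|] eqn:E.
  - exists v. split; [exact E|]. apply Delta_closed; auto. intros e He.
    destruct (phi_near_finite Omega phi (cis s) v e Hphi (closed_disc_cis s) E He) as [d Hd].
    destruct (H d (cond_pos d)) as [s' [[v' [Ev' Dv']] Hs']].
    exists v'. split; [exact Dv'|].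
    destruct (Hd (cis s') (closed_disc_cis s')) as [v'' [E'' Hv'']].
    + eapply Rle_lt_trans; [apply cis_lipschitz|exact Hs'].
    + rewrite Ev' in E''. now injection E'' as <-.
  - exfalso.
    destruct (phi_near_infinite Omega phi (cis s) (INR N) Hphi (closed_disc_cis s) E) as [d Hd].
    destruct (H d (cond_pos d)) as [s' [[v' [Ev' Dv']] Hs']].
    assert (INR N < Cmod v').
    { apply (Hd (cis s')); [apply closed_disc_cis| |exact Ev'].
      eapply Rle_lt_trans; [apply cis_lipschitz|exact Hs']. }
    destruct Dv' as [_ [_ D3]]. lra.
Qed.

(** A cluster point of slow points for functions converging to f is a slow point
    for f, because all the conditions on a slow point are closed. *)
Lemma not_slow_open (Omega J : C -> Prop) (p : nat) (phi : C -> option C) (kap : C) (N : nat) :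
  open Omega -> relatively_open_subset (boundary Omega) J -> extended_riemann_map Omega phi ->
  Cmod kap = 1 -> (1 <= N)%nat -> Ap_open (fun f => ~ slow Omega J p phi kap N f).
Proof.
  intros OO HJ Hphi Hk HN f Hf. apply NNPP. intros Hno. apply Hf. clear Hf.
  set (M := INR N) in *. assert (HM : 1 <= M) by (change 1 with (INR 1); now apply le_INR).
  set (D := seen Omega J phi N) in *.
  assert (HM' : 0 < 1 / M) by (apply Rdiv_lt_0_compat; lra).
  pose (near n (c : Ap Omega J p * R) :=
    (forall z, Delta Omega J N z -> Cmod (Ap_deriv (fst c) p z - Ap_deriv f p z) < / INR (S n)) /\
    slow_at D M (trace phi kap (Ap_deriv (fst c) p)) (snd c)).
  assert (Hseq : forall n, exists c, near n c).
  { intros n. apply NNPP. intros Hn. apply Hno.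
    assert (Hi : 0 < / INR (S n)) by (apply Rinv_0_lt_compat, lt_0_INR; lia).
    exists N, (mkposreal _ Hi). intros g Hg [t Ht]. apply Hn. exists (g, t). split; [|exact Ht].
    intros z Hz. apply (seminorm_lt_bound Omega J p p N f g _ z OO HJ (le_n p)); [|exact Hz].
    now apply Hg. }
  pose (st n := proj1_sig (constructive_indefinite_description _ (Hseq n))).
  assert (Hst : forall n, near n (st n))
    by (intros n; exact (proj2_sig (constructive_indefinite_description _ (Hseq n)))).
  destruct (Bolzano_Weierstrass (fun n => snd (st n)) (fun x => - M <= x <= M)) as [t Ht].
  { apply compact_P3. }
  { intros n. destruct (Hst n) as [_ [H _]]. now apply Rabs_le_between. }
  assert (Hclus : forall d, 0 < d -> exists n, / INR (S n) < d /\ Rabs (snd (st n) - t) < d).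
  { intros d Hd. destruct (archimed_cor1 d Hd) as [k [Hk1 Hk2]].
    destruct (Ht (fun x => Rabs (x - t) < d) k) as [n [Hn1 Hn2]].
    { exists (mkposreal d Hd). intros x Hx. exact Hx. }
    exists n. split; [|exact Hn2]. eapply Rle_lt_trans; [|exact Hk1].
    apply Rinv_le_contravar; [now apply lt_0_INR|]. apply le_INR. lia. }
  exists t.
  assert (HD : forall s, Rabs (s - t) <= 1 / M -> D s).
  { intros s Hs. apply seen_closed; auto. intros d Hd. destruct (Hclus d Hd) as [n [_ Hn]].
    exists (snd (st n) + (s - t)). split.
    - destruct (Hst n) as [_ [_ [H _]]]. apply H.
      now replace (snd (st n) + (s - t) - snd (st n)) with (s - t) by ring.
    - now replace (snd (st n) + (s - t) - s) with (snd (st n) - t) by ring. }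
  split; [|split; [exact HD|]].
  - apply le_epsilon. intros e He. destruct (Hclus e He) as [n [_ Hn]].
    destruct (Hst n) as [_ [H _]]. replace t with (snd (st n) + - (snd (st n) - t)) by ring.
    eapply Rle_trans; [apply Rabs_triang|]. rewrite Rabs_Ropp. fold M. lra.
  - intros s Hs. apply le_epsilon. intros e He.
    assert (Dt : D t) by (apply HD; rewrite Rminus_diag, Rabs_R0; lra).
    destruct (trace_continuous Omega J p phi kap N f s (e / 4) HJ Hphi Hk (HD s Hs)) as [d1 H1]; [lra|].
    destruct (trace_continuous Omega J p phi kap N f t (e / 4) HJ Hphi Hk Dt) as [d2 H2]; [lra|].
    set (u := trace phi kap (Ap_deriv f p)) in *.
    assert (Hd : 0 < Rmin (e / 4) (Rmin d1 d2)) by (repeat apply Rmin_glb_lt; try apply cond_pos; lra).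
    destruct (Hclus _ Hd) as [n [Hn1 Hn2]].
    destruct (Rlt_Rmin _ _ _ Hn1) as [L1 _]. destruct (Rlt_Rmin _ _ _ Hn2) as [_ L].
    destruct (Rlt_Rmin _ _ _ L) as [L2 L3].
    destruct (Hst n) as [Hg [_ [HDn Hsl]]].
    set (tn := snd (st n)) in *. set (un := trace phi kap (Ap_deriv (fst (st n)) p)) in *.
    set (sn := tn + (s - t)).
    assert (Esn : sn - tn = s - t) by (unfold sn; ring).
    assert (Dsn : D sn) by (apply HDn; now rewrite Esn).
    assert (Dtn : D tn) by (apply HDn; rewrite Rminus_diag, Rabs_R0; lra).
    assert (Hclose : forall x, D x -> Rabs (un x - u x) < e / 4).
    { intros x [v [Ev Dv]]. unfold un, u. rewrite !(trace_Some _ _ _ _ _ Ev).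
      eapply Rle_lt_trans; [now apply Re_unimodular_le|]. specialize (Hg v Dv). lra. }
    assert (A1 := Hclose sn Dsn). assert (A2 := Hclose tn Dtn).
    assert (A3 := H1 sn Dsn). replace (sn - s) with (tn - t) in A3 by (unfold sn; ring).
    specialize (A3 L2). assert (A4 := H2 tn Dtn L3).
    assert (A5 := Hsl sn). rewrite Esn in A5. specialize (A5 Hs).
    apply Rabs_lt_between in A1, A2, A3, A4. apply Rabs_le_between in A5. fold M in A5 |- *. apply Rabs_le. lra.
Qed.

(** * Differentiability implies slowness *)

(** J is relatively open, so the points of the closure of Omega close to a point of J
    belong to Omega or J and stay away from the rest of the boundary. *)
Lemma seen_near (Omega J : C -> Prop) (phi : C -> option C) (theta : R) :
  relatively_open_subset (boundary Omega) J -> extended_riemann_map Omega phi ->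
  phi_preimage phi J (cis theta) ->
  exists R0, forall N, R0 <= INR N -> forall s, Rabs (s - theta) <= 1 / INR N -> seen Omega J phi N s.
Proof.
  intros [U [OU HU]] Hphi [_ [v [Ev Jv]]]. assert (Uv := proj2 (proj1 (HU v) Jv)).
  destruct (open_Cmod U v OU Uv) as [r Hr].
  destruct (phi_near_finite Omega phi (cis theta) v (r / 2) Hphi (closed_disc_cis theta) Ev) as [d Hd].
  { generalize (cond_pos r). lra. }
  assert (Pr := cond_pos r). assert (Pd := cond_pos d).
  exists (Rmax 1 (Rmax (2 / r) (Rmax (2 / d) (Cmod v + r)))). intros N HN s Hs.
  destruct (Rmax_Rle _ _ _ HN) as [N1 N']. destruct (Rmax_Rle _ _ _ N') as [N2 N''].
  destruct (Rmax_Rle _ _ _ N'') as [N3 N4].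
  assert (Inv : forall x, 0 < x -> 2 / x <= INR N -> 1 / INR N <= x / 2).
  { intros x Hx Hx'. apply Rmult_le_reg_r with (INR N); [lra|].
    replace (1 / INR N * INR N) with 1 by (field; lra).
    apply (Rmult_le_compat_l (x / 2)) in Hx'; [|lra].
    replace (x / 2 * (2 / x)) with 1 in Hx' by (field; lra). exact Hx'. }
  assert (I2 := Inv r Pr N2). assert (I3 := Inv d Pd N3).
  destruct (Hd (cis s) (closed_disc_cis s)) as [v' [Ev' Hv']].
  { eapply Rle_lt_trans; [apply cis_lipschitz|]. lra. }
  exists v'. split; [exact Ev'|].
  assert (Cv' : closure Omega v').
  { destruct Hphi as [_ [H _]]. apply (H (cis s)); [apply closed_disc_cis|exact Ev']. }
  split; [|split].
  - destruct (classic (Omega v')) as [O | NO]; [now left|right].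
    apply HU. split; [now apply boundary_of_closure|]. apply Hr. lra.
  - apply dist_to_ge. intros b [Bb NJb]. apply Rnot_lt_le. intros Hlt. apply NJb, HU.
    split; [exact Bb|]. apply Hr.
    eapply Rle_lt_trans; [apply (Cmod_between b v' v)|]. rewrite (Cmod_minus_sym b v'). lra.
  - generalize (Cmod_ge_minus v' v). lra.
Qed.

Lemma differentiable_slow (Omega J : C -> Prop) (p : nat) (phi : C -> option C) (kap : C)
    (f : Ap Omega J p) (theta : R) :
  relatively_open_subset (boundary Omega) J -> extended_riemann_map Omega phi ->
  phi_preimage phi J (cis theta) -> ex_derive (trace phi kap (Ap_deriv f p)) theta ->
  exists R0, forall N, R0 <= INR N -> slow Omega J p phi kap N f.
Proof.
  intros HJ Hphi HL [l Hl]. set (u := trace phi kap (Ap_deriv f p)) in *.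
  destruct (seen_near Omega J phi theta HJ Hphi HL) as [R0 HR0].
  assert (Hlim : derivable_pt_lim u theta l) by now apply is_derive_Reals.
  destruct (Hlim 1 Rlt_0_1) as [d Hd]. assert (Pd := cond_pos d).
  exists (Rmax R0 (Rmax (Rabs theta) (Rmax (Rabs l + 1) (2 / d)))). intros N HN.
  destruct (Rmax_Rle _ _ _ HN) as [N1 N']. destruct (Rmax_Rle _ _ _ N') as [N2 N''].
  destruct (Rmax_Rle _ _ _ N'') as [N3 N4].
  assert (Pl := Rabs_pos l). assert (HM : 0 < INR N) by lra.
  assert (I : 1 / INR N < d).
  { apply Rmult_lt_reg_r with (INR N); [lra|].
    replace (1 / INR N * INR N) with 1 by (field; lra).
    apply (Rmult_le_compat_l d) in N4; [|lra].
    replace (d * (2 / d)) with 2 in N4 by (field; lra). lra. }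
  exists theta. split; [exact N2|]. split; [exact (HR0 N N1)|].
  intros s Hs. fold u. destruct (Req_dec (s - theta) 0) as [E | E].
  - replace s with theta by lra. rewrite !Rminus_diag, Rabs_R0. lra.
  - specialize (Hd (s - theta) E). replace (theta + (s - theta)) with s in Hd by ring.
    assert (Hd' := Hd ltac:(lra)).
    replace (u s - u theta) with (((u s - u theta) / (s - theta)) * (s - theta)) by (field; exact E).
    rewrite Rabs_mult. apply Rmult_le_compat_r; [apply Rabs_pos|].
    set (q := (u s - u theta) / (s - theta)) in *.
    replace q with ((q - l) + l) by ring. eapply Rle_trans; [apply Rabs_triang|]. lra.
Qed.

(** * Density *)

(** The inverse of phi is Lipschitz, so the lacunary series composed with it is
    uniformly continuous, and so are its antiderivatives on bounded sets. On
    boundary points read through phi the composition gives back the series. *)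
Lemma lacunary_antiderivative (Omega J : C -> Prop) (p : nat) (phi : C -> option C) :
  is_domain Omega -> convex Omega -> relatively_open_subset (boundary Omega) J ->
  (exists z, boundary Omega z /\ ~ J z) -> extended_riemann_map Omega phi ->
  exists w : Ap Omega J p,
    (forall l, (l <= p)%nat -> loc_bounded Omega (C_derive_n l (Ap_fun w))) /\
    forall zeta v, closed_disc zeta -> phi zeta = Some v -> Omega v \/ J v ->
      Ap_deriv w p v = lacunary zeta.
Proof.
  intros [OO [[z0 Oz0] _]] CO HJ [b [[_ Hb] _]] Hphi. assert (HX := domain_closure Omega J HJ).
  assert (NO : exists z, ~ Omega z).
  { destruct (closure_point _ b (mkposreal 1 Rlt_0_1) Hb) as [z [Nz _]]. now exists z. }
  assert (Hphi' := Hphi).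
  destruct Hphi' as [[g [[Hg [Og [h [Hh [Dh [Hhg Hgh]]]]]] Eg]] _].
  destruct (convex_inverse_lipschitz Omega g h OO CO NO Hg Og Hh Dh Hgh) as [K HK].
  pose (P z := lacunary (h z)).
  assert (HP : holomorphic_on Omega P).
  { intros z Oz. destruct (lacunary_holomorphic (h z) (Dh z Oz)) as [k Hk].
    destruct (Hh z Oz) as [k' Hk']. exists (k * k')%C. now apply (is_Cderive_comp lacunary h). }
  assert (Ch : forall z, Omega z -> Cmod (h z) <= 1) by (intros z Oz; left; now apply Dh).
  assert (UP : unif_cont_bdd Omega P).
  { intros M eps. destruct (lacunary_unif_cont eps) as [d Hd].
    assert (HK' : 0 < Rabs K + 1) by (generalize (Rabs_pos K); lra).
    assert (He : 0 < d / (Rabs K + 1)) by (apply Rdiv_lt_0_compat; [apply cond_pos|exact HK']).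
    exists (mkposreal _ He). simpl. intros w w' Ow Ow' _ _ Hw. apply Hd; auto.
    eapply Rle_lt_trans; [now apply HK|].
    assert (A := Cmod_ge_0 (w - w')).
    apply Rle_lt_trans with ((Rabs K + 1) * Cmod (w - w')).
    - apply Rmult_le_compat_r; [exact A|]. generalize (Rle_abs K). lra.
    - apply (Rmult_lt_compat_l (Rabs K + 1)) in Hw; [|exact HK'].
      replace ((Rabs K + 1) * (d / (Rabs K + 1))) with (pos d) in Hw by (field; lra). exact Hw. }
  assert (BP : loc_bounded Omega P).
  { intros M. exists 4. intros z Oz _. now apply lacunary_bounded, Ch. }
  destruct (iterated_antiderivative Omega P z0 p CO OO Oz0 HP UP BP) as [w [W0 [W1 [W2 W3]]]].
  assert (Hw : in_Ap Omega J p w).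
  { split; [exact W0|]. split; [exact W1|]. intros l Hl.
    apply unif_cont_bdd_extends; [exact HX|]. now apply W2. }
  exists (exist _ w Hw). split.
  - intros l Hl. now apply W2.
  - intros zeta v Cz Ez Hv. unfold Ap_deriv. apply extension_lim; [now apply HX|].
    apply (has_lim_ext Omega P); [intros z Oz; symmetry; now apply W3|].
    intros eps. destruct (lacunary_unif_cont eps) as [d Hd].
    destruct (inverse_boundary_limit Omega phi g h K zeta v Hphi Eg Og Hhg HK Cz Ez d) as [e He].
    exists e. intros y Oy Hy. apply Hd; auto.
Qed.

Definition Ap_lin (Omega J : C -> Prop) (p : nat) (OO : open Omega)
    (HJ : relatively_open_subset (boundary Omega) J) (f w : Ap Omega J p) (a : C) : Ap Omega J p :=
  exist _ _ (in_Ap_lin Omega J p f w a OO HJ).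

Lemma Ap_deriv_lin (Omega J : C -> Prop) (p l : nat) (OO : open Omega)
    (HJ : relatively_open_subset (boundary Omega) J) (f w : Ap Omega J p) (a z : C) :
  (l <= p)%nat -> Omega z \/ J z ->
  Ap_deriv (Ap_lin Omega J p OO HJ f w a) l z = (Ap_deriv f l z + a * Ap_deriv w l z)%C.
Proof.
  intros Hl Hz. unfold Ap_deriv at 1. apply extension_lim; [now apply (domain_closure Omega J)|].
  now apply (Ap_lin_lim Omega J p l f w a z).
Qed.

(** Changing f by a function whose derivatives are c times those of w is a small
    change when c is small, because w has finite seminorms. *)
Lemma Ap_close (Omega J : C -> Prop) (p : nat) (w : Ap Omega J p) (U : Ap Omega J p -> Prop)
    (f : Ap Omega J p) :
  open Omega -> relatively_open_subset (boundary Omega) J ->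
  (forall l, (l <= p)%nat -> loc_bounded Omega (C_derive_n l (Ap_fun w))) -> Ap_open U -> U f ->
  exists r, 0 < r /\ forall g c, Cmod c < r ->
    (forall l z, (l <= p)%nat -> Omega z \/ J z ->
       (Ap_deriv g l z - Ap_deriv f l z = c * Ap_deriv w l z)%C) -> U g.
Proof.
  intros OO HJ Hb HU Uf. destruct (HU f Uf) as [N [eps Hg]].
  destruct (Ap_deriv_bounded Omega J p N w HJ Hb) as [B [HB0 HB]].
  exists (eps / B). split; [apply Rdiv_lt_0_compat; [apply cond_pos|exact HB0]|].
  intros g c Hc E. apply Hg. intros l m Hl Hm.
  apply (bound_seminorm_lt Omega J p l m f g (Cmod c * B) eps OO HJ Hl).
  - intros z Hz. rewrite E; [|exact Hl|apply Hz]. rewrite Cmod_mult.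
    apply Rmult_le_compat_l; [apply Cmod_ge_0|]. apply (HB l m); auto. lia.
  - split; [apply Rmult_le_pos; [apply Cmod_ge_0|lra]|].
    apply (Rmult_lt_compat_r B) in Hc; [|exact HB0].
    replace (eps / B * B) with (pos eps) in Hc by (field; lra). exact Hc.
Qed.

Theorem corollary7p3
  (Omega J : C -> Prop) (p : nat) (phi : C -> option C)
  (HOmega : is_domain Omega) (Hconvex : convex Omega) (Hunbounded : unbounded Omega)
  (HJ : relatively_open_subset (boundary Omega) J)
  (HJproper : exists z, boundary Omega z /\ ~ J z)
  (Hphi : extended_riemann_map Omega phi) :
  exists G : Ap Omega J p -> Prop,
    Ap_Gdelta G /\ Ap_dense G /\
    forall f : Ap Omega J p, G f ->
      nowhere_differentiable (phi_preimage phi J)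
        (fun z => Re (comp_phi (Ap_deriv f p) phi z)) /\
      nowhere_differentiable (phi_preimage phi J)
        (fun z => Im (comp_phi (Ap_deriv f p) phi z)).
Proof.
  assert (OO : open Omega) by apply HOmega.
  (* Even indices test the real part, odd ones the imaginary part. *)
  pose (kap (n : nat) := if Nat.even n then RtoC 1 else (- Ci)%C).
  assert (Hkap : forall n, Cmod (kap n) = 1).
  { intros n. unfold kap. destruct (Nat.even n); [apply Cmod_1|]. rewrite Cmod_opp. apply Cmod_Ci. }
  pose (O n (f : Ap Omega J p) := ~ slow Omega J p phi (kap n) (S n) f).
  assert (HO : forall n, Ap_open (O n)) by (intros n; apply not_slow_open; auto; lia).
  exists (fun f => forall n, O n f). split; [|split].
  - exists O. split; [exact HO|]. intros f. reflexivity.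
  - intros U HU [f Uf].
    destruct (lacunary_antiderivative Omega J p phi HOmega Hconvex HJ HJproper Hphi) as [w [Hb Ew]].
    pose (F a := Ap_lin Omega J p OO HJ f w a).
    destruct (Ap_close Omega J p w U f OO HJ Hb HU Uf) as [r [Hr HUr]].
    destruct (baire_plane (fun n a => O n (F a)) (RtoC 0) r) as [a [Ha HVa]].
    + intros n a Va. destruct (Ap_close Omega J p w (O n) (F a) OO HJ Hb (HO n) Va) as [q [Hq HOq]].
      exists q. split; [exact Hq|]. intros b Hba. apply (HOq (F b) (b - a)%C Hba).
      intros l z Hl Hz. unfold F. rewrite !Ap_deriv_lin by assumption. ring.
    + intros n a q Hq.
      apply (exists_not_slow (seen Omega J phi (S n)) (S n) (trace phi (kap n) (Ap_deriv f p))
        (fun a => trace phi (kap n) (Ap_deriv (F a) p)) (kap n) a q); auto; [lia|].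
      intros c s [v [Ev Dv]]. rewrite !(trace_Some _ _ _ _ _ Ev).
      unfold F. rewrite Ap_deriv_lin; [|lia|apply Dv].
      rewrite (Ew (cis s) v (closed_disc_cis s) Ev) by apply Dv.
      rewrite Cmult_plus_distr_l. apply re_plus.
    + exact Hr.
    + exists (F a). split; [|exact HVa]. apply (HUr (F a) a).
      * now replace (a - RtoC 0)%C with a in Ha by ring.
      * intros l z Hl Hz. unfold F. rewrite Ap_deriv_lin by assumption. ring.
  - intros f Gf.
    assert (Key : forall e theta, (e <= 1)%nat -> phi_preimage phi J (cis theta) ->
      ~ ex_derive (trace phi (kap e) (Ap_deriv f p)) theta).
    { intros e theta He HL Hd.
      destruct (differentiable_slow Omega J p phi (kap e) f theta HJ Hphi HL Hd) as [R0 HR0].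
      destruct (INR_unbounded R0) as [m Hm].
      apply (Gf (2 * m + e)%nat).
      assert (Ek : kap (2 * m + e)%nat = kap e).
      { unfold kap. rewrite Nat.even_add, Nat.even_mul. simpl. now destruct (Nat.even e). }
      rewrite Ek. apply HR0. apply Rlt_le, (Rlt_le_trans _ _ _ Hm), le_INR. lia. }
    split; intros theta HL Hd.
    + apply (Key 0%nat theta); [lia|exact HL|].
      eapply ex_derive_ext; [|exact Hd]. intros t. unfold trace, kap. simpl Nat.even.
      now rewrite Cmult_1_l.
    + apply (Key 1%nat theta); [lia|exact HL|].
      eapply ex_derive_ext; [|exact Hd]. intros t. unfold trace, kap. simpl Nat.even. cbv iota.
      destruct (comp_phi (Ap_deriv f p) phi (cis t)) as [x y].
      unfold Ci, Re, Im; simpl. ring.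
Qed.
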